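(* Let $\omega\in P$ be a (quasi)minuscule weight for $R$ and let $D=D^\omega_z$ be the Macdonald operator for the dual system $R^\vee$ acting in $z$ (with $t_\alpha=q^{-m_\alpha}$, $m_\alpha\in\mathbb Z_{\ge0}$). Define $$\psi(x,z)=\prod_{\nu}\bigl(D-\mathfrak m_\omega(x+\nu)\bigr)\left[q^{2(x,z)}Q(z)\right],$$ where $$Q(z)=q^{2(\rho^\vee,z)}\prod_{\alpha\in R_+}\prod_{j=1}^{m_\alpha}[(\alpha^\vee,z)+j]\,[(\alpha^\vee,z)-j],\qquad \mathfrak m_\omega(x)=\sum_{\tau\in W\omega}q^{2(\tau,x)},$$ and the product is taken over all $\nu\neq0$ of the form $\nu=\sum_{\alpha\in R_+}l_\alpha\alpha^\vee$ with $l_\alpha\in\{0,\dots,m_\alpha\}$. Then: (i) $\psi$ has the form $\psi=q^{2(x,z)}\sum_{\nu\in\mathcal N\cap P^\vee}\psi_\nu(x)q^{2(\nu,z)}$, where $\mathcal N=\{\rho^\vee-\sum_{\alpha\in R_+}l_\alpha\alpha^\vee: 0\le l_\alpha\le m_\alpha\}$; (ii) the coefficient $\psi_{-\rho^\vee}$ in this expansion equals $\psi_{-\rho^\vee}=\prod_\nu\bigl(\mathfrak m_\omega(x)-\mathfrak m_\omega(x+\nu)\bigr)\ne0$ (same product over $\nu$; nonzero as a function of $x$); (iii) $\psi$ is a Baker--Akhiezer function for the system $R$ with multiplicities $m=\{m_\alpha\}$; (iv) as a function of $z$, $\psi$ is an eigenfunction of $D$: $D\psi=\mathfrak m_\ome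ga(x)\psi$.
   Context: $V=\mathbb R^n$ is a Euclidean space with scalar product $(\cdot,\cdot)$, extended complex-bilinearly to $V\otimes\mathbb C$; variables $x,z$ range over $V\otimes\mathbb C$. $R\subset V$ is a reduced irreducible root system of rank $n$, $R_+$ positive roots, $W$ the Weyl group, $\alpha^\vee=2\alpha/(\alpha,\alpha)$, $P$, $P^\vee$ the weight and coweight lattices ($P=\{\pi:(\pi,\alpha^\vee)\in\mathbb Z\ \forall\alpha\in R\}$, $P^\vee=\{\pi:(\pi,\alpha)\in\mathbb Z\ \forall\alpha\in R\}$). $q\in\mathbb C^\times$ is not a root of unity, $\log q$ is fixed, $q^a=e^{a\log q}$, $[a]=q^a-q^{-a}$. $m_\alpha\in\mathbb Z_{\ge0}$ are $W$-invariant, and $\rho^\vee=\frac12\sum_{\alpha\in R_+}m_\alpha\alpha^\vee$. A weight $\omega\in P$ is minuscule if $-1\le(\omega,\alpha^\vee)\le1$ for all $\alpha\in R$, quasiminuscule if $\omega\in R$ and $-1\le(\omega,\alpha^\vee)\le1$ for all $\alpha\in R\setminus\{\pm\omega\}$; ''(quasi)minuscule'' means nonzero and one of these. With $(T_z^vf)(z)=f(z+v)$, $$D_z^\omega=\sum_{\tau\in W\omega}a_\tau(T_z^\tau-1)+\sum_{\tau\in W\omega}q^{-2(\rho^\vee,\tau)},\quad a_\tau(z)=\prod_{\alpha\in R,\,(\alpha^\vee,\tau)>0}\frac{[(\alpha^\vee,z)-m_\alpha]}{[(\alpha^\vee,z)]}\prod_{\alpha\in R,\,(\alpha^\vee,\tau)=2}\frac{[(\alpha^\vee,z)-m_\alpha+1]}{[(\alpha^\vee,z)+1]}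 .$$ A Baker--Akhiezer function associated to $\{R,m\}$ is a (nonzero) function $\psi(x,z)=q^{2(x,z)}\sum_{\nu\in\mathcal N\cap P^\vee}\psi_\nu(x)q^{2(\nu,z)}$, with $\mathcal N$ as in (i), such that for each $\alpha\in R$ and $s=1,\dots,m_\alpha$ one has $\psi(x,z+\frac12s\alpha)=\psi(x,z-\frac12s\alpha)$ whenever $q^{2(\alpha^\vee,z)}=1$. *)

(* Defs.v *)
From HB Require Import structures.
From mathcomp Require Import all_boot all_order all_algebra finmap.
From mathcomp Require Import all_classical all_reals all_analysis.
From mathcomp Require Import complex.

Set Implicit Arguments.
Unset Strict Implicit.
Unset Printing Implicit Defensive.

Import Order.TTheory GRing.Theory Num.Theory.

Local Open Scope classical_set_scope.
Local Open Scope ring_scope.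
Local Open Scope complex_scope.

(* Bilinear form with Gram matrix G.  For K = R[i] it is complex bilinear: no
   conjugation is involved. *)
Definition dotp (K : comNzRingType) (n : nat) (G : 'M[K]_n) (u v : 'rV[K]_n) : K :=
  (u *m G *m v^T) 0 0.

Definition scalar_product (R : realType) (n : nat) (G : 'M[R]_n) : Prop :=
  G^T = G /\ forall u : 'rV[R]_n, u != 0 -> 0 < dotp G u u.

Definition toC (R : realType) (n : nat) (v : 'rV[R]_n) : 'rV[R[i]]_n :=
  map_mx (real_complex R) v.

Definition cexp (R : realType) (z : R[i]) : R[i] :=
  (expR (complex.Re z))%:C *
  Complex (cos (complex.Im z)) (sin (complex.Im z)).

Section RootSystems.
Context (R : realType) (n : nat) (G : 'M[R]_n).
Local Notation V := 'rV[R]_n.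
Implicit Types (Phi Pos : {fset V}) (m : V -> nat) (a v omega : V).

Definition coroot a : V := (2 / dotp G a a) *: a.

Definition refl a v : V := v - dotp G v (coroot a) *: a.

Definition root_system Phi : Prop :=
  [/\ <<enum_fset Phi>>%VS = fullv,
      0 \notin Phi,
      forall a b, a \in Phi -> b \in Phi -> refl a b \in Phi &
      forall a b, a \in Phi -> b \in Phi ->
        dotp G b (coroot a) \is a Num.int].

Definition reduced Phi : Prop :=
  forall a (c : R), a \in Phi -> c *: a \in Phi -> c = 1 \/ c = -1.

Definition irreducible_roots Phi : Prop :=
  Phi <> fset0 /\
  forall A B : {fset V}, Phi = (A `|` B)%fset ->
    (forall a b, a \in A -> b \in B -> dotp G a b = 0) ->
    A = fset0 \/ B = fset0.

Definition positive_roots Phi Pos : Prop :=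
  exists v, (forall a, a \in Phi -> dotp G v a != 0) /\
    Pos = [fset a in Phi | 0 < dotp G v a]%fset.

(* Reflections are involutions, so the monoid they generate is the group. *)
Inductive weyl Phi : (V -> V) -> Prop :=
| weyl_id : weyl Phi id
| weyl_refl a w : a \in Phi -> weyl Phi w -> weyl Phi (refl a \o w).

Definition orbit Phi v : set V := [set u | exists2 w, weyl Phi w & u = w v].

Definition weyl_invariant Phi m : Prop :=
  forall w a, weyl Phi w -> a \in Phi -> m (w a) = m a.

Definition weights Phi : set V :=
  [set p | forall a, a \in Phi -> dotp G p (coroot a) \is a Num.int].

Definition coweights Phi : set V :=
  [set p | forall a, a \in Phi -> dotp G p a \is a Num.int].

Definition minuscule Phi omega : Prop :=
  weights Phi omega /\
  forall a, a \in Phi -> -1 <= dotp G omega (coroot a) <= 1.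

Definition quasiminuscule Phi omega : Prop :=
  [/\ weights Phi omega, omega \in Phi &
      forall a, a \in Phi -> a != omega -> a != - omega ->
        -1 <= dotp G omega (coroot a) <= 1].

Definition quasi_or_minuscule Phi omega : Prop :=
  omega != 0 /\ (minuscule Phi omega \/ quasiminuscule Phi omega).

Definition rhov Pos m : V := \sum_(a <- Pos) ((m a)%:R / 2) *: coroot a.

Definition shifts Pos m : set V :=
  [set nu | nu != 0 /\
    exists l : V -> nat, (forall a, a \in Pos -> (l a <= m a)%N) /\
      nu = \sum_(a <- Pos) (l a)%:R *: coroot a].

(* The l a are real here, so this is a (full) convex polytope; the sums below
   range over its coweight lattice points. *)
Definition polytope Pos m : set V :=
  [set nu | exists l : V -> R,
    (forall a, a \in Pos -> 0 <= l a <= (m a)%:R) /\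
    nu = rhov Pos m - \sum_(a <- Pos) l a *: coroot a].

End RootSystems.

Section Operators.
Context (R : realType) (n : nat) (G : 'M[R]_n).
Local Notation V := 'rV[R]_n.
Local Notation VC := 'rV[R[i]]_n.
Context (Phi Pos : {fset V}) (m : V -> nat) (logq : R[i]) (omega : V).
Implicit Types (x z : VC) (f : VC -> R[i]).

Definition cdot (u v : VC) : R[i] := dotp (map_mx (real_complex R) G) u v.

Definition qpow (a : R[i]) : R[i] := cexp (a * logq).

Definition qbr (a : R[i]) : R[i] := qpow a - qpow (- a).

(* (alpha^vee, z) *)
Definition cpair (a : V) z : R[i] := cdot (toC (coroot G a)) z.

Definition a_coef (tau : V) z : R[i] :=
  \prod_(a <- Phi | 0 < dotp G (coroot G a) tau)
     (qbr (cpair a z - (m a)%:R) / qbr (cpair a z)) *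
  \prod_(a <- Phi | dotp G (coroot G a) tau == 2)
     (qbr (cpair a z - (m a)%:R + 1) / qbr (cpair a z + 1)).

Definition macdonald f : VC -> R[i] := fun z =>
  \sum_(tau \in orbit G Phi omega) a_coef tau z * (f (z + toC tau) - f z) +
  (\sum_(tau \in orbit G Phi omega)
      qpow (- (2 * (dotp G (rhov G Pos m) tau)%:C))) * f z.

Definition orbit_sum x : R[i] :=
  \sum_(tau \in orbit G Phi omega) qpow (2 * cdot (toC tau) x).

Definition Qfun z : R[i] :=
  qpow (2 * cdot (toC (rhov G Pos m)) z) *
  \prod_(a <- Pos) \prod_(1 <= j < (m a).+1)
     (qbr (cpair a z + j%:R) * qbr (cpair a z - j%:R)).

Definition shifted_op x (nu : V) f : VC -> R[i] := fun z =>
  macdonald f z - orbit_sum (x + toC nu) * f z.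

(* The operators [shifted_op x nu] (x fixed) are polynomials in [macdonald]
   with scalar coefficients, hence commute: the enumeration order chosen by
   [fset_set] is irrelevant. *)
Definition psi_op x z : R[i] :=
  (\big[(fun F1 F2 => F1 \o F2)/id]_(nu <- fset_set (shifts G Pos m))
     shifted_op x nu)
  (fun z' => qpow (2 * cdot x z') * Qfun z') z.

(* Points at which all iterates of [macdonald] have regular coefficients.  Since
   (alpha^vee, tau) is an integer for tau in the orbit of omega, this set is
   stable under the shifts by tau.  It is the complement of countably many
   complex hyperplanes, hence dense: equality on it is equality of meromorphic
   functions of z.  Elsewhere division by 0 makes [macdonald] meaningless. *)
Definition generic z : Prop :=
  forall (a : V) (k : int), a \in Phi -> qbr (cpair a z + k%:~R) != 0.

Definition BA_form (c : V -> VC -> R[i]) x z : R[i] :=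
  qpow (2 * cdot x z) *
  \sum_(nu \in polytope G Pos m `&` coweights G Phi)
     c nu x * qpow (2 * cdot (toC nu) z).

Definition Baker_Akhiezer (psi : VC -> VC -> R[i]) : Prop :=
  [/\ exists x z, psi x z != 0,
      exists c : V -> VC -> R[i], forall x z, psi x z = BA_form c x z &
      forall (a : V) (s : nat) x z, a \in Phi -> (1 <= s <= m a)%N ->
        qpow (2 * cpair a z) = 1 ->
        psi x (z + (s%:R / 2) *: toC a) = psi x (z - (s%:R / 2) *: toC a)].

End Operators.

(* Main.v *)
Require Import Defs.
From mathcomp Require Import all_boot all_order all_algebra finmap.
From mathcomp Require Import all_classical all_reals all_analysis.
From mathcomp Require Import complex ring lra zify.

Set Implicit Arguments.
Unset Strict Implicit.
Unset Printing Implicit Defensive.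

Import Order.TTheory GRing.Theory Num.Theory.
Local Open Scope classical_set_scope.
Local Open Scope ring_scope.
Local Open Scope complex_scope.

(* Call quasi-invariant an exponential sum in [z] satisfying the conditions of the
   Baker-Akhiezer function.  The operator [D] preserves quasi-invariance: near a
   wall of [alpha], grouping the terms [tau] and [s_alpha tau] makes the poles of
   the coefficients cancel, and the antisymmetric part of the image under the
   reflection vanishes where it must.  For a generic direction [lam], [D]
   multiplies the [lam]-top coefficient, at the exponent [xi], by
   [m_omega (xi - rho_lam)], where [rho_lam] is [rho^vee] for the chamber of [lam].

   The function [q^(2 (x, z)) Q(z)] is quasi-invariant, and its exponents relative
   to [x] lie in [rho^vee] plus twice the zonotope [N].  By triangularity a
   product of operators [D - m_omega (x + u)] kills it.  If the numbers
   [m_omega (x + u)] are distinct, an eigenfunction with eigenvalue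
   [m_omega (x + u)] has top exponent [x + u + rho_lam] for every [lam] at
   once; by convexity this forces [u - rho^vee] into [N], that is, [u] is [0]
   or one of the [nu] of the theorem.  Hence the product over these [nu] gives an
   eigenfunction with eigenvalue [m_omega x], whose exponents lie in [x + N],
   and triangularity in the direction opposite to the positive chamber computes
   its lowest coefficient.  The remaining [x] are reached along lines, on which
   everything is an exponential sum. *)

(** * The exponential and bilinear forms *)

(** The product runs over integral combinations of coroots, whereas the spectral argument yields
    only linear inequalities on exponents. This is why a combinatorial core is needed: a lattice
    point satisfying the inequalities of the zonotope is an integral one ([zint_saturated]), for the
    multiplicities [m] and for [2 m]. Functions are finite sums of exponentials, and three facts
    replace complex analysis: exponentials are linearly independent; a sum vanishing at the far
    points of an arithmetic progression vanishes at its start, so identities need checking only away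
    from poles; a sum with exponents in a suitable lattice coset that vanishes where
    [q^(2 (alpha^vee, z)) = d] is divisible by that linear factor. The (quasi)minuscule condition
    enters through the pairings [(alpha^vee, tau)]: they are 0, 1, -1, 2 or -2, the last two only
    for [tau] equal to [alpha] or [- alpha]. A translation thus leaves the zone controlled by
    quasi-invariance by at most two steps, and there the numerators of the coefficients vanish. *)

Section Exponential.
Context (R : realType).
Local Notation K := R[i].

Lemma rcD (a b : R) : (a + b)%:C = a%:C + b%:C.
Proof. exact: (rmorphD (real_complex R)). Qed.

Lemma rcN (a : R) : (- a)%:C = - a%:C.
Proof. exact: (rmorphN (real_complex R)). Qed.

Lemma rcB (a b : R) : (a - b)%:C = a%:C - b%:C.
Proof. exact: (rmorphB (real_complex R)). Qed.

Lemma rcM (a b : R) : (a * b)%:C = a%:C * b%:C.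
Proof. exact: (rmorphM (real_complex R)). Qed.

Lemma rc_nat (k : nat) : (k%:R : R)%:C = k%:R.
Proof. exact: (rmorph_nat (real_complex R)). Qed.

Lemma rc_int (k : int) : (k%:~R : R)%:C = k%:~R.
Proof. exact: (rmorph_int (real_complex R)). Qed.

Lemma cexpD (z w : K) : cexp (z + w) = cexp z * cexp w.
Proof.
case: z => a b; case: w => c d; rewrite /cexp /= expRD cosD sinD.
by apply/eqP; rewrite eq_complex /=; apply/andP; split; apply/eqP; ring.
Qed.

Lemma cexp0 : cexp 0 = 1 :> K.
Proof.
rewrite /cexp /= expR0 cos0 sin0.
by apply/eqP; rewrite eq_complex /=; apply/andP; split; apply/eqP; ring.
Qed.

Lemma cexp_neq0 (z : K) : cexp z != 0.
Proof.
apply/eqP => z0; have /eqP := cexpD z (- z).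
by rewrite subrr cexp0 z0 mul0r oner_eq0.
Qed.

Lemma cexpN (z : K) : cexp (- z) = (cexp z)^-1.
Proof.
apply: (mulfI (cexp_neq0 z)).
by rewrite -cexpD subrr cexp0 divff // cexp_neq0.
Qed.

Lemma cexp1_neq1 : cexp 1 != 1 :> K.
Proof.
apply/eqP => /eqP; rewrite /cexp /= cos0 sin0 eq_complex /= => /andP[/eqP h _].
have /(@expR_inj R)/eqP : expR 1 = expR 0 :> R by rewrite expR0 -[RHS]h; ring.
by rewrite oner_eq0.
Qed.

Lemma cexp_ipi : cexp (Complex 0 pi) = -1 :> K.
Proof.
rewrite /cexp /= expR0 cospi sinpi.
by apply/eqP; rewrite eq_complex /=; apply/andP; split; apply/eqP; ring.
Qed.

Lemma cexpMn (z : K) (k : nat) : cexp (z * k%:R) = cexp z ^+ k.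
Proof.
elim: k => [|k IH]; first by rewrite mulr0 cexp0.
by rewrite -natr1 mulrDr mulr1 cexpD IH exprSr.
Qed.

Lemma is_derive_Re_cexp (a b : K) :
  is_derive (0 : R) (1 : R) (fun t : R => complex.Re (a * cexp (b * t%:C)))
    (complex.Re (a * b)).
Proof.
case: a => a1 a2; case: b => b1 b2.
have -> : (fun t : R => complex.Re (Complex a1 a2 * cexp (Complex b1 b2 * t%:C))) =
  (fun t => expR (b1 * t) * (a1 * cos (b2 * t) - a2 * sin (b2 * t))).
  by apply/funext => t; rewrite /cexp /= ?(mulr0, subr0, add0r); ring.
apply: is_derive_eq => /=.
rewrite /GRing.scale /= !mulr0 expR0 cos0 sin0; ring.
Qed.

(** Differentiates the real part at 0. Applied to the sum and to [i] times the sum it gives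
    [sum_derivative_eq0], which makes formal derivatives of exponential sums well defined. *)
Lemma sum_derivative_eq0_Re (s : seq (K * K)) :
  (forall t : R, \sum_(p <- s) p.1 * cexp (p.2 * t%:C) = 0) ->
  complex.Re (\sum_(p <- s) p.1 * p.2) = 0.
Proof.
move=> h.
have D : is_derive (0 : R) (1 : R)
   (fun t : R => complex.Re (\sum_(p <- s) p.1 * cexp (p.2 * t%:C)))
   (complex.Re (\sum_(p <- s) p.1 * p.2)).
  elim: s {h} => [|p s IH].
    rewrite big_nil (_ : (fun _ => _) = cst 0); first exact: is_derive_cst.
    by apply/funext => t; rewrite big_nil.
  rewrite big_cons (_ : (fun _ => _) = (fun t : R => complex.Re (p.1 * cexp (p.2 * t%:C)))
    + (fun t : R => complex.Re (\sum_(p <- s) p.1 * cexp (p.2 * t%:C)))).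
    rewrite raddfD; apply: is_deriveD; exact: is_derive_Re_cexp.
  by apply/funext => t; rewrite big_cons raddfD.
have /@derive_val := D; rewrite (_ : (fun _ => _) = cst 0) ?derive_cst //.
by apply/funext => t; rewrite h.
Qed.

Lemma sum_derivative_eq0 (s : seq (K * K)) :
  (forall t : R, \sum_(p <- s) p.1 * cexp (p.2 * t%:C) = 0) ->
  \sum_(p <- s) p.1 * p.2 = 0.
Proof.
move=> h; apply/eqP; rewrite eq_complex sum_derivative_eq0_Re // eqxx /=.
have := @sum_derivative_eq0_Re [seq ('i%C * p.1, p.2) | p <- s].
rewrite !big_map /=.
under [X in complex.Re X]eq_bigr do rewrite -mulrA.
rewrite -mulr_sumr mulrC ReiNIm => H; rewrite -oppr_eq0 H //= => t.
rewrite big_map /=; under eq_bigr do rewrite -mulrA.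
by rewrite -mulr_sumr h mulr0.
Qed.

(** If [Re c] is nonzero, the modulus leaves only [t = 0]; otherwise the periods are so far apart
    that [floor (t * b)] distinguishes them. *)
Lemma countable_periods (c : K) : c != 0 ->
  countable [set t : R | cexp (t%:C * c) = 1].
Proof.
case: c => a b c0.
have re (t : R) : cexp (t%:C * Complex a b) = 1 -> expR (t * a) = 1 /\ sin (t * b) = 0.
  rewrite /cexp /= !mul0r subr0 addr0 => /eqP.
  rewrite eq_complex /= !mul0r subr0 addr0 => /andP[/eqP h1 /eqP h2].
  have e0 : expR (t * a) != 0 by rewrite gt_eqF // expR_gt0.
  have s0 : sin (t * b) = 0 by apply: (mulfI e0); rewrite h2 mulr0.
  split => //; have c0' : 0 < cos (t * b).
    by rewrite -(pmulr_rgt0 _ (expR_gt0 (t * a))) h1 ltr01.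
  by move: h1; have := sin0cos1 s0; rewrite gtr0_norm // => ->; rewrite mulr1.
have [a0|a0] := eqVneq a 0; last first.
  apply: sub_countable (countable1 (0 : R)); apply: subset_card_le => t /re[h _].
  apply/eqP; move/eqP: h.
  by rewrite -(@expR0 R) (inj_eq (@expR_inj R)) mulf_eq0 (negbTE a0) orbF.
have b0 : b != 0 by move: c0; rewrite eq_complex /= a0 eqxx.
apply/countable_injP; exists (fun t => choice.pickle (Num.floor (t * b))).
move=> t u; rewrite !inE => ht hu /(pcan_inj choice.pickleK) e.
have : cexp ((t - u)%:C * Complex a b) = 1.
  by rewrite rmorphB /= mulrBl cexpD cexpN ht hu invr1 mulr1.
move=> /re [_]; rewrite mulrBl => s0.
apply/eqP; rewrite -subr_eq0 -(mulIr_eq0 _ (mulIf b0)) mulrBl; apply/eqP.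
have /andP[t1 t2] := floor_itv (t * b).
have /andP[u1 u2] := floor_itv (u * b).
rewrite -e in u1 u2.
(* Equal floors put [d] strictly between -1 and 1; as [1 < pi], the sine vanishes there only at
   0. *)
set d := _ - _ in s0 *.
have pi1 : 1 < pi :> R by apply: lt_le_trans (pi_ge2 R); rewrite ltr1n.
have d1 : d < pi by apply: lt_trans pi1; rewrite /d; rewrite rmorphD /= in t2 u2; lra.
have d2 : - d < pi by apply: lt_trans pi1; rewrite /d; rewrite rmorphD /= in t2 u2; lra.
have [d0|d0|//] := ltgtP d 0.
  by have := @sin_gt0_pi R (- d); rewrite sinN s0 oppr0 ltxx d2 oppr_gt0 d0 => /(_ isT).
by have := @sin_gt0_pi R d; rewrite s0 ltxx d1 d0 => /(_ isT).
Qed.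

Lemma real_uncountable : ~ countable [set: R].
Proof.
move=> h; have /countable_lebesgue_measure0 : countable (`[0, 1]%classic : set R).
  by apply: sub_countable h; exact: subset_card_le.
rewrite lebesgue_measure_itv /= lte_fin ltr01 oppr0 adde0 => /eqP.
by rewrite onee_eq0.
Qed.

End Exponential.

Section BilinearForm.
Context (K : comNzRingType) (n : nat) (G : 'M[K]_n).
Implicit Types u v w : 'rV[K]_n.

Lemma dotpDl u v w : dotp G (u + v) w = dotp G u w + dotp G v w.
Proof. by rewrite /dotp !mulmxDl mxE. Qed.

Lemma dotpDr u v w : dotp G u (v + w) = dotp G u v + dotp G u w.
Proof. by rewrite /dotp linearD /= mulmxDr mxE. Qed.

Lemma dotpZl a u v : dotp G (a *: u) v = a * dotp G u v.
Proof. by rewrite /dotp -!scalemxAl mxE. Qed.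

Lemma dotpZr a u v : dotp G u (a *: v) = a * dotp G u v.
Proof. by rewrite /dotp linearZ /= -scalemxAr mxE. Qed.

Lemma dotpNl u v : dotp G (- u) v = - dotp G u v.
Proof. by rewrite -scaleN1r dotpZl mulN1r. Qed.

Lemma dotpNr u v : dotp G u (- v) = - dotp G u v.
Proof. by rewrite -scaleN1r dotpZr mulN1r. Qed.

Lemma dotpBl u v w : dotp G (u - v) w = dotp G u w - dotp G v w.
Proof. by rewrite dotpDl dotpNl. Qed.

Lemma dotpBr u v w : dotp G u (v - w) = dotp G u v - dotp G u w.
Proof. by rewrite dotpDr dotpNr. Qed.

Lemma dotp0l v : dotp G 0 v = 0.
Proof. by rewrite -(scale0r 0) dotpZl mul0r. Qed.

Lemma dotp0r v : dotp G v 0 = 0.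
Proof. by rewrite -(scale0r 0) dotpZr mul0r. Qed.

Lemma dotp_suml (I : Type) (s : seq I) (P : pred I) F v :
  dotp G (\sum_(i <- s | P i) F i) v = \sum_(i <- s | P i) dotp G (F i) v.
Proof. exact: (big_morph (dotp G ^~ v) (fun x y => dotpDl x y v) (dotp0l v)). Qed.

Lemma dotp_sumr (I : Type) (s : seq I) (P : pred I) F v :
  dotp G v (\sum_(i <- s | P i) F i) = \sum_(i <- s | P i) dotp G v (F i).
Proof. exact: (big_morph (dotp G v) (dotpDr v) (dotp0r v)). Qed.

Lemma dotpC : G^T = G -> forall u v, dotp G u v = dotp G v u.
Proof.
move=> GT u v; rewrite /dotp.
have -> : v *m G *m u^T = (u *m G *m v^T)^T by rewrite !trmx_mul trmxK GT mulmxA.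
by rewrite [RHS]mxE.
Qed.

End BilinearForm.

Section Complexification.
Context (R : realType) (n : nat) (G : 'M[R]_n) (hG : scalar_product G).
Local Notation V := 'rV[R]_n.
Local Notation VC := 'rV[R[i]]_n.

Lemma toCD (u v : V) : toC (u + v) = toC u + toC v.
Proof. exact: map_mxD. Qed.

Lemma toCN (u : V) : toC (- u) = - toC u.
Proof. exact: map_mxN. Qed.

Lemma toCB (u v : V) : toC (u - v) = toC u - toC v.
Proof. exact: map_mxB. Qed.

Lemma toC0 : toC (0 : V) = 0.
Proof. exact: map_mx0. Qed.

Lemma toCZ a (u : V) : toC (a *: u) = a%:C *: toC u.
Proof. exact: map_mxZ. Qed.

Lemma toC_inj : injective (@toC R n).
Proof. by apply: map_mx_inj => x y []. Qed.

Lemma cdot_toC (u v : V) : cdot G (toC u) (toC v) = (dotp G u v)%:C.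
Proof. by rewrite /cdot /dotp /toC map_trmx -!map_mxM mxE. Qed.

Lemma dotp_real_sym (u v : V) : dotp G u v = dotp G v u.
Proof. by case: hG => GT _; exact: dotpC. Qed.

Lemma cdotC (u v : VC) : cdot G u v = cdot G v u.
Proof. by case: hG => GT _; apply: dotpC; rewrite map_trmx GT. Qed.

Lemma dotp_gt0 (u : V) : u != 0 -> 0 < dotp G u u.
Proof. by case: hG => _; apply. Qed.

Lemma dotp_ge0 (u : V) : 0 <= dotp G u u.
Proof. by have [->|/dotp_gt0/ltW] := eqVneq u 0; rewrite ?dotp0l. Qed.

Lemma dotp_eq0 (u : V) : (dotp G u u == 0) = (u == 0).
Proof.
have [->|/dotp_gt0 u0] := eqVneq u 0; first by rewrite dotp0l eqxx.
by rewrite gt_eqF.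
Qed.

Lemma gram_unit : G \in unitmx.
Proof.
rewrite -row_free_unit; apply: inj_row_free => v v0.
by apply/eqP; rewrite -dotp_eq0 /dotp v0 mul0mx mxE.
Qed.

Lemma cdot_nondegenerate (xi : VC) : xi != 0 -> exists z, cdot G xi z = 1.
Proof.
move=> xi0.
have : xi *m map_mx (real_complex R) G != 0.
  apply: contra_neq xi0 => h.
  have GU : map_mx (real_complex R) G \in unitmx by rewrite map_unitmx gram_unit.
  by rewrite -[xi](mulmxK GU) h mul0mx.
move=> /rV0Pn[j wj]; set w := xi *m _ in wj.
exists ((w 0 j)^-1 *: delta_mx 0 j).
rewrite /cdot dotpZr /dotp -/w trmx_delta; clearbody w.
by rewrite -colE [col _ _ _ _]mxE mulVf.
Qed.

Lemma linear_form_dotp (c : 'cV[R]_n) : exists u : V, forall v, dotp G u v = (v *m c) 0 0.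
Proof.
exists (c^T *m invmx G) => v; rewrite /dotp mulmxKV ?gram_unit //.
by rewrite -[c^T *m _]trmxK trmx_mul !trmxK [LHS]mxE.
Qed.

End Complexification.

Section QPower.
Context (R : realType) (logq : R[i]).
Hypothesis hq : forall k : nat, (0 < k)%N -> cexp logq ^+ k != 1.
Local Notation K := R[i].
Local Notation qpow := (qpow logq).
Local Notation qbr := (qbr logq).

Lemma qpowD a b : qpow (a + b) = qpow a * qpow b.
Proof. by rewrite /qpow mulrDl cexpD. Qed.

Lemma qpow0 : qpow 0 = 1.
Proof. by rewrite /qpow mul0r cexp0. Qed.

Lemma qpow_neq0 a : qpow a != 0.
Proof. exact: cexp_neq0. Qed.

Lemma qpowN a : qpow (- a) = (qpow a)^-1.
Proof. by rewrite /qpow mulNr cexpN. Qed.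

Lemma qpowB a b : qpow (a - b) = qpow a / qpow b.
Proof. by rewrite qpowD qpowN. Qed.

Lemma qpowMn a k : qpow (a * k%:R) = qpow a ^+ k.
Proof. by rewrite /qpow mulrAC cexpMn. Qed.

Lemma logq_neq0 : logq != 0.
Proof. by apply/eqP => h; have := @hq 1 isT; rewrite h cexp0 expr1n eqxx. Qed.

Lemma qpow_int_neq1 (k : int) : k != 0 -> qpow k%:~R != 1.
Proof.
have nat_case m : (0 < m)%N -> qpow (m%:R) != 1.
  by move=> m0; rewrite -[m%:R]mul1r qpowMn /qpow mul1r hq.
case: k => [m|m] k0; first by apply: nat_case; rewrite lt0n.
rewrite NegzE rmorphN qpowN invr_eq1; exact: nat_case.
Qed.

Lemma qpow_int_inj (k l : int) : qpow k%:~R = qpow l%:~R -> k = l.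
Proof.
move=> h; apply/eqP; rewrite -subr_eq0; apply: contraT => /qpow_int_neq1.
by rewrite rmorphB /= qpowB h divff ?eqxx // qpow_neq0.
Qed.

Lemma qbr_eq0 a : (qbr a == 0) = (qpow (2 * a) == 1).
Proof.
rewrite /qbr qpowN subr_eq0 mulr_natl mulr2n qpowD.
have a0 := qpow_neq0 a.
by rewrite -(inj_eq (mulIf a0)) mulVf.
Qed.

Lemma qpow_half_period : exists w : K, qpow w = -1.
Proof. by exists (Complex 0 pi / logq); rewrite /qpow divfK ?logq_neq0 ?cexp_ipi. Qed.

Lemma qpow_invlog_neq1 : qpow logq^-1 != 1.
Proof. by rewrite /qpow mulVf ?logq_neq0 // cexp1_neq1. Qed.

(** For fixed [r], [N] and [l] the forbidden [s] lie in an affine image of the countable set of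
    periods, and countably many such sets cannot exhaust the reals. With this step a line meets the
    walls of a given root for at most one integer parameter. *)
Lemma exists_step (rs : seq R) : (forall r, r \in rs -> r != 0) ->
  exists s : R, forall r (N l : int), r \in rs -> N != 0 ->
    qpow (2 * (s%:C * r%:C * N%:~R + l%:~R)) != 1.
Proof.
move=> rs0; apply: contrapT => H; apply: (@real_uncountable R).
pose T := [set t : R | cexp (t%:C * logq) = 1].
have cT : countable T := countable_periods logq_neq0.
pose bad (i : int * int * R) := (fun t => (t / 2 - i.1.2%:~R) / (i.2 * i.1.1%:~R)) @` T.
apply: (@sub_countable _ _ _ (\bigcup_(i in [set i | i.2 \in rs]) bad i)).
  apply: subset_card_le => s _; apply: contrapT => Hs; apply: H; exists s.
  move=> r N l rrs N0; apply/eqP => E; apply: Hs.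
  have r0 := rs0 _ rrs; have N0' : N%:~R != 0 :> R by rewrite intr_eq0.
  exists (N, l, r); first by [].
  pose t : R := 2 * (s * r * N%:~R + l%:~R).
  have tE : t%:C = 2 * (s%:C * r%:C * N%:~R + l%:~R).
    by rewrite /t rcM rc_nat rcD !rcM !rc_int.
  exists t; first by rewrite /T /= tE.
  by rewrite /t /=; field; rewrite N0' r0.
apply: bigcup_countable => [|i _]; last exact: sub_countable (card_image_le _ _) cT.
have -> : [set i : int * int * R | i.2 \in rs] = [set: int * int] `*` [set` rs].
  by apply/seteqP; split => -[? ?] //= [].
apply: countableX; first exact: countableP.
by apply: finite_set_countable; exact: finite_seq.
Qed.

End QPower.

Lemma eq_big_in (T : Type) (idx : T) (op : T -> T -> T) (I : eqType) (r : seq I)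
    (P P' : pred I) (F F' : I -> T) :
  (forall i, i \in r -> P i = P' i) -> (forall i, i \in r -> P i -> F i = F' i) ->
  \big[op/idx]_(i <- r | P i) F i = \big[op/idx]_(i <- r | P' i) F' i.
Proof.
move=> hP hF; rewrite big_seq_cond [RHS]big_seq_cond.
by apply: eq_big => [i|i /andP[]]; [case ir: (i \in r) => //=; exact: hP|exact: hF].
Qed.

(** * Exponential sums *)

Section ExponentialSums.
Context (K : fieldType).

(** Bezout for [X^k0] and the product of the [X - b], coprime because the [b] are nonzero. The
    coefficients of [p] recover a sum of [a_i] from the sums of [a_i b_i^k] with [k >= k0]; they
    depend on the [b_i] only, and [continuation] rests on this. *)
Lemma shift_weights (bs : seq K) (k0 : nat) : all (fun b => b != 0) bs ->
  exists p : {poly K}, forall b, b \in bs -> p.[b] * b ^+ k0 = 1.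
Proof.
move=> /allP bs0; pose P := \prod_(b <- bs) ('X - b%:P).
have : coprimep 'X^k0 P.
  elim: k0 => [|k IH]; first by rewrite expr0 coprime1p.
  rewrite exprS coprimepMl IH andbT /P.
  elim: bs bs0 {IH P} => [|b bs IH] bs0; first by rewrite big_nil coprimep1.
  rewrite big_cons coprimepMr IH ?andbT => [|c cb]; last by rewrite bs0 // inE cb orbT.
  by rewrite coprimep_XsubC rootX bs0 // inE eqxx.
move=> /Bezout_eq1_coprimepP[[u v] /= e]; exists u => b bbs.
have := congr1 (horner^~ b) e; rewrite hornerD !hornerM hornerXn hornerC => <-.
have -> : P.[b] = 0 by rewrite /P (big_rem b) //= hornerM hornerXsubC subrr mul0r.
by rewrite mulr0 addr0.
Qed.

Lemma exp_sum_shift (T : eqType) (s : seq T) (a b : T -> K) (k0 : nat) (p : {poly K}) :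
  (forall i, i \in s -> p.[b i] * b i ^+ k0 = 1) ->
  \sum_(i <- s) a i = \sum_(j < size p) p`_j * \sum_(i <- s) a i * b i ^+ (k0 + j).
Proof.
move=> h; under [RHS]eq_bigr do rewrite mulr_sumr.
rewrite exchange_big /=; apply: eq_big_seq => i /h e.
rewrite -[LHS]mulr1 -e horner_coef mulr_suml mulr_sumr.
by apply: eq_bigr => j _; rewrite exprD; ring.
Qed.

Lemma exp_sum_tail (T : eqType) (s : seq T) (a b : T -> K) (k0 : nat) :
  (forall i, i \in s -> b i != 0) ->
  (forall k, (k0 <= k)%N -> \sum_(i <- s) a i * b i ^+ k = 0) ->
  \sum_(i <- s) a i = 0.
Proof.
move=> b0 h.
have [|p hp] := @shift_weights [seq b i | i <- s] k0.
  by apply/allP => _ /mapP[i /b0 ? ->].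
rewrite (@exp_sum_shift _ _ _ b k0 p) => [|i si]; last by rewrite hp ?map_f.
by rewrite big1 // => j _; rewrite h ?mulr0 ?leq_addr.
Qed.

End ExponentialSums.

Section Characters.
Context (R : realType) (n : nat) (G : 'M[R]_n) (hG : scalar_product G).
Context (logq : R[i]).
Hypothesis hq : forall k : nat, (0 < k)%N -> cexp logq ^+ k != 1.
Local Notation K := R[i].
Local Notation VC := 'rV[R[i]]_n.
Implicit Types (xi eta z w : VC) (P Q : set VC) (f g : VC -> K).

Definition expc xi z : K := qpow logq (2 * cdot G xi z).
Local Notation ee := expc.

Lemma eeD xi eta z : ee (xi + eta) z = ee xi z * ee eta z.
Proof. by rewrite /ee /cdot dotpDl mulrDr qpowD. Qed.

Lemma ee_sym xi z : ee xi z = ee z xi.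
Proof. by rewrite /ee (cdotC hG). Qed.

Lemma eeDr xi z w : ee xi (z + w) = ee xi z * ee xi w.
Proof. by rewrite /ee /cdot dotpDr mulrDr qpowD. Qed.

Lemma ee0 z : ee 0 z = 1.
Proof. by rewrite /ee /cdot dotp0l mulr0 qpow0. Qed.

Lemma ee_neq0 xi z : ee xi z != 0.
Proof. exact: qpow_neq0. Qed.

Lemma eeN xi z : ee (- xi) z = (ee xi z)^-1.
Proof. by rewrite /ee /cdot dotpNl mulrN qpowN. Qed.

Lemma eeNr xi z : ee xi (- z) = (ee xi z)^-1.
Proof. by rewrite /ee /cdot dotpNr mulrN qpowN. Qed.

Lemma eeMn xi z k : ee xi (k%:R *: z) = ee xi z ^+ k.
Proof. by rewrite /ee /cdot dotpZr -qpowMn; congr qpow; ring. Qed.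

Lemma ee_separates xi : xi != 0 -> exists z, ee xi z != 1.
Proof.
move=> /(cdot_nondegenerate hG)[z z1]; exists ((logq^-1 / 2) *: z).
rewrite /ee /cdot dotpZr; rewrite /cdot in z1; rewrite z1 mulr1 mulrC divfK ?pnatr_eq0 //.
exact: qpow_invlog_neq1.
Qed.

(** Subtracting [ee x0 w] times the relation at [z] from the relation at [z + w] removes [x0]; the
    vector [w] is chosen to separate [xi] from [x0]. *)
Lemma characters_free (t : seq VC) (c : VC -> K) : uniq t ->
  (forall z, \sum_(xi <- t) c xi * ee xi z = 0) -> forall xi, xi \in t -> c xi = 0.
Proof.
elim: t c => [//|x0 t IH] c /= /andP[x0t ut] h.
have c0 xi : xi \in t -> c xi = 0.
  move=> xit; have [|w w1] := @ee_separates (xi - x0).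
    by rewrite subr_eq0; apply: contraNneq x0t => <-.
  have : c xi * (ee xi w - ee x0 w) = 0.
    apply: (IH (fun xi => c xi * (ee xi w - ee x0 w))) => // z.
    have h1 : c x0 * ee x0 z + \sum_(xi <- t) c xi * ee xi z = 0 by rewrite -[RHS](h z) big_cons.
    have h2 : c x0 * ee x0 z * ee x0 w + \sum_(xi <- t) c xi * ee xi (z + w) = 0.
      by rewrite -[RHS](h (z + w)) big_cons eeDr mulrA.
    have : 0 * ee x0 w = 0 by rewrite mul0r.
    rewrite -{1}h1 -[in RHS]h2 mulrDl => /addrI /eqP.
    rewrite eq_sym -subr_eq0 mulr_suml -sumrB => /eqP H; rewrite -[RHS]H.
    apply: eq_bigr => i _; rewrite eeDr.
    by move: (ee i z) (ee i w) (ee x0 w) => u1 u2 u3; ring.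
  move=> /eqP; rewrite mulf_eq0 => /orP[/eqP //|]; rewrite subr_eq0 => /eqP e.
  by move: w1; rewrite eeD eeN e divff ?eqxx ?ee_neq0.
move=> xi; rewrite inE => /orP[/eqP->|]; last exact: c0.
have := h 0; rewrite big_cons big1_seq ?addr0 => [/eqP|i /andP[_ /c0->]]; last by rewrite mul0r.
by rewrite mulf_eq0 (negbTE (ee_neq0 _ _)) orbF => /eqP.
Qed.

Definition ev (s : seq (K * VC)) z : K := \sum_(p <- s) p.1 * ee p.2 z.

Definition coef (s : seq (K * VC)) xi : K := \sum_(p <- s | p.2 == xi) p.1.

Lemma ev_coef s (t : seq VC) z : uniq t -> {subset [seq p.2 | p <- s] <= t} ->
  ev s z = \sum_(xi <- t) coef s xi * ee xi z.
Proof.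
move=> ut st; under eq_bigr do rewrite /coef mulr_suml.
rewrite (exchange_big_dep xpredT) //=; apply: eq_big_seq => p ps.
rewrite big_mkcond (bigD1_seq p.2) ?st ?map_f //= eqxx big1 ?addr0 // => x xp.
by rewrite eq_sym (negbTE xp).
Qed.

Lemma coef_supp s xi : coef s xi != 0 -> exists2 p, p \in s & p.2 = xi.
Proof.
move=> h; apply: contrapT => H; move/eqP: h; apply.
rewrite /coef big_seq_cond big1 // => p /andP[ps /eqP e].
by case: H; exists p.
Qed.

Lemma coef_ev s s' : ev s =1 ev s' -> coef s =1 coef s'.
Proof.
move=> h xi; pose t := undup (xi :: [seq p.2 | p <- s] ++ [seq p.2 | p <- s']).
apply/eqP; rewrite -subr_eq0; apply/eqP.
apply: (@characters_free t (fun xi => coef s xi - coef s' xi)).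
- exact: undup_uniq.
- move=> z; under eq_bigr do rewrite mulrBl.
  rewrite sumrB -!ev_coef ?undup_uniq //; first by rewrite h subrr.
    by move=> x xs; rewrite mem_undup inE mem_cat xs !orbT.
  by move=> x xs; rewrite mem_undup inE mem_cat xs !orbT.
- by rewrite mem_undup inE eqxx.
Qed.

(* Exponential sums with spectrum in [P]. *)
Definition sp P f : Prop :=
  exists2 s, (forall p, p \in s -> P p.2) & f =1 ev s.

Lemma sp_sub P Q f : P `<=` Q -> sp P f -> sp Q f.
Proof. by move=> PQ [s sP fs]; exists s => // p /sP /PQ. Qed.

Lemma sp_ext P f g : f =1 g -> sp P f -> sp P g.
Proof. by move=> fg [s sP fs]; exists s => // z; rewrite -fg. Qed.

Lemma sp0 P : sp P (fun=> 0).
Proof. by exists [::] => // z; rewrite /ev big_nil. Qed.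

Lemma sp_mono P a xi : P xi -> sp P (fun z => a * ee xi z).
Proof.
move=> Px; exists [:: (a, xi)]; first by move=> p; rewrite inE => /eqP->.
by move=> z; rewrite /ev big_seq1.
Qed.

Lemma sp_ee P xi : P xi -> sp P (ee xi).
Proof. by move=> /(sp_mono 1); apply: sp_ext => z; rewrite mul1r. Qed.

Lemma sp_cst P a : P 0 -> sp P (fun=> a).
Proof. by move=> /(sp_mono a); apply: sp_ext => z; rewrite ee0 mulr1. Qed.

Lemma spD P f g : sp P f -> sp P g -> sp P (fun z => f z + g z).
Proof.
move=> [s sP fs] [t tP gt]; exists (s ++ t).
  by move=> p; rewrite mem_cat => /orP[/sP|/tP].
by move=> z; rewrite /ev big_cat fs gt.
Qed.

Lemma spM P Q PQ f g : (forall xi eta, P xi -> Q eta -> PQ (xi + eta)) ->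
  sp P f -> sp Q g -> sp PQ (fun z => f z * g z).
Proof.
move=> h [s sP fs] [t tP gt].
exists [seq (p.1 * r.1, p.2 + r.2) | p <- s, r <- t].
  by move=> _ /allpairsP[[p r] /= [/sP ? /tP ? ->]]; exact: h.
move=> z; rewrite /ev big_allpairs_dep fs gt /ev mulr_suml; apply: eq_bigr => p _.
by rewrite mulr_sumr; apply: eq_bigr => r _; rewrite eeD /=; move: (ee p.2 z) (ee r.2 z) => u1 u2; ring.
Qed.

Lemma spZ P a f : sp P f -> sp P (fun z => a * f z).
Proof.
move=> [s sP fs]; exists [seq (a * p.1, p.2) | p <- s].
  by move=> _ /mapP[p /sP ? ->].
move=> z; rewrite /ev big_map fs /ev mulr_sumr; apply: eq_bigr => p _ /=.
by rewrite mulrA.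
Qed.

Lemma spN P f : sp P f -> sp P (fun z => - f z).
Proof. by move=> /(spZ (-1)); apply: sp_ext => z; rewrite mulN1r. Qed.

Lemma spB P f g : sp P f -> sp P g -> sp P (fun z => f z - g z).
Proof. by move=> fP /spN gP; exact: spD. Qed.

Lemma sp_sum P (I : eqType) (r : seq I) (F : I -> VC -> K) :
  (forall i, i \in r -> sp P (F i)) -> sp P (fun z => \sum_(i <- r) F i z).
Proof.
elim: r => [|i r IH] h.
  by apply: sp_ext (sp0 P) => z; rewrite big_nil.
apply: (@sp_ext _ (fun z => F i z + \sum_(i <- r) F i z)) => [z|]; first by rewrite big_cons.
apply: spD; first by apply: h; rewrite inE eqxx.
by apply: IH => j jr; apply: h; rewrite inE jr orbT.
Qed.

Lemma sp_prod P (I : eqType) (r : seq I) (F : I -> VC -> K) :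
  P 0 -> (forall xi eta, P xi -> P eta -> P (xi + eta)) ->
  (forall i, i \in r -> sp P (F i)) -> sp P (fun z => \prod_(i <- r) F i z).
Proof.
move=> P0 PD; elim: r => [|i r IH] h.
  by apply: sp_ext (sp_cst 1 P0) => z; rewrite big_nil.
apply: (@sp_ext _ (fun z => F i z * \prod_(i <- r) F i z)) => [z|]; first by rewrite big_cons.
apply: (spM PD); first by apply: h; rewrite inE eqxx.
by apply: IH => j jr; apply: h; rewrite inE jr orbT.
Qed.

Lemma sp_shift P f w : sp P f -> sp P (fun z => f (z + w)).
Proof.
move=> [s sP fs]; exists [seq (p.1 * ee p.2 w, p.2) | p <- s].
  by move=> _ /mapP[p /sP ? ->].
move=> z; rewrite fs /ev big_map; apply: eq_bigr => p _ /=.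
by rewrite eeDr; move: (ee _ z) (ee _ w) => u1 u2; ring.
Qed.

(* Coefficient of [ee xi] in [f]; it is [0] when [f] is not an exponential sum. *)
Definition cf f xi : K :=
  if pselect (exists s, f =1 ev s) is left H then coef (projT1 (cid H)) xi else 0.

Lemma cf_coef f s : f =1 ev s -> cf f =1 coef s.
Proof.
move=> fs xi; rewrite /cf; case: pselect => [H|]; last by case; exists s.
by apply: coef_ev; case: (cid H) => /= s' fs' z; rewrite -fs' -fs.
Qed.

Lemma cf_in P f xi : sp P f -> cf f xi != 0 -> P xi.
Proof. by move=> [s sP fs]; rewrite (cf_coef fs) => /coef_supp[p /sP ? <-]. Qed.

Lemma cf_out P f xi : sp P f -> ~ P xi -> cf f xi = 0.
Proof. by move=> fP Px; apply/eqP/negPn/negP => /(cf_in fP). Qed.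

Lemma cf_expand P f : sp P f -> exists t : seq VC,
  [/\ uniq t, forall xi, (xi \in t) = (cf f xi != 0) &
      forall z, f z = \sum_(xi <- t) cf f xi * ee xi z].
Proof.
move=> [s sP fs]; pose u := undup [seq p.2 | p <- s].
exists [seq xi <- u | cf f xi != 0]; split; first by rewrite filter_uniq ?undup_uniq.
  move=> xi; rewrite mem_filter; case: eqP => //= /eqP; rewrite (cf_coef fs).
  by move=> /coef_supp[p ps <-]; rewrite mem_undup map_f.
move=> z; rewrite fs big_filter (@ev_coef _ u) ?undup_uniq => [|//|x]; last by rewrite mem_undup.
rewrite (bigID (fun xi => cf f xi != 0)) /= [X in _ + X]big1 ?addr0 => [|xi].
  by apply: eq_bigr => xi _; rewrite (cf_coef fs).
by rewrite negbK => /eqP; rewrite (cf_coef fs) => ->; rewrite mul0r.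
Qed.

Lemma sp_cf P Q f : sp P f -> (forall xi, cf f xi != 0 -> Q xi) -> sp Q f.
Proof.
move=> /cf_expand[t [ut tE fE]] h; exists [seq (cf f xi, xi) | xi <- t].
  by move=> _ /mapP[xi xit ->]; apply: h; rewrite -tE.
by move=> z; rewrite /ev big_map fE.
Qed.

Lemma cf_eq0 P f : sp P f -> (forall xi, cf f xi = 0) -> forall z, f z = 0.
Proof.
move=> fP h; have [s sP fs] : sp set0 f by apply: sp_cf fP _ => xi; rewrite h eqxx.
move=> z; rewrite fs /ev big_seq big1 // => p /sP [].
Qed.

Lemma cfD P Q f g xi : sp P f -> sp Q g ->
  cf (fun z => f z + g z) xi = cf f xi + cf g xi.
Proof.
move=> [s sP fs] [t tP gt].
rewrite (cf_coef fs) (cf_coef gt) (@cf_coef _ (s ++ t)) /coef ?big_cat // => z.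
by rewrite /ev big_cat fs gt.
Qed.

Lemma cfZ P a f xi : sp P f -> cf (fun z => a * f z) xi = a * cf f xi.
Proof.
move=> [s sP fs].
rewrite (cf_coef fs) (@cf_coef _ [seq (a * p.1, p.2) | p <- s]).
  by rewrite /coef big_map mulr_sumr.
by move=> z; rewrite /ev big_map fs /ev mulr_sumr; apply: eq_bigr => p _; rewrite mulrA.
Qed.

Lemma cfB P Q f g xi : sp P f -> sp Q g ->
  cf (fun z => f z - g z) xi = cf f xi - cf g xi.
Proof.
move=> fP gQ; rewrite -mulN1r -(cfZ _ _ gQ) -(cfD _ fP (spZ _ gQ)).
by congr (cf _ _); apply/funext => z; rewrite mulN1r.
Qed.

Lemma cf0 xi : cf (fun=> 0) xi = 0.
Proof. by rewrite (@cf_coef _ [::]) ?/coef ?big_nil // => z; rewrite /ev big_nil. Qed.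

Lemma cf_sum P (I : eqType) (r : seq I) (F : I -> VC -> K) xi :
  (forall i, i \in r -> sp P (F i)) ->
  cf (fun z => \sum_(i <- r) F i z) xi = \sum_(i <- r) cf (F i) xi.
Proof.
elim: r => [|i r IH] h.
  by rewrite big_nil -[RHS](cf0 xi); congr (cf _ _); apply/funext => z; rewrite big_nil.
have h' j : j \in r -> sp P (F j) by move=> jr; apply: h; rewrite inE jr orbT.
rewrite big_cons -IH // -(cfD _ (h i _) (sp_sum h')) ?inE ?eqxx //.
by congr (cf _ _); apply/funext => z; rewrite big_cons.
Qed.

Lemma cf_mono a xi eta : cf (fun z => a * ee xi z) eta = a * (xi == eta)%:R.
Proof.
rewrite (@cf_coef _ [:: (a, xi)]); last by move=> z; rewrite /ev big_seq1.
by rewrite /coef big_mkcond big_seq1 /=; case: eqP => _; rewrite ?mulr1 ?mulr0.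
Qed.

Lemma cf_shift P f w xi : sp P f -> cf (fun z => f (z + w)) xi = ee xi w * cf f xi.
Proof.
move=> [s sP fs]; rewrite (cf_coef fs) (@cf_coef _ [seq (p.1 * ee p.2 w, p.2) | p <- s]).
  by rewrite /coef big_map mulr_sumr; apply: eq_bigr => p /= /eqP->; rewrite mulrC.
move=> z; rewrite fs /ev big_map; apply: eq_bigr => p _ /=.
by rewrite eeDr; move: (ee _ z) (ee _ w) => u1 u2; ring.
Qed.

Lemma cf_mul_mono P a eta f xi : sp P f ->
  cf (fun z => a * ee eta z * f z) (eta + xi) = a * cf f xi.
Proof.
move=> [s sP fs]; rewrite (cf_coef fs) (@cf_coef _ [seq (a * p.1, eta + p.2) | p <- s]).
  rewrite /coef big_map mulr_sumr; apply: eq_bigl => p /=.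
  by rewrite (inj_eq (addrI _)).
move=> z; rewrite fs /ev big_map mulr_sumr; apply: eq_bigr => p _ /=.
by rewrite eeD; move: (ee eta z) (ee p.2 z) => u1 u2; ring.
Qed.

(** Allows to test an exponential sum only where other factors are known not to vanish, namely far
    along a well chosen direction. *)
Lemma sp_line P f z w k0 : sp P f ->
  (forall k, (k0 <= k)%N -> f (z + k%:R *: w) = 0) -> f z = 0.
Proof.
move=> [s sP fs] h; rewrite fs /ev.
apply: (@exp_sum_tail _ _ _ _ (fun p : K * VC => ee p.2 w) k0) => [p _|k /h].
  exact: ee_neq0.
rewrite fs /ev => e; rewrite -[RHS]e; apply: eq_bigr => p _.
by rewrite eeDr eeMn mulrA.
Qed.

End Characters.

(** * Roots and chambers *)

Section LargeMultiples.
Context (R : realType).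

Lemma eventually_seq (T : eqType) (s : seq T) (P : T -> nat -> Prop) :
  (forall x, x \in s -> exists N0, forall N, (N0 <= N)%N -> P x N) ->
  exists N0, forall N, (N0 <= N)%N -> forall x, x \in s -> P x N.
Proof.
elim: s => [|x s IH] h; first by exists 0%N.
have [|N1 h1] := IH; first by move=> y ys; apply: h; rewrite inE ys orbT.
have [N2 h2] := h x (mem_head _ _).
exists (maxn N1 N2) => N; rewrite geq_max => /andP[le1 le2] y.
by rewrite inE => /orP[/eqP->|ys]; [exact: h2|exact: h1].
Qed.

Lemma archi_nat (x : R) : exists N0, forall N, (N0 <= N)%N -> x < N%:R.
Proof.
exists (Num.bound `|x|) => N hN; apply: le_lt_trans (ler_norm x) _.
by apply: lt_le_trans (archi_boundP (normr_ge0 x)) _; rewrite ler_nat.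
Qed.

(** Used for vectors [N u + w] with [w] regular: for large [N] they are regular, and the second
    clause says that [u] lies in the closure of their chamber. *)
Lemma large_multiple (p r : R) : (p != 0) || (r != 0) -> exists N0, forall N, (N0 <= N)%N ->
  N%:R * p + r != 0 /\ (0 < N%:R * p + r -> 0 <= p).
Proof.
have [->|p0] := eqVneq p 0 => /= r0.
  by exists 0%N => N _; rewrite mulr0 add0r.
have [N0 h] := archi_nat (`|r| / `|p|); exists N0 => N /h.
rewrite ltr_pdivrMr ?normr_gt0 // => {}h.
have [p1|p1|/eqP] := ltgtP p 0; last by rewrite (negbTE p0).
  rewrite (ltr0_norm p1) in h; have := ler_norm r => hr.
  have lt0 : N%:R * p + r < 0 by lra.
  by split; [rewrite lt_eqF|rewrite ltNge ltW].
rewrite (gtr0_norm p1) in h; have := ler_norm (- r); rewrite normrN => hr.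
have gt0 : 0 < N%:R * p + r by lra.
by split => [|_] //; rewrite gt_eqF.
Qed.

End LargeMultiples.

Section Avoidance.
Context (R : realType) (n : nat) (G : 'M[R]_n).
Local Notation V := 'rV[R]_n.

(** The set [D] is a parameter so that the vector found can be required to have integral pairings
    with an orbit. A large multiple of the vector already found keeps the hyperplanes avoided so
    far. *)
Lemma avoid_hyperplanes (D : set V) (T : seq V) : D 0 ->
  (forall u w (N : nat), D u -> D w -> D (N%:R *: u + w)) ->
  (forall t, t \in T -> exists2 w, D w & dotp G w t != 0) ->
  exists2 y, D y & forall t, t \in T -> dotp G y t != 0.
Proof.
move=> D0 Dlin; elim: T => [|t T IH] hT; first by exists 0.
have [|u Du hu] := IH; first by move=> t' t'T; apply: hT; rewrite inE t'T orbT.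
have [w Dw hw] := hT t (mem_head _ _).
have [x|N0 h] := @eventually_seq _ (t :: T) (fun x N => dotp G (N%:R *: u + w) x != 0).
  move=> xT; have [|N1 h1] := @large_multiple R (dotp G u x) (dotp G w x).
    by move: xT; rewrite inE => /orP[/eqP->|/hu->//]; rewrite hw orbT.
  by exists N1 => N /h1[]; rewrite dotpDl dotpZl.
by exists (N0%:R *: u + w); [exact: Dlin|exact: h].
Qed.

End Avoidance.

Section Roots.
Context (R : realType) (n : nat) (G : 'M[R]_n) (hG : scalar_product G).
Context (Phi : {fset 'rV[R]_n}) (hroot : root_system G Phi) (hred : reduced Phi).
Local Notation V := 'rV[R]_n.
Local Notation "<< u , v >>" := (dotp G u v) (at level 0, format "<< u ,  v >>").
Local Notation cr := (coroot G).
Local Notation sC := (dotp_real_sym hG).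
Implicit Types (a b c u w lam : V).

Lemma root_neq0 a : a \in Phi -> a != 0.
Proof. by case: hroot => _ h0 _ _ aP; apply: contraNneq h0 => <-. Qed.

Lemma root_sqr_gt0 a : a \in Phi -> 0 < <<a, a>>.
Proof. by move=> /root_neq0; exact: dotp_gt0. Qed.

Lemma cr_pair u a : <<u, cr a>> = 2 / <<a, a>> * <<u, a>>.
Proof. by rewrite dotpZr. Qed.

Lemma cr_pairl u a : <<cr a, u>> = 2 / <<a, a>> * <<a, u>>.
Proof. by rewrite dotpZl. Qed.

Lemma cr_gt0 u a : a \in Phi -> (0 < <<u, cr a>>) = (0 < <<u, a>>).
Proof. by move=> /root_sqr_gt0 a0; rewrite cr_pair pmulr_rgt0 // divr_gt0. Qed.

Lemma cr_lt0 u a : a \in Phi -> (<<u, cr a>> < 0) = (<<u, a>> < 0).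
Proof. by move=> /root_sqr_gt0 a0; rewrite cr_pair pmulr_rlt0 // divr_gt0. Qed.

Lemma cr_gt0l u a : a \in Phi -> (0 < <<cr a, u>>) = (0 < <<a, u>>).
Proof. by rewrite !(sC _ u) => /cr_gt0->. Qed.

Lemma cr_pair_eq0 u a : a \in Phi -> (<<u, cr a>> == 0) = (<<u, a>> == 0).
Proof.
move=> /root_sqr_gt0 a0; rewrite cr_pair mulf_eq0 gt_eqF //.
by rewrite divr_gt0.
Qed.

Lemma cr_self a : a \in Phi -> <<cr a, a>> = 2.
Proof. by move=> /root_sqr_gt0 a0; rewrite cr_pairl divfK // gt_eqF. Qed.

Lemma crN a : cr (- a) = - cr a.
Proof. by rewrite /coroot dotpNl dotpNr opprK scalerN. Qed.

Lemma cr_neq0 a : a \in Phi -> cr a != 0.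
Proof.
by move=> aP; apply/eqP => h; have := cr_self aP; rewrite h dotp0l => /eqP; rewrite eq_sym pnatr_eq0.
Qed.

Lemma crK a : a \in Phi -> cr (cr a) = a.
Proof.
move=> /root_sqr_gt0 a0; rewrite {1}/coroot cr_pairl cr_pair scalerA.
by rewrite -[RHS]scale1r; congr (_ *: _); field; rewrite gt_eqF.
Qed.

Lemma cr_inj a b : a \in Phi -> b \in Phi -> cr a = cr b -> a = b.
Proof. by move=> aP bP e; rewrite -(crK aP) e crK. Qed.

Lemma reflE a u : refl G a u = u - <<u, a>> *: cr a.
Proof.
by rewrite /refl cr_pair /coroot scalerA; congr (_ - _ *: _); rewrite mulrC.
Qed.

Lemma reflD a u w : refl G a (u + w) = refl G a u + refl G a w.
Proof. by rewrite !reflE dotpDl scalerDl opprD addrACA. Qed.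

Lemma reflZ a k u : refl G a (k *: u) = k *: refl G a u.
Proof. by rewrite !reflE dotpZl scalerBr -[(k * _) *: _]scalerA. Qed.

Lemma reflN a u : refl G a (- u) = - refl G a u.
Proof. by rewrite -scaleN1r reflZ scaleN1r. Qed.

Lemma refl_self a : a \in Phi -> refl G a a = - a.
Proof.
move=> aP; rewrite /refl sC cr_self // scaler_nat mulr2n opprD addrA subrr add0r //.
Qed.

Lemma refl_sym a u w : <<refl G a u, w>> = <<u, refl G a w>>.
Proof.
rewrite !reflE dotpBl dotpBr dotpZl dotpZr (sC (cr a) w) !cr_pair (sC w a).
by rewrite (sC a w); ring.
Qed.

Lemma reflK a u : a \in Phi -> refl G a (refl G a u) = u.
Proof.
move=> aP; rewrite [X in refl _ _ X]/refl -scaleNr reflD reflZ refl_self //.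
by rewrite /refl scalerN scaleNr opprK subrK.
Qed.

Lemma refl_isom a u w : a \in Phi -> <<refl G a u, refl G a w>> = <<u, w>>.
Proof. by move=> aP; rewrite refl_sym reflK. Qed.

Lemma refl_inj a : a \in Phi -> injective (refl G a).
Proof. by move=> aP u w e; rewrite -(reflK u aP) e reflK. Qed.

Lemma cr_refl a b : a \in Phi -> cr (refl G a b) = refl G a (cr b).
Proof. by move=> aP; rewrite /coroot refl_isom // reflZ. Qed.

Lemma root_refl a b : a \in Phi -> b \in Phi -> refl G a b \in Phi.
Proof. by case: hroot => _ _ h _; exact: h. Qed.

Lemma root_opp a : (- a \in Phi) = (a \in Phi).
Proof.
have h c : c \in Phi -> - c \in Phi by move=> cP; rewrite -refl_self // root_refl.
by apply/idP/idP => /h //; rewrite opprK.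
Qed.

Lemma root_int a b : a \in Phi -> b \in Phi -> exists k : int, <<cr a, b>> = k%:~R.
Proof. by case: hroot => _ _ _ h aP bP; rewrite sC; apply/intrP; exact: h. Qed.

Lemma root_opp_neq a : a \in Phi -> a != - a.
Proof.
move=> aP; apply/eqP => /eqP; rewrite -subr_eq0 opprK -mulr2n -scaler_nat.
by rewrite scaler_eq0 pnatr_eq0 /= (negbTE (root_neq0 aP)).
Qed.

Lemma root_proportional a b k : a \in Phi -> b \in Phi -> b = k *: a -> b = a \/ b = - a.
Proof.
move=> aP bP e; have [k1|k1] := hred aP (eq_ind _ (fun x => x \in Phi) bP _ e).
  by left; rewrite e k1 scale1r.
by right; rewrite e k1 scaleN1r.
Qed.

Lemma root_span u : (forall a, a \in Phi -> <<u, a>> = 0) -> u = 0.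
Proof.
case: hroot => sp _ _ _ h; apply/eqP; rewrite -(dotp_eq0 hG).
have : u \in <<enum_fset Phi>>%VS by rewrite sp memvf.
move=> /(@coord_span _ _ _ (in_tuple _)) {2}->; rewrite dotp_sumr big1 // => i _.
by rewrite dotpZr h ?mulr0 // mem_nth.
Qed.

Lemma perm_refl a : a \in Phi -> perm_eq [seq refl G a b | b <- Phi] Phi.
Proof.
move=> aP; apply: uniq_perm => [||b]; rewrite ?(map_inj_uniq (@refl_inj _ aP)) ?fset_uniq //.
apply/mapP/idP => [[c cP ->]|bP]; first exact: root_refl.
by exists (refl G a b); rewrite ?reflK // root_refl.
Qed.

Lemma perm_oppPhi : perm_eq [seq - b | b <- Phi] Phi.
Proof.
apply: uniq_perm => [||b]; rewrite ?(map_inj_uniq oppr_inj) ?fset_uniq //.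
apply/mapP/idP => [[c cP ->]|bP]; first by rewrite root_opp.
by exists (- b); rewrite ?opprK // root_opp.
Qed.

Lemma big_refl (T : Type) (idx : T) (op : Monoid.com_law idx) a (P : pred V) (F : V -> T) :
  a \in Phi ->
  \big[op/idx]_(b <- Phi | P b) F b = \big[op/idx]_(b <- Phi | P (refl G a b)) F (refl G a b).
Proof.
move=> aP; rewrite -[LHS](perm_big _ (perm_refl aP)) big_map //.
Qed.

Lemma big_oppPhi (T : Type) (idx : T) (op : Monoid.com_law idx) (P : pred V) (F : V -> T) :
  \big[op/idx]_(b <- Phi | P b) F b = \big[op/idx]_(b <- Phi | P (- b)) F (- b).
Proof. by rewrite -[LHS](perm_big _ perm_oppPhi) big_map. Qed.

Definition regular_vec lam := forall a, a \in Phi -> <<lam, a>> != 0.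
Local Notation gen := regular_vec.

Lemma genN lam : gen lam -> gen (- lam).
Proof. by move=> h a /h; rewrite dotpNl oppr_eq0. Qed.

Lemma gen_refl a lam : a \in Phi -> gen lam -> gen (refl G a lam).
Proof. by move=> aP h b bP; rewrite refl_sym; apply: h; exact: root_refl. Qed.

Lemma gen_opp_gt0 lam a : gen lam -> a \in Phi -> (0 < <<lam, - a>>) = ~~ (0 < <<lam, a>>).
Proof.
by move=> h /h; rewrite dotpNr oppr_gt0; case: ltgtP.
Qed.

Lemma big_split_gen (T : Type) (idx : T) (op : Monoid.com_law idx) lam (P : pred V) (F : V -> T) :
  gen lam -> (forall b, b \in Phi -> P (- b) = P b) ->
  \big[op/idx]_(b <- Phi | P b) F b =
  \big[op/idx]_(b <- Phi | P b && (0 < <<lam, b>>)) op (F b) (F (- b)).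
Proof.
move=> h hP; rewrite big_split (bigID (fun b => 0 < <<lam, b>>)) /=; congr (op _ _).
rewrite big_oppPhi big_seq_cond [RHS]big_seq_cond; apply: eq_bigl => b.
case bP: (b \in Phi) => //=; rewrite hP // gen_opp_gt0 // negbK //.
Qed.

Lemma exists_gen : exists lam, gen lam.
Proof.
have [||t tP|y _ hy] := @avoid_hyperplanes R n G setT Phi; [by []|by []| |by exists y].
by exists t => //; rewrite gt_eqF // root_sqr_gt0.
Qed.

(** Symmetrises under [s_a] a vector not orthogonal to any [b + s_a b]. These sums are nonzero,
    since [b + s_a b = 0] would make [b] proportional to [a]. *)
Lemma exists_perp a : a \in Phi -> exists2 lam, <<lam, a>> = 0 &
  forall b, b \in Phi -> b != a -> b != - a -> <<lam, b>> != 0.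
Proof.
move=> aP.
pose T := [seq b + refl G a b | b <- Phi & (b != a) && (b != - a)].
have [||t|y _ hy] := @avoid_hyperplanes R n G setT T; [by []|by []| |].
  move=> /mapP[b]; rewrite mem_filter => /andP[/andP[ba bNa] bP] ->.
  exists (b + refl G a b) => //; rewrite dotp_eq0 //.
  apply/eqP => /eqP; rewrite /refl addrA -mulr2n subr_eq0 -scaler_nat => /eqP e.
  have : b = (<<b, cr a>> / 2) *: a.
    by rewrite mulrC -scalerA -e scalerA mulVf ?pnatr_eq0 // scale1r.
  by move=> /(root_proportional aP bP)[/eqP|/eqP]; [rewrite (negbTE ba)|rewrite (negbTE bNa)].
exists (y + refl G a y).
  by rewrite dotpDl refl_sym refl_self // dotpNr subrr.
move=> b bP ba bNa; rewrite dotpDl refl_sym -dotpDr; apply: hy.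
by apply/mapP; exists b => //; rewrite mem_filter ba bNa.
Qed.

(** Strict Cauchy-Schwarz, read off the norm of [(a, a) b - (a, b) a], which is nonzero because the
    system is reduced. *)
Lemma root_cauchy a b : a \in Phi -> b \in Phi -> b != a -> b != - a ->
  <<cr a, b>> * <<cr b, a>> < 4.
Proof.
move=> aP bP ba bNa; have a0 := root_sqr_gt0 aP; have b0 := root_sqr_gt0 bP.
rewrite !cr_pairl (sC b a).
have e0 : <<a, a>> *: b - <<a, b>> *: a != 0.
  rewrite subr_eq0; apply/eqP => e.
  have : b = (<<a, b>> / <<a, a>>) *: a.
    by rewrite mulrC -scalerA -e scalerA mulVf ?gt_eqF // scale1r.
  by move=> /(root_proportional aP bP)[/eqP|/eqP]; [rewrite (negbTE ba)|rewrite (negbTE bNa)].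
have := dotp_gt0 hG e0.
rewrite !(dotpBl, dotpBr, dotpZl, dotpZr) (sC b a).
set x := <<a, a>> in a0 *; set y := <<b, b>> in b0 *; set w := <<a, b>>.
move=> H; have {}H : 0 < x * (x * y - w * w) by lra.
rewrite pmulr_rgt0 // subr_gt0 in H.
have -> : 2 / x * w * (2 / y * w) = 4 * ((w * w) / (x * y)).
  by field; rewrite !gt_eqF.
by rewrite -[ltRHS]mulr1 ltr_pM2l ?ltr0n // ltr_pdivrMr ?mulr_gt0 // mul1r.
Qed.

(** Of two positive integers with product below 4, one is 1. The explicit form of [c] is kept
    because it gives the multiplicity of [c]: that of [b] or that of [a]. *)
Lemma coroot_diff a b : a \in Phi -> b \in Phi -> b != a -> 0 < <<b, a>> ->
  exists2 c, c \in Phi & cr c = cr b - cr a /\ (c = refl G a b \/ c = - refl G b a).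
Proof.
move=> aP bP ba ab0.
have bNa : b != - a.
  by apply: contraTneq ab0 => ->; rewrite dotpNl oppr_gt0 -leNgt ltW // root_sqr_gt0.
have [k ek] := root_int aP bP; have [l el] := root_int bP aP.
have k0 : 0 < k by rewrite -(@ltr0z R) -ek cr_gt0l // sC.
have l0 : 0 < l by rewrite -(@ltr0z R) -el cr_gt0l.
have := root_cauchy aP bP ba bNa; rewrite ek el -intrM -[4]/(4%:~R) ltr_int => kl.
have [l1|k1] : l = 1 \/ k = 1 by nia.
  exists (refl G a b); first exact: root_refl.
  by split; [rewrite cr_refl // reflE el l1 scale1r|left].
exists (- refl G b a); first by rewrite root_opp root_refl.
by split; [rewrite crN cr_refl // reflE ek k1 scale1r opprB|right].
Qed.

End Roots.

(** * Zonotopes of coroots *)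

Section Saturation.
Context (R : realType) (n : nat) (G : 'M[R]_n) (hG : scalar_product G).
Context (Phi : {fset 'rV[R]_n}) (hroot : root_system G Phi) (hred : reduced Phi).
Local Notation V := 'rV[R]_n.
Local Notation "<< u , v >>" := (dotp G u v) (at level 0, format "<< u ,  v >>").
Local Notation cr := (coroot G).
Local Notation sC := (dotp_real_sym hG).
Local Notation gen := (regular_vec G Phi).
Local Notation rfl := (refl G).
Context (m : V -> nat).
Hypothesis hm : forall a b, a \in Phi -> b \in Phi -> m (rfl a b) = m b.
Implicit Types (a b c u w lam : V) (nn : V -> nat).

Lemma mN a : a \in Phi -> m (- a) = m a.
Proof. by move=> aP; rewrite -(refl_self hG hroot aP) hm. Qed.

(* [signed_half_sum u] says that [u] is a vector [rho^vee - sum l_a a^vee] with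
   integers [0 <= l_a <= m_a], in a form that does not depend on the choice of
   the positive roots: [nn (- a) = l_a] and [nn a = m_a - l_a] for [a] positive. *)
Definition zrep nn u := (forall b, b \in Phi -> nn b + nn (- b) = m b)%N /\
  u = \sum_(b <- Phi) ((nn b)%:R / 2) *: cr b.

Definition signed_half_sum u := exists nn, zrep nn u.
Local Notation zint := signed_half_sum.

Definition coroot_lattice u := exists k : V -> int,
  u = \sum_(b <- Phi | (0 < m b)%N) (k b)%:~R *: cr b.
Local Notation clat := coroot_lattice.

(* [half_sum lam] is [rho^vee] for the chamber of [lam], hence the vertex at which
   [lam] is maximal on the zonotope of the [signed_half_sum]s. *)
Definition half_sum lam : V := \sum_(b <- Phi | 0 < <<lam, b>>) ((m b)%:R / 2) *: cr b.
Local Notation rl := half_sum.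

Lemma clat0 : clat 0.
Proof. by exists (fun=> 0); rewrite big1 // => b _; rewrite scale0r. Qed.

Lemma clatD u w : clat u -> clat w -> clat (u + w).
Proof.
move=> [k ->] [l ->]; exists (fun b => k b + l b).
by rewrite -big_split; apply: eq_bigr => b _; rewrite /= intrD scalerDl.
Qed.

Lemma clatN u : clat u -> clat (- u).
Proof.
move=> [k ->]; exists (fun b => - k b).
by rewrite -sumrN; apply: eq_bigr => b _; rewrite intrN scaleNr.
Qed.

Lemma clatB u w : clat u -> clat w -> clat (u - w).
Proof. by move=> hu /clatN; exact: clatD. Qed.

Lemma clatZ (k : int) u : clat u -> clat (k%:~R *: u).
Proof.
move=> [l ->]; exists (fun b => k * l b).
by rewrite scaler_sumr; apply: eq_bigr => b _; rewrite intrM scalerA.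
Qed.

Lemma clat_coroot b : b \in Phi -> (0 < m b)%N -> clat (cr b).
Proof.
move=> bP mb; exists (fun x => (x == b)%:R).
rewrite big_mkcond (bigD1_seq b) ?fset_uniq //= mb eqxx scale1r big1 ?addr0 // => c /negbTE cb.
by rewrite cb scale0r if_same.
Qed.

Lemma clat_weight p u : weights G Phi p -> clat u -> exists k : int, <<p, u>> = k%:~R.
Proof.
move=> hp [k ->]; apply/intrP; rewrite dotp_sumr big_seq_cond rpred_sum // => b /andP[bP _].
by rewrite dotpZr rpredM ?rpred_int // ?hp.
Qed.

Lemma root_weight a : a \in Phi -> weights G Phi a.
Proof.
by move=> aP b bP; have [k e] := root_int hG hroot bP aP; rewrite sC e rpred_int.
Qed.

Lemma zint_opp u : zint u -> zint (- u).
Proof.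
move=> [nn [h ->]]; exists (fun b => nn (- b)); split.
  by move=> b bP; rewrite opprK addnC h.
rewrite (big_oppPhi hG hroot) -sumrN; apply: eq_bigr => b _.
by rewrite crN scalerN opprK.
Qed.

Lemma zint_split lam nn : gen lam ->
  \sum_(b <- Phi) ((nn b)%:R / 2) *: cr b =
  \sum_(b <- Phi | 0 < <<lam, b>>) (((nn b)%:R - (nn (- b))%:R) / 2) *: cr b.
Proof.
move=> gl; rewrite (big_split_gen hG hroot _ _ gl) //=; apply: eq_bigr => b _.
by rewrite crN scalerN -scalerBl mulrBl.
Qed.

Lemma zint_sub u w : zint u -> zint w -> clat (u - w).
Proof.
move=> [nu [hu ->]] [nw [hw ->]]; have [lam gl] := exists_gen hG hroot.
rewrite !(zint_split _ gl) -sumrB.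
exists (fun b => if 0 < <<lam, b>> then (nu b)%:Z - (nw b)%:Z else 0).
rewrite big_mkcond [RHS]big_mkcond; apply: eq_big_seq => b bP.
case: ifP => lb; last by rewrite scale0r if_same.
have := hu _ bP; have := hw _ bP => ew eu.
case: ifP => mb; rewrite -scalerBl.
  congr (_ *: _); rewrite intrB -!pmulrn.
  have eu' : (nu (- b))%:R = (m b)%:R - (nu b)%:R :> R by rewrite -eu natrD; ring.
  have ew' : (nw (- b))%:R = (m b)%:R - (nw b)%:R :> R by rewrite -ew natrD; ring.
  by rewrite eu' ew'; field.
have m0 : m b = 0%N by apply/eqP; rewrite -leqn0 leqNgt mb.
move: eu ew; rewrite m0 => /eqP; rewrite addn_eq0 => /andP[/eqP-> /eqP->] /eqP.
by rewrite addn_eq0 => /andP[/eqP-> /eqP->]; rewrite subrr scale0r.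
Qed.

Lemma zint_rl lam : gen lam -> zint (rl lam).
Proof.
move=> gl; exists (fun b => if 0 < <<lam, b>> then m b else 0%N); split.
  by move=> b bP; rewrite (gen_opp_gt0 gl bP) mN //; case: ifP => _ //=; rewrite addn0.
rewrite /rl big_mkcond; apply: eq_bigr => b _; case: ifP => //.
by rewrite mul0r scale0r.
Qed.

(** Moves one unit from [b] to [- b]. The last clause makes a second move at another pair of roots
    possible. *)
Lemma zrep_lower nn u b : zrep nn u -> b \in Phi -> (0 < nn b)%N ->
  exists2 nn', zrep nn' (u - cr b) & forall x, x != b -> x != - b -> nn' x = nn x.
Proof.
move=> [h ->] bP n0; have bNb := root_opp_neq hroot bP.
pose nn' x := if x == b then (nn b).-1 else if x == - b then (nn (- b)).+1 else nn x.
exists nn'; last by move=> x /negbTE xb /negbTE xNb; rewrite /nn' xb xNb.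
have nb : nn' b = (nn b).-1 by rewrite /nn' eqxx.
have nNb : nn' (- b) = (nn (- b)).+1 by rewrite /nn' eq_sym (negbTE bNb) eqxx.
split.
  move=> c cP; have [->|cb] := eqVneq c b; first by rewrite nb nNb -(h _ bP); lia.
  have [->|cNb] := eqVneq c (- b).
    by rewrite opprK nb nNb mN // -(h _ bP); lia.
  rewrite /nn' (negbTE cb) (negbTE cNb) eqr_oppLR (negbTE cNb) (inj_eq oppr_inj) (negbTE cb).
  exact: h.
apply/eqP; rewrite eq_sym addrC -subr_eq; apply/eqP; rewrite -sumrB.
rewrite (bigD1_seq b) ?fset_uniq //= (bigID (pred1 (- b))) /= [X in _ + (_ + X)]big1; last first.
  by move=> c /andP[cb cNb]; rewrite /nn' (negbTE cb) (negbTE cNb) subrr.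
rewrite (eq_bigl (pred1 (- b))) => [|c]; last first.
  by rewrite /=; have [->|] := eqVneq c (- b); rewrite ?andbF // andbT eq_sym bNb.
rewrite -big_filter filter_pred1_uniq ?fset_uniq ?(root_opp hG hroot) // big_seq1.
rewrite nb nNb addr0 crN; move: (cr b) => c.
rewrite -[c in RHS]scale1r !scalerN -!scaleNr -!scalerDl; congr (_ *: _).
have -> : (nn b).-1%:R = (nn b)%:R - 1 :> R by rewrite -subn1 natrB.
have -> : (nn (- b)).+1%:R = (nn (- b))%:R + 1 :> R by rewrite -natr1.
by rewrite /GRing.scale /=; field.
Qed.

Lemma cr_double a b : a \in Phi -> b \in Phi -> cr b <> cr a + cr a.
Proof.
move=> aP bP e; have e2 : b = 2^-1 *: a.
  have dbl c : c != 0 -> cr (c + c) = 2^-1 *: cr c.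
    move=> /(dotp_gt0 hG) c0; rewrite -mulr2n -scaler_nat /coroot dotpZl dotpZr !scalerA.
    by congr (_ *: _); field; rewrite gt_eqF.
  by rewrite -(crK hG hroot bP) e dbl ?(cr_neq0 hG hroot) // (crK hG hroot).
have [] := root_proportional hred aP bP e2; rewrite e2 => /eqP.
  rewrite -subr_eq0 -[X in _ - X]scale1r -scalerBl scaler_eq0 (negbTE (root_neq0 hroot aP)) orbF.
  by move=> /eqP; lra.
rewrite -subr_eq0 opprK -[X in _ + X]scale1r -scalerDl scaler_eq0 (negbTE (root_neq0 hroot aP)) orbF.
by move=> /eqP; lra.
Qed.

Lemma coroot_diff_mult a b : a \in Phi -> b \in Phi -> (0 < m a)%N -> (0 < m b)%N ->
  b != a -> 0 < <<b, a>> -> exists c, [/\ c \in Phi, (0 < m c)%N & cr c = cr b - cr a].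
Proof.
move=> aP bP ma mb ba ab; have [c cP [ec h]] := coroot_diff hG hroot hred aP bP ba ab.
exists c; split => //; case: h => ->; first by rewrite hm.
by rewrite mN ?hm // root_refl.
Qed.

Section Strings.
Context (nn : V -> nat) (a : V) (aP : a \in Phi) (ma : (0 < m a)%N).
Hypothesis nnm : forall b, b \in Phi -> (nn b + nn (- b) = m b)%N.
(** If this fails for [b] and [c], one unit moved at [b] and one at [- c] lower the sum by exactly
    [cr a]. *)
Hypothesis no_transfer : forall b c, b \in Phi -> c \in Phi -> cr c = cr b - cr a ->
  (0 < nn b)%N -> nn (- c) = 0%N.

(** Goes down the string from [b^vee] to [s_a b^vee = b^vee - k a^vee]. For [k >= 3] the first and
    the last step are instances of [no_transfer]; between them lies the string of
    [c^vee = b^vee - a^vee], shorter by 2, which is the induction hypothesis. *)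
Lemma string_saturated (k : nat) b : b \in Phi -> (0 < m b)%N -> b != a -> (0 < k)%N ->
  <<cr b, a>> = k%:R -> (0 < nn b)%N -> nn (- rfl a b) = 0%N.
Proof.
have [l] := ubnP k; elim: l k b => // l IH k b lk bP mb ba k0 ek nb.
have ab : 0 < <<b, a>> by rewrite -(cr_gt0l hG hroot) // ek ltr0n.
have [c [cP mc ec]] := coroot_diff_mult aP bP ma mb ba ab.
have rP := root_refl hroot aP bP.
have er : cr (rfl a b) = cr b - k%:R *: cr a by rewrite (cr_refl hG hroot) // reflE // ek.
have n0 : nn (- c) = 0%N := no_transfer bP cP ec nb.
have nc : (0 < nn c)%N by move: (nnm cP); rewrite n0 addn0 => ->.
case: k k0 lk ek er => [//|[|[|k]]] _ lk ek er.
- have -> : rfl a b = c by apply: (cr_inj hG hroot) => //; rewrite er ec scale1r.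
  exact: n0.
- apply: (no_transfer cP rP) => //.
  by rewrite er ec scaler_nat mulr2n opprD addrA.
have ca : c != a.
  apply/eqP => ca; apply: (cr_double aP bP); move: ec; rewrite ca => e.
  by rewrite {1}e subrK.
have ekc : <<cr c, a>> = k.+1%:R.
  by rewrite ec dotpBl ek (cr_self hG hroot) // -[k.+3]addn2 natrD addrK.
have n1 : nn (- rfl a c) = 0%N by apply: (IH k.+1 c) => //; rewrite -ltnS; apply: leq_trans lk.
have rcP := root_refl hroot aP cP.
apply: (no_transfer rcP rP); last first.
  by move: (nnm rcP); rewrite n1 addn0 hm // => ->.
rewrite er (cr_refl hG hroot) // reflE // ekc ec.
have -> : k.+3%:R = 1 + k.+1%:R + 1 :> R by rewrite -natr1 -[k.+2]/(1 + k.+1)%N natrD.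
by rewrite !scalerDl !scale1r !opprD !addrA.
Qed.

End Strings.
(** If [nn a > 0], a unit is moved at [a]; if [no_transfer] fails, two moves suffice. Otherwise
    [string_saturated] gives [nn b <= nn (s_a b)] whenever [(b^vee, a) > 0], which forces
    [(u, a) <= 0], a contradiction. *)
Lemma zint_string u a : a \in Phi -> (0 < m a)%N -> zint u -> 0 < <<u, a>> ->
  zint (u - cr a).
Proof.
move=> aP ma [nn hu] ua; have [nnm eu] := hu.
have [na|na] := posnP (nn a); last by have [nn' h _] := zrep_lower hu aP na; exists nn'.
have NaP : - a \in Phi by rewrite (root_opp hG hroot).
have [H|H] := pselect (forall b c, b \in Phi -> c \in Phi -> cr c = cr b - cr a ->
  (0 < nn b)%N -> nn (- c) = 0%N).
  have P b : b \in Phi -> 0 < <<cr b, a>> -> (nn b <= nn (rfl a b))%N.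
    move=> bP ab; have [->|ba] := eqVneq b a; first by rewrite na.
    have [->//|nb] := posnP (nn b).
    have mb : (0 < m b)%N by rewrite -(nnm _ bP) addn_gt0 nb.
    have [k ek] := root_int hG hroot bP aP.
    have k0 : 0 < k by rewrite -(@ltr0z R) -ek.
    have n0 : nn (- rfl a b) = 0%N.
      apply: (@string_saturated nn a aP ma nnm H `|k|%N b) => //.
        by rewrite absz_gt0 gt_eqF.
      by rewrite ek natr_absz gtr0_norm.
    have := nnm _ (root_refl hroot aP bP); rewrite n0 addn0 hm // => ->.
    by rewrite -(nnm _ bP) leq_addr.
  have Q b : b \in Phi -> ((nn b)%:R - (nn (rfl a b))%:R) * <<cr b, a>> <= 0.
    move=> bP; have [ab|ab|<-] := ltgtP 0 <<cr b, a>>; last by rewrite mulr0.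
      by rewrite pmulr_lle0 // subr_le0 ler_nat P.
    rewrite nmulr_lle0 // subr_ge0 ler_nat -[X in (_ <= nn X)%N](reflK hG hroot b aP).
    apply: P; first exact: root_refl.
    by rewrite (cr_refl hG hroot) // (refl_sym hG) (refl_self hG hroot) // dotpNr oppr_gt0.
  have : <<u, a>> <= 0.
    (* The 4 absorbs the halves in [u] and the symmetrisation under [s_a]. *)
    rewrite -(@pmulr_rle0 _ 4) // {1}eu dotp_suml.
    under eq_bigr do rewrite dotpZl.
    have -> : 4 * \sum_(b <- Phi) (nn b)%:R / 2 * <<cr b, a>> =
        \sum_(b <- Phi) (nn b)%:R * <<cr b, a>> + \sum_(b <- Phi) (nn b)%:R * <<cr b, a>>.
      by rewrite mulr_sumr -big_split; apply: eq_bigr => b _ /=; field.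
    rewrite [X in _ + X](big_refl hG hroot _ _ _ aP) -big_split big_seq sumr_le0 //= => b bP.
    rewrite (cr_refl hG hroot) // (refl_sym hG) (refl_self hG hroot) // dotpNr mulrN -mulrBl.
    exact: Q.
  by rewrite leNgt ua.
move/existsNP: H => [b /existsNP[c /not_implyP[bP /not_implyP[cP /not_implyP[ec /not_implyP[nb /eqP nc]]]]]].
have [nn' h' h] := zrep_lower hu bP nb.
have NcP : - c \in Phi by rewrite (root_opp hG hroot).
have cNb : - c != b.
  apply/eqP => e; apply: (cr_double bP aP).
  by rewrite -[LHS](subKr (cr b)) -ec -e crN.
have cb : - c != - b.
  rewrite eqr_opp; apply/eqP => e; move/eqP: ec.
  by rewrite e eq_sym -subr_eq0 addrAC subrr sub0r oppr_eq0 (negbTE (cr_neq0 hG hroot aP)).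
have nc' : (0 < nn' (- c))%N by rewrite h // lt0n.
have [nn2 h2 _] := zrep_lower h' NcP nc'.
by exists nn2; rewrite crN opprK ec addrA subrK in h2.
Qed.

End Saturation.

Section SimpleRoots.
Context (R : realType) (n : nat) (G : 'M[R]_n) (hG : scalar_product G).
Context (Phi : {fset 'rV[R]_n}) (hroot : root_system G Phi) (hred : reduced Phi).
Local Notation V := 'rV[R]_n.
Local Notation "<< u , v >>" := (dotp G u v) (at level 0, format "<< u ,  v >>").
Local Notation cr := (coroot G).
Local Notation sC := (dotp_real_sym hG).
Local Notation gen := (regular_vec G Phi).
Local Notation rfl := (refl G).
Context (m : V -> nat).
Hypothesis hm : forall a b, a \in Phi -> b \in Phi -> m (rfl a b) = m b.
Implicit Types (a b c u w lam : V).

Section FixedChamber.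
Context (lam : V) (gl : gen lam).

Definition positives := [seq b <- Phi | (0 < m b)%N && (0 < <<lam, b>>)].

(** Simplicity is taken as indecomposability of coroots: generation is then an induction, and
    obtuseness follows from [coroot_diff_mult]. *)
Definition simples := [seq b <- positives |
  ~~ has (fun c => has (fun d => cr b == cr c + cr d) positives) positives].

Lemma positivesP b : reflect [/\ b \in Phi, (0 < m b)%N & 0 < <<lam, b>>] (b \in positives).
Proof. by rewrite mem_filter; apply: (iffP andP) => [[/andP[? ?] ?]|[? -> ->]]. Qed.

Lemma simple_positive b : b \in simples -> b \in positives.
Proof. by rewrite mem_filter => /andP[]. Qed.

Lemma simple_indecomposable b c d : b \in simples -> c \in positives -> d \in positives ->
  cr b <> cr c + cr d.
Proof.
rewrite mem_filter => /andP[/hasPn h _] /h /hasPn h' /h'.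
by move=> /eqP.
Qed.

Lemma simples_uniq : uniq simples.
Proof. by rewrite !filter_uniq ?fset_uniq. Qed.

Lemma positive_cr b : b \in positives -> 0 < <<lam, cr b>>.
Proof. by move=> /positivesP[bP _]; rewrite (cr_gt0 hG hroot). Qed.

Lemma simples_generate b : b \in positives ->
  exists k : V -> nat, cr b = \sum_(s <- simples) (k s)%:R *: cr s.
Proof.
(* Induction on the number of positive coroots lower for [lam]; both summands of a decomposition are
   strictly lower. *)
pose rk b := count (fun c => <<lam, cr c>> < <<lam, cr b>>) positives.
have [N] := ubnP (rk b); elim: N b => // N IH b rkb bP.
have [bS|] := boolP (b \in simples).
  exists (fun x => (x == b) : nat); rewrite (bigD1_seq b) ?simples_uniq //= eqxx scale1r.
  by rewrite big1 ?addr0 // => c /negbTE->; rewrite scale0r.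
rewrite mem_filter bP andbT negbK => /hasP[c cP /hasP[d dP /eqP e]].
have rk_lt x y : x \in positives -> y \in positives -> cr b = cr x + cr y -> (rk x < rk b)%N.
  move=> xP yP exy.
  have xb : <<lam, cr x>> < <<lam, cr b>> by rewrite exy dotpDr ltrDl positive_cr.
  have hle : (count (fun c => (<<lam, cr c>> < <<lam, cr x>>)%R) positives
          + count_mem x positives <= rk b)%N.
    rewrite -count_predUI (@eq_count _ (predI _ _) pred0) ?count_pred0 ?addn0.
      by apply: sub_count => w /= /orP[wx|/eqP->//]; exact: lt_trans xb.
    by move=> w /=; apply/negP => /andP[wx /eqP ew]; move: wx; rewrite ew ltxx.
  apply: leq_trans hle; rewrite -addn1 leq_add2l -has_count.
  by apply/hasP; exists x => //=.
have [|kc ec] := IH c _ cP; first by rewrite -ltnS; apply: leq_trans rkb; rewrite ltnS; exact: rk_lt dP e.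
have [|kd ed] := IH d _ dP.
  by rewrite -ltnS; apply: leq_trans rkb; rewrite ltnS; apply: rk_lt cP _ => //; rewrite addrC.
exists (fun x => kc x + kd x)%N; rewrite e ec ed -big_split.
by apply: eq_bigr => s _; rewrite /= natrD scalerDl.
Qed.

(** Otherwise the difference of the two coroots would be a coroot of nonzero multiplicity, and
    according to its sign it would decompose [cr s] or [cr t]. *)
Lemma simples_obtuse s t : s \in simples -> t \in simples -> s != t -> <<cr s, cr t>> <= 0.
Proof.
move=> sS tS st; have sP := simple_positive sS; have tP := simple_positive tS.
have /positivesP[s1 s2 s3] := sP; have /positivesP[t1 t2 t3] := tP.
rewrite leNgt; apply/negP; rewrite (cr_gt0 hG hroot) // (cr_gt0l hG hroot) // => h.
have [c [cP mc ec]] := coroot_diff_mult hG hroot hred hm t1 s1 t2 s2 st h.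
have [lc|lc] := boolP (0 < <<lam, c>>).
  have cS : c \in positives by apply/positivesP.
  by apply: (simple_indecomposable sS cS tP); rewrite ec subrK.
have cS : - c \in positives.
  apply/positivesP; rewrite (root_opp hG hroot) (mN hG hroot hm) //; split => //.
  by rewrite (gen_opp_gt0 gl cP).
by apply: (simple_indecomposable tS cS sP); rewrite crN ec opprB subrK.
Qed.

(** The part with positive coefficients equals minus the rest, so by obtuseness its norm is
    nonpositive and it is zero; pairing it with [lam] then leaves no positive coefficient. *)
Lemma simples_free_aux (d : V -> R) : \sum_(s <- simples) d s *: cr s = 0 ->
  forall s, s \in simples -> d s <= 0.
Proof.
move=> d0; pose p := \sum_(s <- simples | 0 < d s) d s *: cr s.
have pE : p = \sum_(s <- simples | ~~ (0 < d s)) (- d s) *: cr s.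
  apply/eqP; rewrite -subr_eq0 -sumrN -[X in _ == X]d0 [X in _ == X](bigID (fun s => 0 < d s)) /=.
  by apply/eqP; congr (_ + _); apply: eq_bigr => s _; rewrite scaleNr opprK.
have p0 : p = 0.
  apply/eqP; rewrite -(dotp_eq0 hG) eq_le dotp_ge0 // andbT {2}pE dotp_suml.
  rewrite big_seq_cond sumr_le0 // => s /andP[sS ds]; rewrite dotp_sumr.
  rewrite big_seq_cond sumr_le0 // => t /andP[tS dt]; rewrite dotpZl dotpZr mulrA.
  apply: mulr_ge0_le0; first by apply: mulr_ge0; [exact: ltW|rewrite oppr_ge0 leNgt].
  by apply: simples_obtuse => //; apply: contraTneq ds => ->; rewrite dt.
move=> s sS; rewrite leNgt; apply/negP => ds.
have : <<lam, p>> = 0 by rewrite p0 dotp0r.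
rewrite /p dotp_sumr big_seq_cond => /eqP.
rewrite psumr_eq0 => [/allP/(_ s sS)|t /andP[tS dt]].
  by rewrite sS ds /= dotpZr mulf_eq0 !gt_eqF ?positive_cr ?simple_positive.
by rewrite dotpZr mulr_ge0 ?ltW // positive_cr ?simple_positive.
Qed.

Lemma simples_free (d : V -> R) : \sum_(s <- simples) d s *: cr s = 0 ->
  forall s, s \in simples -> d s = 0.
Proof.
move=> d0 s sS; apply/eqP; rewrite eq_le (simples_free_aux d0) //= -oppr_le0.
apply: (@simples_free_aux (fun s => - d s)) => //.
by under eq_bigr do rewrite scaleNr; rewrite sumrN d0 oppr0.
Qed.

Lemma simples_dual s0 : s0 \in simples -> exists w, forall s, s \in simples ->
  <<w, cr s>> = (s == s0)%:R.
Proof.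
move=> s0S; pose M : 'M[R]_(size simples, n) := \matrix_(i < size simples) cr (nth 0 simples i).
have /row_freeP[B MB] : row_free M.
  apply: inj_row_free => v vM; apply/rowP => i; rewrite !mxE.
  have si : nth 0 simples i \in simples by rewrite mem_nth.
  pose d (x : V) : R := if insub (index x simples) is Some j then v 0 j else 0.
  have dE (j : 'I_(size simples)) : d (nth 0 simples j) = v 0 j.
    by rewrite /d index_uniq ?simples_uniq // valK.
  rewrite -dE; apply: simples_free => //.
  rewrite -[RHS]vM mulmx_sum_row (big_nth 0) big_mkord; apply: eq_bigr => j _.
  by rewrite dE rowK.
have i0 : (index s0 simples < size simples)%N by rewrite index_mem.
have [w hw] := linear_form_dotp hG (col (Ordinal i0) B).
exists w => s sS; rewrite hw.
have is_ : (index s simples < size simples)%N by rewrite index_mem.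
have -> : cr s = row (Ordinal is_) M by rewrite rowK /= nth_index.
rewrite -row_mul colE mulmxA MB mul1mx mxE mxE andbT.
rewrite -val_eqE /=; congr (nat_of_bool _)%:R; apply/eqP/eqP => [e|->//].
by rewrite -(nth_index 0 sS) e nth_index.
Qed.

Lemma clat_simples u : coroot_lattice G Phi m u ->
  exists k : V -> int, u = \sum_(s <- simples) (k s)%:~R *: cr s.
Proof.
move=> [l ->].
suff h (r : seq V) : {subset r <= Phi} -> exists k : V -> int,
    \sum_(b <- r | (0 < m b)%N) (l b)%:~R *: cr b = \sum_(s <- simples) (k s)%:~R *: cr s.
  by apply: h.
elim: r => [|b r IH] hr.
  by exists (fun=> 0); rewrite big_nil big1 // => s _; rewrite scale0r.
have [|k ek] := IH; first by move=> x xr; apply: hr; rewrite inE xr orbT.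
rewrite big_cons ek; case: ifP => mb; last by exists k.
have bP : b \in Phi by apply: hr; rewrite mem_head.
suff [j ej] : exists j : V -> int, cr b = \sum_(s <- simples) (j s)%:~R *: cr s.
  exists (fun s => l b * j s + k s); rewrite ej scaler_sumr -big_split.
  by apply: eq_bigr => s _; rewrite /= intrD intrM scalerDl scalerA.
have [lb|lb] := boolP (0 < <<lam, b>>).
  have [|j ->] := @simples_generate b; first by apply/positivesP.
  by exists (fun s => (j s)%:Z).
have [|j ej] := @simples_generate (- b).
  by apply/positivesP; rewrite (root_opp hG hroot) (mN hG hroot hm) // (gen_opp_gt0 gl bP).
exists (fun s => - (j s)%:Z); rewrite -[b]opprK crN ej -sumrN.
by apply: eq_bigr => s _; rewrite intrN scaleNr.
Qed.

End FixedChamber.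

Local Notation zint := (signed_half_sum G Phi m).
Local Notation clat := (coroot_lattice G Phi m).
Local Notation rl := (half_sum G Phi m).

Lemma eq_rl lam lam' : (forall b, b \in Phi -> (0 < m b)%N ->
  (0 < <<lam, b>>) = (0 < <<lam', b>>)) -> rl lam = rl lam'.
Proof.
move=> h; rewrite /half_sum big_mkcond [RHS]big_mkcond; apply: eq_big_seq => b bP.
have [m0|mb] := posnP (m b); first by rewrite m0 mul0r scale0r !if_same.
by rewrite h.
Qed.

Definition bounded u := forall lam, gen lam -> <<lam, u>> <= <<lam, rl lam>>.

(** While [x <> u], some simple [s] used in [x - u] has [(x - u, s^vee) > 0], since otherwise the
    norm of [x - u] would be nonpositive. Dominance of [u] gives [(x, s) > 0], and [zint_string]
    subtracts [s^vee]. *)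
Lemma descend u lam : gen lam -> (forall b, b \in Phi -> 0 < <<lam, b>> -> 0 <= <<u, b>>) ->
  forall (N : nat) (k : V -> nat) x, (\sum_(s <- simples lam) k s = N)%N -> zint x ->
  x - u = \sum_(s <- simples lam) (k s)%:R *: cr s -> zint u.
Proof.
move=> gl dom; elim=> [|N IH] k x kN zx ex.
  suff <- : x = u by [].
  apply/eqP; rewrite -subr_eq0 ex big_seq big1 // => s sS.
  have /eqP := kN; rewrite sum_nat_seq_eq0 => /allP/(_ s sS)/eqP->.
  by rewrite scale0r.
have [s sS ks] : exists2 s, s \in simples lam & (0 < k s)%N /\ 0 < <<x - u, cr s>>.
  apply: contrapT => H.
  have : <<x - u, x - u>> <= 0.
    rewrite {2}ex dotp_sumr big_seq sumr_le0 // => s sS; rewrite dotpZr.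
    have [->|ks] := posnP (k s); first by rewrite mul0r.
    rewrite pmulr_rle0 ?ltr0n // leNgt; apply/negP => h; apply: H.
    by exists s.
  rewrite le_eqVlt dotp_eq0 // ltNge dotp_ge0 // orbF => /eqP x0.
  have : <<lam, x - u>> = 0 by rewrite x0 dotp0r.
  rewrite ex dotp_sumr big_seq => /eqP; rewrite psumr_eq0 => [/allP H0|s sS]; last first.
    by rewrite dotpZr mulr_ge0 ?ler0n // ltW // positive_cr // simple_positive.
  have : (\sum_(s <- simples lam) k s = 0)%N.
    apply/eqP; rewrite sum_nat_seq_eq0; apply/allP => s sS; have := H0 s sS.
    rewrite sS /= dotpZr mulf_eq0 (gt_eqF (positive_cr _)) ?simple_positive // orbF.
    by rewrite pnatr_eq0.
  by rewrite kN.
case: ks => ks hs; have /positivesP[sP orbit_char ls] := simple_positive sS.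
have zx' : zint (x - cr s).
  apply: (zint_string hG hroot hred hm) => //.
  rewrite -(cr_gt0 hG hroot) //; rewrite dotpBl subr_gt0 in hs.
  apply: le_lt_trans hs; have := dom _ sP ls.
  by rewrite cr_pair => h; rewrite mulr_ge0 // divr_ge0 // ltW // (root_sqr_gt0 hG hroot).
apply: (IH (fun t => if t == s then (k s).-1 else k t) (x - cr s)) => //.
  rewrite (bigD1_seq s) ?simples_uniq //= eqxx.
  apply: succn_inj; rewrite -kN (bigD1_seq s) ?simples_uniq //= -addSn prednK //.
  by congr addn; apply: eq_bigr => t /negbTE->.
rewrite addrAC ex (bigD1_seq s) ?simples_uniq //= [RHS](bigD1_seq s) ?simples_uniq //= eqxx.
rewrite addrAC; congr (_ + _); last by apply: eq_bigr => t /negbTE->.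
rewrite -subn1 natrB // scalerBl scale1r //.
Qed.

(* A lattice point satisfying the support inequalities of the zonotope is an
   integral zonotope point: move to the chamber of [u], where [rl lam - u] is a
   nonnegative combination of simple coroots, and descend from [rl lam]. *)
Lemma zint_saturated u u0 : zint u0 -> clat (u - u0) -> bounded u -> zint u.
Proof.
move=> z0 cu bu; have [v gv] := exists_gen hG hroot.
have [|N hN] := @eventually_seq _ Phi (fun b N => N%:R * <<u, b>> + <<v, b>> != 0 /\
   (0 < N%:R * <<u, b>> + <<v, b>> -> 0 <= <<u, b>>)).
  by move=> b bP; apply: large_multiple; rewrite (gv b bP) orbT.
pose lam := N%:R *: u + v.
have lamE b : <<lam, b>> = N%:R * <<u, b>> + <<v, b>> by rewrite dotpDl dotpZl.
have gl : gen lam by move=> b bP; rewrite lamE; case: (hN N (leqnn N) b bP).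
have dom b : b \in Phi -> 0 < <<lam, b>> -> 0 <= <<u, b>>.
  by move=> bP; rewrite lamE; case: (hN N (leqnn N) b bP).
have zl := zint_rl hG hroot hm gl.
have cK : clat (rl lam - u).
  rewrite -[_ - u](subrKA u0) -[u0 - u]opprB; apply: clatB => //.
  exact: (zint_sub hG hroot).
have [k ek] := clat_simples gl cK.
have k0 s : s \in simples lam -> 0 <= k s.
  move=> sS; rewrite leNgt; apply/negP => ks.
  (* The dual vector [w] isolates [k s]. Adding multiples of [w] to [lam] keeps the signs on the
     roots of nonzero multiplicity, hence also [rl]; far out in this direction a negative [k s]
     violates the support inequality. *)
  have [w hw] := simples_dual gl sS.
  have wpos b : b \in positives lam -> 0 <= <<w, b>>.
    move=> bP; have /positivesP[bPhi _ _] := bP.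
    rewrite leNgt -(cr_lt0 hG hroot) // -leNgt.
    have [j ->] := simples_generate bP; rewrite dotp_sumr big_seq sumr_ge0 // => t tS.
    by rewrite dotpZr hw // mulr_ge0 // ler0n.
  have [|N1 h1] := @eventually_seq _ Phi (fun b N => N%:R * <<w, b>> + <<lam, b>> != 0).
    move=> b bP; have [|N0 h0] := @large_multiple R <<w, b>> <<lam, b>>.
      by rewrite gl ?orbT.
    by exists N0 => N' /h0[].
  have [N2 h2] := archi_nat <<lam, rl lam - u>>.
  pose N' := maxn N1 N2; pose lam' := N'%:R *: w + lam.
  have lE b : <<lam', b>> = N'%:R * <<w, b>> + <<lam, b>> by rewrite dotpDl dotpZl.
  have gl' : gen lam' by move=> b bP; rewrite lE; apply: h1 => //; exact: leq_maxl.
  have pos b : b \in Phi -> (0 < m b)%N -> 0 < <<lam, b>> -> 0 < <<lam', b>>.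
    move=> bP mb lb; rewrite lE ltr_wpDl // mulr_ge0 ?ler0n // wpos //.
    exact/positivesP.
  have rlE : rl lam' = rl lam.
    apply: eq_rl => b bP mb; apply/idP/idP; last exact: pos.
    apply: contraTT => nb; have := pos (- b).
    rewrite (root_opp hG hroot) (mN hG hroot hm) // (gen_opp_gt0 gl bP) (gen_opp_gt0 gl' bP) nb.
    exact.
  have := bu _ gl'; rewrite rlE -subr_ge0 -dotpBr lE leNgt => /negP; apply.
  rewrite ek dotp_sumr -ek (bigD1_seq s) ?simples_uniq //= big_seq_cond big1 ?addr0; last first.
    by move=> t /andP[tS ts]; rewrite dotpZr hw // (negbTE ts) mulr0.
  rewrite dotpZr hw // eqxx mulr1.
  have hk : (k s)%:~R <= -1 :> R by rewrite -[-1]/((-1)%:~R) ler_int; lia.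
  have := h2 N' (leq_maxr _ _); have N0 : 0 <= N'%:R :> R by rewrite ler0n.
  by nra.
apply: (@descend u lam gl dom _ (fun s => `|k s|%N) (rl lam) erefl zl).
rewrite ek; apply: eq_big_seq => s /k0 ks; congr (_ *: _).
by rewrite natr_absz ger0_norm.
Qed.

Lemma zint_bounded_seq : exists r : seq V, forall u, zint u -> u \in r.
Proof.
suff h (s : seq V) : exists r : seq V, forall nn : V -> nat,
    (forall b, b \in s -> nn b <= m b)%N -> \sum_(b <- s) ((nn b)%:R / 2) *: cr b \in r.
  have [r hr] := h Phi; exists r => _ [nn [hn ->]]; apply: hr => b bP.
  by rewrite -(hn _ bP) leq_addr.
elim: s => [|b s [r hr]]; first by exists [:: 0] => nn _; rewrite big_nil inE.
exists [seq (j%:R / 2) *: cr b + x | j <- iota 0 (m b).+1, x <- r] => nn hn.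
rewrite big_cons; apply: (allpairs_f (fun j x => (j%:R / 2) *: cr b + x)).
  by rewrite mem_iota add0n ltnS hn // mem_head.
by apply: hr => c cs; apply: hn; rewrite inE cs orbT.
Qed.

(** All these vectors differ by the coroot lattice, so one of them suffices for each root [a]. The
    one taken is [rho^vee] for a chamber in which [a] is simple; its pairing with [a] is [m a]. *)
Lemma zint_coweight u : zint u -> coweights G Phi u.
Proof.
move=> zu a aP.
have [lam la hl] := exists_perp hG hroot hred aP.
have aNa := root_opp_neq hroot aP.
pose nn b := if b == a then m a else if b == - a then 0%N else if 0 < <<lam, b>> then m b else 0%N.
pose w := \sum_(b <- Phi) ((nn b)%:R / 2) *: cr b.
have zw : zint w.
  exists nn; split => // b bP; rewrite /nn.
  have [->|ba] := eqVneq b a; first by rewrite eq_sym (negbTE aNa) eqxx addn0.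
  have [->|bNa] := eqVneq b (- a); first by rewrite opprK eqxx (mN hG hroot hm).
  rewrite eqr_oppLR (negbTE bNa) (inj_eq oppr_inj) (negbTE ba).
  have := hl _ bP ba bNa; rewrite dotpNr oppr_gt0 (mN hG hroot hm) //.
  by case: ltgtP => //= _ _; rewrite ?addn0.
have -> : u = w + (u - w) by rewrite addrC subrK.
rewrite dotpDl rpredD //; last first.
  have [k ek] := clat_weight (root_weight hG hroot aP) (zint_sub hG hroot zu zw).
  by rewrite sC ek rpred_int.
suff -> : <<w, a>> = (m a)%:R by exact: rpred_nat.
have e2 : <<w, a>> + <<w, a>> = \sum_(b <- Phi) (nn b)%:R * <<cr b, a>>.
  by rewrite /w dotp_suml -big_split; apply: eq_bigr => b _; rewrite /= dotpZl; field.
have e3 : \sum_(b <- Phi) (nn b)%:R * <<cr b, a>> =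
    - \sum_(b <- Phi) (nn (rfl a b))%:R * <<cr b, a>>.
  rewrite (big_refl hG hroot _ _ _ aP) -sumrN; apply: eq_bigr => b _.
  by rewrite (cr_refl hG hroot) // (refl_sym hG) (refl_self hG hroot) // dotpNr mulrN.
have e4 : <<w, a>> *+ 4 = \sum_(b <- Phi) ((nn b)%:R - (nn (rfl a b))%:R) * <<cr b, a>>.
  under eq_bigr do rewrite mulrBl.
  by rewrite sumrB -e3 -e2; ring.
have NaP : - a \in Phi by rewrite (root_opp hG hroot).
have : <<w, a>> *+ 4 = (m a)%:R *+ 4.
  rewrite e4 (bigD1_seq a) ?fset_uniq //= (bigID (pred1 (- a))) /= [X in _ + (_ + X)]big1_seq; last first.
    move=> b /andP[/andP[ba bNa] bP].
    suff -> : nn (rfl a b) = nn b by rewrite subrr mul0r.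
    rewrite /nn (negbTE ba) (negbTE bNa).
    have -> : (rfl a b == a) = false.
      by apply/eqP => e; move: bNa; rewrite -(reflK hG hroot b aP) e (refl_self hG hroot) ?eqxx.
    have -> : (rfl a b == - a) = false.
      apply/eqP => e; move: ba; rewrite -(reflK hG hroot b aP) e reflN //.
      by rewrite (refl_self hG hroot) // opprK eqxx.
    by rewrite -(refl_sym hG) [rfl a lam]/refl cr_pair la mulr0 scale0r subr0 hm.
  rewrite (eq_bigl (pred1 (- a))) => [|c]; last first.
    by rewrite /=; have [->|] := eqVneq c (- a); rewrite ?andbF // andbT eq_sym aNa.
  rewrite -big_filter filter_pred1_uniq ?fset_uniq // big_seq1 addr0.
  rewrite (refl_self hG hroot) // reflN // (refl_self hG hroot) // opprK crN dotpNl (cr_self hG hroot) //.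
  by rewrite /nn eqxx eq_sym (negbTE aNa) eqxx; ring.
by move=> /eqP; rewrite eqrMn2r // => /eqP.
Qed.

End SimpleRoots.

Lemma seq_argmax (T : eqType) (R : realDomainType) (f : T -> R) (s : seq T) x0 :
  x0 \in s -> exists2 x, x \in s & forall y, y \in s -> f y <= f x.
Proof.
elim: s x0 => [//|a [|b s] IH] x0 _.
  by exists a; rewrite ?mem_head // => y; rewrite inE => /eqP->.
have [x xs hx] := IH b (mem_head _ _).
have [ax|xa] := leP (f a) (f x).
  by exists x; [rewrite inE xs orbT|move=> y; rewrite inE => /orP[/eqP->|/hx]].
exists a; first exact: mem_head.
move=> y; rewrite inE => /orP[/eqP->//|/hx yx].
exact: le_trans yx (ltW xa).
Qed.

(** * Orbits of (quasi)minuscule weights *)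

Section WeylOrbits.
Context (R : realType) (n : nat) (G : 'M[R]_n) (hG : scalar_product G).
Context (Phi : {fset 'rV[R]_n}) (hroot : root_system G Phi) (hred : reduced Phi).
Local Notation V := 'rV[R]_n.
Local Notation "<< u , v >>" := (dotp G u v) (at level 0, format "<< u ,  v >>").
Local Notation cr := (coroot G).
Local Notation sC := (dotp_real_sym hG).
Local Notation gen := (regular_vec G Phi).
Local Notation rfl := (refl G).
Implicit Types (a b c u w lam tau : V).

Lemma orbit_self u : Defs.orbit G Phi u u.
Proof. by exists id => //; exact: weyl_id. Qed.

Lemma orbit_refl a u tau : a \in Phi -> Defs.orbit G Phi u tau -> Defs.orbit G Phi u (rfl a tau).
Proof.
by move=> aP [w hw ->]; exists (rfl a \o w) => //; exact: weyl_refl.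
Qed.

Lemma orbit_ind u (P : V -> Prop) : P u ->
  (forall a tau, a \in Phi -> P tau -> P (rfl a tau)) ->
  forall tau, Defs.orbit G Phi u tau -> P tau.
Proof.
move=> Pu hP tau [w hw ->{tau}]; elim: hw => [//|a w' aP _ IH] /=.
exact: hP.
Qed.

(** A Weyl group element acts on a combination of roots through a self-map of the finite set of
    roots. *)
Lemma finite_orbit u : finite_set (Defs.orbit G Phi u).
Proof.
have [c ->] : exists c : 'I_(size Phi) -> R, u = \sum_i c i *: (nth 0 Phi i).
  case: hroot => sp _ _ _; have : u \in <<enum_fset Phi>>%VS by rewrite sp memvf.
  move=> /(@coord_span _ _ _ (in_tuple _)) e; rewrite {}e.
  by eexists.
pose g (f : {ffun 'I_(size Phi) -> 'I_(size Phi)}) : V := \sum_i c i *: nth 0 Phi (f i).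
apply: (@sub_finite_set _ _ (range g)); last exact: finite_image.
apply: orbit_ind => [|a tau aP [f _ <-]].
  by exists [ffun i => i] => //; apply: eq_bigr => i _; rewrite ffunE.
have ord0 (i : 'I_(size Phi)) : (index (rfl a (nth 0%R Phi (f i))) Phi < size Phi)%N.
  by rewrite index_mem root_refl // mem_nth.
exists [ffun i => Ordinal (ord0 i)] => //.
rewrite /g (big_morph (rfl a) (reflD G a) (_ : rfl a 0 = 0)); last first.
  by rewrite /refl dotp0l scale0r subr0.
apply: eq_bigr => i _; rewrite ffunE reflZ; congr (_ *: _).
by rewrite /= nth_index // root_refl // mem_nth.
Qed.

Lemma orbit_weights om tau : weights G Phi om -> Defs.orbit G Phi om tau -> weights G Phi tau.
Proof.
move=> hom; apply: orbit_ind => // a {}tau aP ht b bP.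
by rewrite (refl_sym hG) -(cr_refl hG hroot) // ht // root_refl.
Qed.

Context (omega : V) (hom : quasi_or_minuscule G Phi omega).

Definition Orb : seq V := fset_set (Defs.orbit G Phi omega).

Lemma mem_Orb tau : (tau \in Orb) <-> Defs.orbit G Phi omega tau.
Proof.
rewrite /Orb in_fset_set; last exact: finite_orbit.
by split; [move/set_mem|move/mem_set].
Qed.

Lemma Orb_uniq : uniq Orb.
Proof. exact: fset_uniq. Qed.

Lemma omega_weight : weights G Phi omega.
Proof. by case: hom => _ [] []. Qed.

Lemma Orb_weight tau : tau \in Orb -> weights G Phi tau.
Proof. by move=> /mem_Orb; apply: orbit_weights; exact: omega_weight. Qed.

Lemma Orb_refl a tau : a \in Phi -> tau \in Orb -> rfl a tau \in Orb.
Proof. by move=> aP /mem_Orb h; apply/mem_Orb; exact: orbit_refl. Qed.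

Lemma big_Orb_refl (T : Type) (idx : T) (op : Monoid.com_law idx) a (F : V -> T) :
  a \in Phi -> \big[op/idx]_(t <- Orb) F t = \big[op/idx]_(t <- Orb) F (rfl a t).
Proof.
move=> aP; have h : perm_eq [seq rfl a t | t <- Orb] Orb.
  apply: uniq_perm => [||b]; rewrite ?(map_inj_uniq (refl_inj hG hroot aP)) ?Orb_uniq //.
  apply/mapP/idP => [[c cP ->]|bP]; first exact: Orb_refl.
  by exists (rfl a b); rewrite ?(reflK hG hroot) // Orb_refl.
by rewrite -[LHS](perm_big _ h) big_map.
Qed.

Lemma Orb_small tau b : tau \in Orb -> b \in Phi -> b != tau -> b != - tau ->
  -1 <= <<cr b, tau>> <= 1.
Proof.
move=> /mem_Orb tO; move: b.
apply: (@orbit_ind omega (fun tau => forall b, b \in Phi -> b != tau -> b != - tau ->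
  -1 <= <<cr b, tau>> <= 1)) tO => [b bP b1 b2|a t aP IH b bP b1 b2].
  by rewrite sC; case: hom => _ [[_ h]|[_ _ h]]; [exact: h|exact: h].
rewrite -(refl_sym hG) -(cr_refl hG hroot) //; apply: IH; first exact: root_refl.
  by apply: contraNneq b1 => <-; rewrite (reflK hG hroot).
by apply: contraNneq b2 => e; rewrite -reflN // -e (reflK hG hroot).
Qed.

(** Besides integrality and [omega != 0], this list is what the sequel uses of the (quasi)minuscule
    condition. *)
Variant pair_spec tau b (j : R) : Prop :=
| Pair0 of j = 0
| Pair1 of j = 1
| PairN1 of j = -1
| Pair2 of j = 2 & tau = b
| PairN2 of j = -2 & tau = - b.

Lemma Orb_pair tau b : tau \in Orb -> b \in Phi -> pair_spec tau b <<cr b, tau>>.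
Proof.
move=> tO bP.
have [e|b1] := eqVneq b tau; first by apply: Pair2; rewrite -?e // (cr_self hG hroot).
have [e|b2] := eqVneq b (- tau).
  have tb : tau = - b by rewrite e opprK.
  by apply: PairN2 => //; rewrite tb dotpNr (cr_self hG hroot).
have := Orb_small tO bP b1 b2.
have /intrP[k ek] := Orb_weight tO bP; rewrite sC ek.
rewrite -[-1]/((-1)%:~R) -[X in _ <= _ <= X]/(1%:~R) !ler_int => hk.
have [->|[->|->]] : k = 0 \/ k = 1 \/ k = -1 by lia.
- exact: Pair0.
- exact: Pair1.
- exact: PairN1.
Qed.

Hypothesis hirr : irreducible_roots G Phi.

(** Irreducibility is used here. A root not orthogonal to the orbit is a multiple of some
    [tau - s_a tau], hence orthogonal to every root that is orthogonal to the orbit. One of the two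
    classes is empty, and it is the second because [omega] is nonzero. *)
Lemma Orb_span u : (forall tau, tau \in Orb -> <<tau, u>> = 0) -> u = 0.
Proof.
move=> hu; pose P a := exists2 tau, tau \in Orb & <<tau, a>> != 0.
pose A := [fset a in Phi | `[< P a >]]%fset; pose B := [fset a in Phi | ~~ `[< P a >]]%fset.
have hA a : a \in Phi -> P a -> exists tau k, tau \in Orb /\ a = k *: (tau - rfl a tau).
  move=> aP [tau tO ta]; exists tau, (<<tau, cr a>>)^-1; split => //.
  by rewrite /refl opprB addrC subrK scalerA mulVf ?scale1r // (cr_pair_eq0 hG hroot).
have [_ irr] := hirr.
have [||A0|B0] := irr A B.
- apply/fsetP => a; rewrite !inE /=; case aP: (a \in Phi) => //=.
  by case: asboolP.
- move=> a b; rewrite !inE /= => /andP[aP /asboolP Pa] /andP[bP /asboolPn Pb].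
  have hb t : t \in Orb -> <<t, b>> = 0.
    by move=> tO; apply/eqP/negPn/negP => tb; apply: Pb; exists t.
  have [tau [k [tO ->]]] := hA _ aP Pa.
  by rewrite dotpZl dotpBl !hb ?subrr ?mulr0 // Orb_refl.
- case: hom => /negP om0 _; case: om0; apply/eqP/(root_span hG hroot) => a aP.
  apply/eqP/negPn/negP => oa; have : a \in A.
    rewrite !inE /= aP; apply/asboolP; exists omega => //.
    by apply/mem_Orb; exact: orbit_self.
  by rewrite A0 inE.
- apply: (root_span hG hroot) => a aP; rewrite sC.
  have Pa : P a.
    apply: contrapT => Pa; have : a \in B by rewrite !inE /= aP; apply/asboolPn.
    by rewrite B0 inE.
  have [tau [k [tO ->]]] := hA _ aP Pa.
  by rewrite dotpZl dotpBl !hu ?subrr ?mulr0 // Orb_refl.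
Qed.

Section Weight.
Context (m : V -> nat).
Hypothesis hm : forall a b, a \in Phi -> b \in Phi -> m (rfl a b) = m b.
Local Notation rl := (half_sum G Phi m).

Lemma rl_refl a lam : a \in Phi -> rl (rfl a lam) = rfl a (rl lam).
Proof.
move=> aP; rewrite /half_sum (big_refl hG hroot _ _ _ aP) [RHS](big_morph (rfl a) (reflD G a) (_ : rfl a 0 = 0)).
  rewrite big_seq_cond [RHS]big_seq_cond; apply: eq_big => [b|b /andP[bP _]].
    by rewrite (refl_isom hG hroot).
  by rewrite hm // [RHS]reflZ (cr_refl hG hroot).
by rewrite /refl dotp0l scale0r subr0.
Qed.

(** Maximising the pairing with [v] over the Weyl orbit of [lam] reaches the chamber of [v], and
    reflections permute the orbit of [omega]. The constant term of the operator can therefore be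
    computed in any chamber. *)
Lemma rl_chamber (T : nmodType) (F : R -> T) lam v : gen lam -> gen v ->
  \sum_(t <- Orb) F (dotp G (rl lam) t) = \sum_(t <- Orb) F (dotp G (rl v) t).
Proof.
move=> gl gv.
have fO := finite_orbit lam.
have mO l : (l \in fset_set (Defs.orbit G Phi lam)) <-> Defs.orbit G Phi lam l.
  by rewrite in_fset_set //; split; [move/set_mem|move/mem_set].
have [|mu /mO muO hmu] := @seq_argmax _ R (dotp G ^~ v) (fset_set (Defs.orbit G Phi lam)) lam.
  by apply/mO; exact: orbit_self.
have inv : gen mu /\ \sum_(t <- Orb) F (dotp G (rl lam) t) = \sum_(t <- Orb) F (dotp G (rl mu) t).
  apply: (@orbit_ind lam (fun mu => gen mu /\
    \sum_(t <- Orb) F (dotp G (rl lam) t) = \sum_(t <- Orb) F (dotp G (rl mu) t))) muO => //.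
  move=> a t aP [gt ->]; split; first exact: gen_refl.
  by rewrite rl_refl // (big_Orb_refl _ _ aP); under eq_bigr do rewrite -(refl_sym hG).
have [gmu ->] := inv.
have dom b : b \in Phi -> 0 < <<v, b>> -> 0 < <<mu, b>>.
  move=> bP vb; rewrite lt_neqAle eq_sym gmu //=.
  have /mO/hmu : Defs.orbit G Phi lam (rfl b mu) by exact: orbit_refl.
  rewrite /refl dotpBl dotpZl lerBlDr lerDl (sC b) => h.
  rewrite leNgt; apply/negP => mb; move: h; apply/negP; rewrite -ltNge.
  by rewrite nmulr_rlt0 // (cr_lt0 hG hroot).
suff -> : rl mu = rl v by [].
apply: (eq_rl (m := m)) => b bP _; apply/idP/idP; last exact: dom.
apply: contraTT => nb; have := dom (- b).
by rewrite (root_opp hG hroot) (gen_opp_gt0 gv bP) (gen_opp_gt0 gmu bP) nb; exact.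
Qed.

Context (Pos : {fset V}) (v : V) (gv : gen v) (hPos : Pos = [fset a in Phi | 0 < <<v, a>>]%fset).

Lemma big_Pos (T : Type) (idx : T) (op : Monoid.com_law idx) (F : V -> T) :
  \big[op/idx]_(b <- Pos) F b = \big[op/idx]_(b <- Phi | 0 < <<v, b>>) F b.
Proof.
rewrite hPos -[RHS]big_filter; apply: perm_big; apply: uniq_perm.
- exact: fset_uniq.
- by rewrite filter_uniq ?fset_uniq.
- by move=> b; rewrite mem_filter !inE andbC.
Qed.

Lemma mem_Pos a : (a \in Pos) = (a \in Phi) && (0 < <<v, a>>).
Proof. by rewrite hPos !inE. Qed.

Lemma rhov_rl : rhov G Pos m = rl v.
Proof. by rewrite /rhov big_Pos. Qed.

Lemma zint_split_Pos nn : (forall b, b \in Phi -> nn b + nn (- b) = m b)%N ->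
  \sum_(b <- Phi) ((nn b)%:R / 2) *: cr b =
  \sum_(a <- Pos) (nn a)%:R *: cr a - rl v.
Proof.
move=> h; rewrite (zint_split hG hroot _ gv) big_Pos /half_sum -sumrB.
rewrite big_seq_cond [RHS]big_seq_cond; apply: eq_bigr => b /andP[bP _].
by rewrite -scalerBl; congr (_ *: _); rewrite -(h _ bP) natrD; field.
Qed.

Lemma shiftsE nu : shifts G Pos m nu <-> nu != 0 /\ signed_half_sum G Phi m (nu - rl v).
Proof.
split=> [[nu0 [l [hl e]]]|[nu0 [nn [hn e]]]]; split => //.
  pose nn b := if 0 < <<v, b>> then l b else (m b - l (- b))%N.
  have hnn b : b \in Phi -> (nn b + nn (- b) = m b)%N.
    move=> bP; rewrite /nn (gen_opp_gt0 gv bP) opprK (mN hG hroot hm) //.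
    case: ifP => vb /=; first by rewrite subnKC // hl // mem_Pos bP.
    rewrite subnK // -(mN hG hroot hm) // hl // mem_Pos (root_opp hG hroot) bP.
    by rewrite (gen_opp_gt0 gv bP) vb.
  exists nn; split => //; rewrite zint_split_Pos // e; congr (_ - _).
  rewrite !big_Pos; apply: eq_bigr => b vb; by rewrite /nn vb.
exists nn; split.
  by move=> a; rewrite mem_Pos => /andP[aP _]; rewrite -(hn _ aP) leq_addr.
by move: e; rewrite zint_split_Pos // => /addIr.
Qed.

Lemma zint_polytope u : signed_half_sum G Phi m u -> polytope G Pos m u.
Proof.
move=> [nn [hn ->]]; exists (fun a => (nn (- a))%:R); split.
  move=> a; rewrite mem_Pos => /andP[aP _]; rewrite ler0n ler_nat -(hn _ aP).
  exact: leq_addl.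
rewrite zint_split_Pos // rhov_rl big_Pos big_Pos /half_sum -sumrB -sumrB.
rewrite big_seq_cond [RHS]big_seq_cond; apply: eq_bigr => b /andP[bP _].
by rewrite -!scalerBl; congr (_ *: _); rewrite -(hn _ bP) natrD; field.
Qed.

End Weight.
End WeylOrbits.

(** * Regularity and quasi-invariance of the Macdonald operator *)

Section FormalDerivative.
Context (R : realType).
Local Notation K := R[i].

(* The derivative at [0] is read off the exponents, so that no differential
   calculus is needed; it does not depend on the representation ([hasd_uniq]). *)
Definition hasd (S : R -> K) (d : K) : Prop :=
  exists2 s : seq (K * K), forall t, S t = \sum_(p <- s) p.1 * cexp (p.2 * t%:C) &
    d = \sum_(p <- s) p.1 * p.2.

Lemma hasd_ext S T d : S =1 T -> hasd S d -> hasd T d.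
Proof. by move=> ST [s sE ->]; exists s => // t; rewrite -ST. Qed.

Lemma hasd_exp a b : hasd (fun t => a * cexp (b * t%:C)) (a * b).
Proof. by exists [:: (a, b)] => [t|]; rewrite big_seq1. Qed.

Lemma hasd_cst a : hasd (fun=> a) 0.
Proof. by exists [:: (a, 0)] => [t|]; rewrite big_seq1 /= ?mul0r ?mulr0 ?cexp0 ?mulr1. Qed.

Lemma hasdD S T d e : hasd S d -> hasd T e -> hasd (fun t => S t + T t) (d + e).
Proof.
by move=> [s sE ->] [r rE ->]; exists (s ++ r) => [t|]; rewrite big_cat //= sE rE.
Qed.

Lemma hasdM S T d e : hasd S d -> hasd T e ->
  hasd (fun t => S t * T t) (d * T 0 + S 0 * e).
Proof.
move=> [s sE ->] [r rE ->]; exists [seq (p.1 * p'.1, p.2 + p'.2) | p <- s, p' <- r].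
  move=> t; rewrite sE rE big_allpairs_dep mulr_suml; apply: eq_bigr => p _.
  by rewrite mulr_sumr; apply: eq_bigr => p' _; rewrite /= mulrDl cexpD; ring.
rewrite big_allpairs_dep sE rE mulr_suml.
rewrite [X in _ + X = _]mulr_suml -big_split; apply: eq_bigr => p _ /=.
rewrite mulr_sumr [X in _ + X = _]mulr_sumr -big_split; apply: eq_bigr => p' _ /=.
by rewrite !mulr0 cexp0; ring.
Qed.

Lemma hasd_sum (I : eqType) (r : seq I) (S : I -> R -> K) :
  (forall i, i \in r -> hasd (S i) 0) -> hasd (fun t => \sum_(i <- r) S i t) 0.
Proof.
elim: r => [|i r IH] h.
  by apply: hasd_ext (hasd_cst 0) => t; rewrite big_nil.
apply: (@hasd_ext (fun t => S i t + \sum_(i <- r) S i t)) => [t|]; first by rewrite big_cons.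
have hr : hasd (fun t => \sum_(i <- r) S i t) 0.
  by apply: IH => j jr; apply: h; rewrite inE jr orbT.
by have := hasdD (h i (mem_head _ _)) hr; rewrite addr0.
Qed.

Lemma hasd_uniq S d e : hasd S d -> hasd S e -> d = e.
Proof.
move=> [s sE ->] [r rE ->]; apply/eqP; rewrite -subr_eq0; apply/eqP.
have := @sum_derivative_eq0 R (s ++ [seq (- p.1, p.2) | p <- r]).
rewrite big_cat big_map /=; under [X in _ + X]eq_bigr do rewrite mulNr.
rewrite sumrN; apply => t; rewrite big_cat big_map /=.
by under [X in _ + X]eq_bigr do rewrite mulNr; rewrite sumrN -sE -rE subrr.
Qed.

Lemma hasd_even S d : (forall t, S (- t) = S t) -> hasd S d -> d = 0.
Proof.
move=> ev hd; have hN : hasd S (- d).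
  case: hd => s sE ->; exists [seq (p.1, - p.2) | p <- s].
    move=> t; rewrite -ev sE big_map; apply: eq_bigr => p _ /=.
    by rewrite rcN mulrN mulNr.
  by rewrite big_map -sumrN; apply: eq_bigr => p _ /=; rewrite mulrN.
have := hasd_uniq hd hN => /eqP.
by rewrite -subr_eq0 opprK -mulr2n -mulr_natl mulf_eq0 pnatr_eq0 /= => /eqP.
Qed.

End FormalDerivative.

Section QuasiInvariants.
Context (R : realType) (n : nat) (G : 'M[R]_n) (hG : scalar_product G).
Context (logq : R[i]).
Hypothesis hq : forall k : nat, (0 < k)%N -> cexp logq ^+ k != 1.
Context (Phi : {fset 'rV[R]_n}) (hroot : root_system G Phi) (hred : reduced Phi).
Context (m : 'rV[R]_n -> nat).
Hypothesis hm : forall a b, a \in Phi -> b \in Phi -> m (refl G a b) = m b.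
Context (rho : 'rV[R]_n) (hrho : signed_half_sum G Phi m rho).
Context (omega : 'rV[R]_n) (hom : quasi_or_minuscule G Phi omega).
Context (CE : R[i]).
Local Notation K := R[i].
Local Notation V := 'rV[R]_n.
Local Notation VC := 'rV[R[i]]_n.
Local Notation "<< u , v >>" := (dotp G u v) (at level 0, format "<< u ,  v >>").
Local Notation cr := (coroot G).
Local Notation sC := (dotp_real_sym hG).
Local Notation gen := (regular_vec G Phi).
Local Notation rfl := (refl G).
Local Notation ee := (expc G logq).
Local Notation sp := (sp G logq).
Local Notation cf := (cf G logq).
Local Notation qpow := (qpow logq).
Local Notation qbr := (qbr logq).
Local Notation cpair := (cpair G).
Local Notation clat := (coroot_lattice G Phi m).
Local Notation generic := (generic G Phi logq).
Local Notation Orb := (Orb G Phi omega).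
Local Notation rl := (half_sum G Phi m).

Section Divisibility.
Implicit Types (a b : V) (z w xi : VC) (f F H A : VC -> K).

Definition coroot_exp b z : K := ee (toC (cr b)) z.
Local Notation Y := coroot_exp.

Lemma YE b z : Y b z = qpow (2 * cpair b z).
Proof. by []. Qed.

Lemma Y_neq0 b z : Y b z != 0.
Proof. exact: ee_neq0. Qed.

Lemma YN b z : Y (- b) z = (Y b z)^-1.
Proof. by rewrite /Y crN toCN eeN. Qed.

Lemma cpairD b z w : cpair b (z + w) = cpair b z + cpair b w.
Proof. by rewrite /Defs.cpair /cdot dotpDr. Qed.

Lemma cpairZ b k z : cpair b (k *: z) = k * cpair b z.
Proof. by rewrite /Defs.cpair /cdot dotpZr. Qed.

Lemma cpairN b z : cpair b (- z) = - cpair b z.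
Proof. by rewrite /Defs.cpair /cdot dotpNr. Qed.

Lemma cpair_toC b (u : V) : cpair b (toC u) = <<cr b, u>>%:C.
Proof. exact: cdot_toC. Qed.

Lemma YD b z w : Y b (z + w) = Y b z * qpow (2 * cpair b w).
Proof. by rewrite /Y eeDr. Qed.

Lemma qbr_cpair b z (l : int) :
  (qbr (cpair b z + l%:~R) == 0) = (Y b z * qpow (2 * l%:~R) == 1).
Proof. by rewrite qbr_eq0 mulrDr qpowD YE. Qed.

Lemma qpow_neg (x : K) : qpow (2 * - x) = (qpow (2 * x))^-1.
Proof. by rewrite mulrN qpowN. Qed.

Definition off (a : V) z := forall b (l : int), b \in Phi -> b != a -> b != - a ->
  qbr (cpair b z + l%:~R) != 0.

Lemma off_neq a z b (l : int) : off a z -> b \in Phi -> b != a -> b != - a ->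
  Y b z != qpow (2 * l%:~R).
Proof.
move=> h bP ba bNa; have := h b (- l) bP ba bNa; rewrite qbr_cpair.
apply: contra => /eqP->; rewrite rmorphN qpow_neg mulfV ?qpow_neq0 //.
Qed.

Lemma generic_neq z b (l : int) : generic z -> b \in Phi -> Y b z != qpow (2 * l%:~R).
Proof.
move=> h bP; have := h b (- l) bP; rewrite qbr_cpair.
apply: contra => /eqP->; rewrite rmorphN qpow_neg mulfV ?qpow_neq0 //.
Qed.

(** Two integers [k] meeting walls of the same [b] contradict the choice of [s] by [exists_step], so
    each [b] excludes at most one [k]. *)
Lemma line_regular (lam : V) (bs : seq V) : (forall b, b \in bs -> <<cr b, lam>> != 0) ->
  exists s : R, forall z, exists k0, forall k, (k0 <= k)%N -> forall b (l : int), b \in bs ->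
    qbr (cpair b (z + k%:R *: (s%:C *: toC lam)) + l%:~R) != 0.
Proof.
move=> hb; have [|s hs] := exists_step hq (rs := [seq <<cr b, lam>> | b <- bs]).
  by move=> _ /mapP[b /hb ? ->].
exists s => z; suff [k0 h] : exists k0, forall k, (k0 <= k)%N -> forall b, b \in bs ->
    forall l : int, qbr (cpair b (z + k%:R *: (s%:C *: toC lam)) + l%:~R) != 0.
  by exists k0 => k /h hk b l /hk.
apply: eventually_seq => b bbs.
have E k : cpair b (z + k%:R *: (s%:C *: toC lam)) = cpair b z + s%:C * <<cr b, lam>>%:C * k%:R.
  by rewrite cpairD !cpairZ cpair_toC; ring.
have [[k1 [l1 h1]]|H] := pselect (exists k1 (l : int),
    qbr (cpair b (z + k1%:R *: (s%:C *: toC lam)) + l%:~R) = 0); last first.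
  by exists 0%N => k _ l; apply/eqP => e; apply: H; exists k, l.
exists k1.+1 => k k1k l; apply/eqP => e.
have := hs <<cr b, lam>> (k%:Z - k1%:Z) (l - l1).
move=> /(_ (map_f (fun b => dotp G (cr b) lam) bbs)) h; have kk : k%:Z - k1%:Z != 0 by lia.
move: {h} (h kk) => /negP; apply.
move: h1 e => /eqP + /eqP; rewrite !qbr_eq0 !E => /eqP h1 /eqP h2.
rewrite !rmorphB /= -!pmulrn.
have -> : 2 * (s%:C * <<cr b, lam>>%:C * (k%:R - k1%:R) + (l%:~R - l1%:~R)) =
  2 * (cpair b z + s%:C * <<cr b, lam>>%:C * k%:R + l%:~R) -
  2 * (cpair b z + s%:C * <<cr b, lam>>%:C * k1%:R + l1%:~R) by ring.
by rewrite qpowB h1 h2 divff ?oner_eq0.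
Qed.

Lemma sp_generic P f : sp P f -> (forall z, generic z -> f z = 0) -> forall z, f z = 0.
Proof.
move=> fP h z; have [lam gl] := exists_gen hG hroot.
have [|s hs] := @line_regular lam Phi.
  by move=> b bP; rewrite sC (cr_pair_eq0 hG hroot) // gl.
have [k0 hk] := hs z.
apply: (sp_line (w := s%:C *: toC lam) (k0 := k0) fP) => k /hk hk'.
by apply: h => b l; exact: hk'.
Qed.

Lemma sp_eq_generic P Q f F : sp P f -> sp Q F -> (forall z, generic z -> f z = F z) -> f =1 F.
Proof.
move=> fP FQ h z; apply/eqP; rewrite -subr_eq0; apply/eqP.
have : sp setT (fun z => f z - F z) by apply: spB; [exact: sp_sub fP|exact: sp_sub FQ].
by move=> /sp_generic; apply => w /h->; rewrite subrr.
Qed.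

(** The direction is orthogonal to [a], so [Y a] is constant along the line, while the walls of the
    other roots are eventually left. *)
Lemma off_line a : a \in Phi -> exists w, cpair a w = 0 /\
  forall z, exists k0, forall k, (k0 <= k)%N -> off a (z + k%:R *: w).
Proof.
move=> aP; have [lam la hl] := exists_perp hG hroot hred aP.
have [|s hs] := @line_regular lam [seq b <- Phi | (b != a) && (b != - a)].
  move=> b; rewrite mem_filter => /andP[/andP[ba bNa] bP].
  by rewrite sC (cr_pair_eq0 hG hroot) // hl.
exists (s%:C *: toC lam); split.
  by rewrite cpairZ cpair_toC sC cr_pair la mulr0 mulr0.
move=> z; have [k0 hk] := hs z; exists k0 => k /hk h b l bP ba bNa.
by apply: h; rewrite mem_filter ba bNa.
Qed.

Definition Lc : set VC := [set xi | exists2 mu, xi = toC mu & clat mu].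

(** On this coset the pairings of [mu] with roots are integers ([coset_coweight]), as the division
    in [sp_div] requires. *)
Definition Px (x : VC) : set VC := [set xi | exists2 mu, xi = x + toC mu & clat (mu - rho)].

Lemma Lc0 : Lc 0.
Proof. by exists 0; [rewrite toC0|exact: clat0]. Qed.

Lemma LcD xi eta : Lc xi -> Lc eta -> Lc (xi + eta).
Proof. by move=> [u -> hu] [w -> hw]; exists (u + w); [rewrite toCD|exact: clatD]. Qed.

Lemma LcP x xi eta : Lc xi -> Px x eta -> Px x (xi + eta).
Proof.
move=> [u -> hu] [w -> hw]; exists (u + w); first by rewrite toCD addrCA.
by rewrite -addrA; exact: clatD.
Qed.

Lemma spLM f F : sp Lc f -> sp Lc F -> sp Lc (fun z => f z * F z).
Proof. exact: (spM LcD). Qed.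

Lemma spLP x f F : sp Lc f -> sp (Px x) F -> sp (Px x) (fun z => f z * F z).
Proof. exact: (spM (@LcP x)). Qed.

Lemma sp_Y b : b \in Phi -> (0 < m b)%N -> sp Lc (Y b).
Proof. by move=> bP mb; apply: sp_ee; exists (cr b) => //; exact: clat_coroot. Qed.

Lemma coset_coweight (mu a : V) : a \in Phi -> clat (mu - rho) -> exists k : int, <<mu, a>> = k%:~R.
Proof.
move=> aP cm; apply/intrP; rewrite -[mu](subrK rho) dotpDl rpredD //; last first.
  exact: (zint_coweight hG hroot hred hm).
have [k ek] := clat_weight (root_weight hG hroot aP) cm.
by rewrite sC ek rpred_int.
Qed.

Section OneRoot.
Context (a : V) (aP : a \in Phi) (ma : (0 < m a)%N).

Lemma sp_power_diff (d : K) (k : int) : d != 0 ->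
  exists2 g, sp Lc g & forall z, ee (toC (k%:~R *: cr a)) z - d ^ k = (Y a z - d) * g z.
Proof.
move=> d0.
have ka z (j : nat) : ee (toC (j%:R *: cr a)) z = Y a z ^+ j.
  by rewrite toCZ rc_nat ee_sym // eeMn -ee_sym.
have nat_case (j : nat) : exists2 g, sp Lc g & forall z, Y a z ^+ j - d ^+ j = (Y a z - d) * g z.
  elim: j => [|j [g gL gE]].
    by exists (fun=> 0); [exact: sp0|move=> z; rewrite subrr mulr0].
  exists (fun z => Y a z * g z + d ^+ j).
    by apply: spD; [exact: spLM (sp_Y aP ma) gL|apply: sp_cst; exact: Lc0].
  move=> z; rewrite mulrDr mulrCA -gE !exprS; ring.
case: k => j.
  by have [g gL gE] := nat_case j; exists g => // z; rewrite -pmulrn ka gE.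
have [g gL gE] := nat_case j.+1.
exists (fun z => (- (d ^+ j.+1)^-1) * (ee (toC (- (j.+1%:R *: cr a))) z * g z)).
  apply: spZ; apply: spLM gL; apply: sp_ee; exists (- (j.+1%:R *: cr a)) => //.
  by apply: clatN; rewrite -[j.+1%:R]/(j.+1%:~R); apply: clatZ; exact: clat_coroot.
move=> z; have -> : d ^ Negz j = (d ^+ j.+1)^-1 by [].
rewrite NegzE mulrNz scaleNr -pmulrn toCN eeN ka.
have y0 := expf_neq0 j.+1 (Y_neq0 a z); have dd0 := expf_neq0 j.+1 d0.
have -> : (Y a z - d) * (- (d ^+ j.+1)^-1 * ((Y a z ^+ j.+1)^-1 * g z)) =
  - ((d ^+ j.+1)^-1 * (Y a z ^+ j.+1)^-1 * ((Y a z - d) * g z)) by ring.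
by rewrite -gE; field; rewrite y0 dd0.
Qed.

(* Write each exponent as [r + k alpha^vee] with [(r, alpha)] in {0, 1}.  Modulo
   [Y - d] the exponential sum becomes [G0 + G1], where the two parts are scaled
   differently when [z] moves along [alpha]; the hyperplane [Y = d] meets this
   line at two points where the scalings of [G1] are opposite, so both vanish. *)
Lemma sp_div x f (a1 : K) : sp (Px x) f ->
  (forall z, Y a z = qpow (2 * a1) -> f z = 0) ->
  exists2 F, sp (Px x) F & forall z, f z = (Y a z - qpow (2 * a1)) * F z.
Proof.
move=> [s sP fs] fz; set d := qpow (2 * a1); have d0 : d != 0 := qpow_neq0 _ _.
pose mu (xi : VC) : V := map_mx (@complex.Re R) (xi - x).
have muE xi : Px x xi -> xi = x + toC (mu xi) /\ clat (mu xi - rho).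
  move=> [u -> hu]; suff -> : mu (x + toC u) = u by [].
  by apply/rowP => i; rewrite /mu addrC addKr !mxE.
pose k xi : int := Num.floor (<<mu xi, a>> / 2).
pose r xi : VC := xi - toC ((k xi)%:~R *: cr a).
have kP xi : Px x xi -> <<mu xi, a>> - 2 * (k xi)%:~R = 0 \/ <<mu xi, a>> - 2 * (k xi)%:~R = 1.
  move=> /muE[_ /(coset_coweight aP)[j ej]]; rewrite /k ej.
  set l := Num.floor _; have /andP[l1 l2] := floor_itv (j%:~R / 2 : R).
  rewrite -/l in l1 l2.
  have [h1 h2] : (2 * l <= j) /\ (j < 2 * l + 2).
    split; first by rewrite -(ler_int R) rmorphM /=; lra.
    by rewrite -(ltr_int R) rmorphD rmorphM /=; rewrite rmorphD /= in l2; lra.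
  have [->|->] : j = 2 * l \/ j = 2 * l + 1 by lia.
    by left; rewrite rmorphM /= subrr.
  by right; rewrite rmorphD rmorphM /=; ring.
have eE xi z : ee xi z = ee (r xi) z * ee (toC ((k xi)%:~R *: cr a)) z.
  by rewrite -eeD /r subrK.
have rP xi : Px x xi -> Px x (r xi).
  move=> [u -> hu]; exists (u - (k (x + toC u))%:~R *: cr a).
    by rewrite /r toCB addrA.
  by rewrite addrAC; apply: clatB => //; apply: clatZ; exact: clat_coroot.
pose G0 z := \sum_(p <- s | <<mu p.2, a>> - 2 * (k p.2)%:~R == 0) p.1 * d ^ (k p.2) * ee (r p.2) z.
pose G1 z := \sum_(p <- s | <<mu p.2, a>> - 2 * (k p.2)%:~R != 0) p.1 * d ^ (k p.2) * ee (r p.2) z.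
have [F FP FE] : exists2 F, sp (Px x) F &
    forall z, f z = (Y a z - d) * F z + (G0 z + G1 z).
  have hc xi : exists g, sp Lc g /\
      forall z, ee (toC ((k xi)%:~R *: cr a)) z - d ^ k xi = (Y a z - d) * g z.
    by have [g gL gE] := sp_power_diff (k xi) d0; exists g.
  have [h hh] := choice hc.
  exists (fun z => \sum_(p <- s) p.1 * (h p.2 z * ee (r p.2) z)).
    apply: sp_sum => p ps; apply: spZ; apply: spLP; first by case: (hh p.2).
    by apply: sp_ee; apply: rP; exact: sP.
  move=> z; have -> : G0 z + G1 z = \sum_(p <- s) p.1 * d ^ (k p.2) * ee (r p.2) z.
    by rewrite [RHS](bigID (fun p : K * VC => dotp G (mu p.2) a - 2 * (k p.2)%:~R == 0)).
  rewrite fs /ev mulr_sumr -big_split; apply: eq_bigr => p _ /=.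
  have [_ /(_ z) hz] := hh p.2.
  have -> : (Y a z - d) * (p.1 * (h p.2 z * ee (r p.2) z)) =
     p.1 * (((Y a z - d) * h p.2 z) * ee (r p.2) z) by ring.
  rewrite -hz [ee p.2 z]eE.
  move: (ee (r p.2) z) (ee (toC _) z) (d ^ k p.2) => u1 u2 u3; ring.
exists F => // z; rewrite FE.
suff [-> ->] : G0 z = 0 /\ G1 z = 0 by rewrite !addr0.
pose kap (t : K) := qpow (2 * (t * cdot G x (toC a))).
have eT p t : p \in s -> ee (r p.2) (z + t *: toC a) =
    kap t * qpow (2 * (t * (<<mu p.2, a>> - 2 * (k p.2)%:~R)%:C)) * ee (r p.2) z.
  move=> ps; have [e _] := muE _ (sP _ ps).
  rewrite eeDr mulrC; congr (_ * _); rewrite /expc /kap -qpowD; congr qpow.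
  rewrite /cdot dotpZr /r {1}e dotpBl dotpDl -!/(cdot _ _ _) !cdot_toC dotpZl (cr_self hG hroot) //.
  by rewrite rcB !rcM rc_nat !rc_int; ring.
have G0T t : G0 (z + t *: toC a) = kap t * G0 z.
  rewrite /G0 mulr_sumr big_seq_cond [RHS]big_seq_cond; apply: eq_bigr => p /andP[ps /eqP e].
  by rewrite eT // e mulr0 mulr0 qpow0 mulr1 mulrCA.
have G1T t : G1 (z + t *: toC a) = kap t * qpow (2 * t) * G1 z.
  rewrite /G1 mulr_sumr big_seq_cond [RHS]big_seq_cond; apply: eq_bigr => p /andP[ps e].
  have [e0|e1] := kP _ (sP _ ps); first by rewrite e0 eqxx in e.
  by rewrite eT // e1 mulr1 mulrCA.
have key t : Y a (z + t *: toC a) = d -> G0 z + qpow (2 * t) * G1 z = 0.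
  move=> e; have := FE (z + t *: toC a); rewrite fz // e subrr mul0r add0r G0T G1T.
  move=> /eqP; rewrite eq_sym -mulrA -mulrDr mulf_eq0 (negbTE (qpow_neq0 _ _)) /=.
  by move=> /eqP.
have [w hw] := qpow_half_period hq.
pose t1 := (a1 - cpair a z) / 2.
have ca : cpair a (toC a) = 2 by rewrite cpair_toC (cr_self hG hroot) // rc_nat.
have h1 : G0 z + qpow (2 * t1) * G1 z = 0.
  apply: key; rewrite YE cpairD cpairZ ca /d.
  by congr (qpow (_ * _)); rewrite /t1; field.
have h2 : G0 z + qpow (2 * (t1 + w / 2)) * G1 z = 0.
  apply: key; rewrite YE cpairD cpairZ ca.
  have -> : 2 * (cpair a z + (t1 + w / 2) * 2) = 2 * a1 + (w + w) by rewrite /t1; field.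
  by rewrite qpowD qpowD hw mulrNN mulr1 mulr1.
have e2 : qpow (2 * (t1 + w / 2)) = - qpow (2 * t1).
  have -> : 2 * (t1 + w / 2) = 2 * t1 + w by field.
  by rewrite qpowD hw mulrN1.
rewrite e2 in h2.
have g0 : G0 z = 0.
  apply: (@mulfI _ 2); first by rewrite pnatr_eq0.
  rewrite mulr0; transitivity ((G0 z + qpow (2 * t1) * G1 z) + (G0 z + - qpow (2 * t1) * G1 z)).
    by ring.
  by rewrite h1 h2 addr0.
split => //; move: h1; rewrite g0 add0r => /eqP.
by rewrite mulf_eq0 (negbTE (qpow_neq0 _ _)) /= => /eqP.
Qed.

(** On the hyperplane of the linear factor, [F] vanishes wherever [A] does not; [off_line] reaches
    such points without leaving the hyperplane. *)
Lemma sp_gauss x F A H (l : int) : sp (Px x) F -> sp Lc A -> sp (Px x) H ->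
  (forall z, off a z -> A z != 0) ->
  (forall z, F z * A z = (Y a z - qpow (2 * l%:~R)) * H z) ->
  exists F', [/\ sp (Px x) F', forall z, F z = (Y a z - qpow (2 * l%:~R)) * F' z &
    forall z, F' z * A z = H z].
Proof.
move=> FP AL HP A0 FA.
have [w [wa hw]] := off_line aP.
have [F' F'P FE] : exists2 F', sp (Px x) F' &
    forall z, F z = (Y a z - qpow (2 * l%:~R)) * F' z.
  apply: sp_div => // z hz; have [k0 hk] := hw z.
  apply: (sp_line (w := w) (k0 := k0) FP) => k /hk /A0 h.
  apply: (mulIf h); rewrite mul0r FA YD cpairZ wa mulr0 mulr0 qpow0 mulr1 hz.
  by rewrite subrr mul0r.
exists F'; split => //; apply: (sp_eq_generic (P := Px x) (Q := Px x)) => //.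
  by apply: sp_ext (spLP AL F'P) => z; rewrite mulrC.
move=> z gz; apply: (@mulfI _ (Y a z - qpow (2 * l%:~R))).
  by rewrite subr_eq0 generic_neq.
by rewrite -FA FE mulrA.
Qed.

End OneRoot.
End Divisibility.

Section LocalOperators.
Local Notation Y := coroot_exp.
Implicit Types (a b tau : V) (z w xi : VC) (f F g : VC -> K) (y : K) (j : R) (k : nat).

(** The constant [CE] is left arbitrary: regularity and quasi-invariance hold for every value, and
    only [symbolE] fixes it. *)
Definition dual_macdonald f z : K :=
  \sum_(tau <- Orb) a_coef G Phi m logq tau z * (f (z + toC tau) - f z) + CE * f z.
Local Notation Dop := dual_macdonald.

(* With [y = q^(2 (b^vee, z))], the quotients [num1 / fac1] and [num2 / fac2] are the
   factors of [a_coef]; [cleared_op] is [dual_macdonald] times the common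
   denominator. *)
Definition fac1 y : K := y - 1.
Definition fac2 y : K := qpow 1 * y - qpow (- 1).
Definition num1 k y : K := qpow (- k%:R) * y - qpow k%:R.
Definition num2 k y : K := qpow (1 - k%:R) * y - qpow (k%:R - 1).

(** The denominator is completed to [fac1 * fac2] for every pairing [j], even where [a_coef] has no
    factor, so that all [tau] share one denominator. *)
Definition psi j k y : K :=
  (if 0 < j then num1 k y else fac1 y) * (if j == 2 then num2 k y else fac2 y).

Lemma psi_le0 j k y : j <= 0 -> psi j k y = fac1 y * fac2 y.
Proof.
move=> j0; rewrite /psi ltNge j0 /= lt_eqF //.
by apply: le_lt_trans j0 _; rewrite ltr0n.
Qed.

Lemma psi1 k y : psi 1 k y = num1 k y * fac2 y.
Proof. by rewrite /psi ltr01 -[1]/(1%:R) eqr_nat. Qed.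

Lemma psi2 k y : psi 2 k y = num1 k y * num2 k y.
Proof. by rewrite /psi ltr0n eqxx. Qed.

Definition cleared_coef tau z : K := \prod_(b <- Phi | (0 < m b)%N) psi <<cr b, tau>> (m b) (Y b z).
Local Notation bt := cleared_coef.

Definition common_denom z : K := \prod_(b <- Phi | (0 < m b)%N) psi 0 (m b) (Y b z).
Local Notation Dl := common_denom.

Definition cleared_op f z : K :=
  \sum_(tau <- Orb) bt tau z * (f (z + toC tau) - f z) + CE * Dl z * f z.
Local Notation Nop := cleared_op.

Lemma fac1_generic z b : generic z -> b \in Phi -> fac1 (Y b z) != 0.
Proof.
by move=> gz bP; have := generic_neq 0 gz bP; rewrite mulr0 qpow0 subr_eq0.
Qed.

Lemma fac2E y : fac2 y = qpow 1 * (y - qpow (2 * -1)).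
Proof. by rewrite /fac2 mulrBr -qpowD; congr (_ - qpow _); ring. Qed.

Lemma fac2_generic z b : generic z -> b \in Phi -> fac2 (Y b z) != 0.
Proof.
move=> gz bP; have h := generic_neq (-1) gz bP; rewrite mulrN1z in h.
by rewrite fac2E mulf_neq0 ?qpow_neq0 // subr_eq0.
Qed.

Lemma psi0_generic z b k : generic z -> b \in Phi -> psi 0 k (Y b z) != 0.
Proof. by move=> gz bP; rewrite psi_le0 // mulf_neq0 ?fac1_generic ?fac2_generic. Qed.

Lemma qbr_num (x s : K) : qbr (x - s) = qpow (- x) * (qpow (- s) * qpow (2 * x) - qpow s).
Proof.
rewrite /Defs.qbr mulrBr -!qpowD.
by congr (qpow _ - qpow _); ring.
Qed.

Lemma qbr_ratio1 b z k :
  qbr (cpair b z - k%:R) / qbr (cpair b z) = num1 k (Y b z) / fac1 (Y b z).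
Proof.
rewrite qbr_num -[X in qbr X]subr0 qbr_num oppr0 qpow0 mul1r -YE.
by rewrite -mulf_div divff ?qpow_neq0 // mul1r.
Qed.

Lemma qbr_ratio2 b z k :
  qbr (cpair b z - k%:R + 1) / qbr (cpair b z + 1) = num2 k (Y b z) / fac2 (Y b z).
Proof.
have -> : cpair b z - k%:R + 1 = cpair b z - (k%:R - 1) by ring.
rewrite qbr_num -[X in qbr (_ + X)]opprK qbr_num opprK -YE.
by rewrite -mulf_div divff ?qpow_neq0 // mul1r /num2 opprB.
Qed.

Lemma a_coef_generic tau z : generic z -> Dl z * a_coef G Phi m logq tau z = bt tau z.
Proof.
move=> gz; rewrite /a_coef [X in _ * (X * _)]big_mkcond [X in _ * (_ * X)]big_mkcond.
rewrite /Dl /bt [X in X * _ = _]big_mkcond [RHS]big_mkcond -!big_split /=; apply: eq_big_seq => b bP.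
have f1 := fac1_generic gz bP; have f2 := fac2_generic gz bP.
rewrite qbr_ratio1 qbr_ratio2 psi_le0 //.
have [m0|mb] := posnP (m b).
  rewrite m0 /num1 /num2 mulr0n oppr0 qpow0 !mul1r addr0 sub0r.
  rewrite -[_ - 1]/(fac1 _) -[_ - qpow (-1)]/(fac2 _) !divff //.
  by rewrite !if_same mulr1.
by rewrite /psi; case: ifP => _; case: ifP => _; field; rewrite ?f1 ?f2.
Qed.

Lemma Dl_generic z : generic z -> Dl z != 0.
Proof.
move=> gz; rewrite /Dl big_seq_cond prodf_seq_neq0; apply/allP => b bP.
by apply/implyP => /andP[_ _]; exact: psi0_generic.
Qed.

Lemma Nop_generic f z : generic z -> Dl z * Dop f z = Nop f z.
Proof.
move=> gz; rewrite /Dop /Nop mulrDr mulr_sumr mulrA [Dl z * CE]mulrC; congr (_ + _).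
by apply: eq_bigr => tau _; rewrite mulrA a_coef_generic.
Qed.

Section OneRoot.
Context (a : V) (aP : a \in Phi) (ma : (0 < m a)%N).

Let aNP : - a \in Phi. Proof. by rewrite (root_opp hG hroot). Qed.
Let mNa : m (- a) = m a. Proof. by rewrite (mN hG hroot hm). Qed.

Definition others b := [&& (0 < m b)%N, b != a & b != - a].

Definition At tau z : K := \prod_(b <- Phi | others b) psi <<cr b, tau>> (m b) (Y b z).
Definition Da z : K := \prod_(b <- Phi | others b) psi 0 (m b) (Y b z).

(* What [psi_Bj] leaves after the spurious factor [y^-1 - 1] is removed: then
   [cleared_op] becomes [local_op], and regularity along the walls of [a] amounts
   to the vanishing of [local_op] at [y = 1, q^2, q^-2]. *)
Definition local_factor j y : K :=
  if 0 <= j then psi j (m a) y * fac2 y^-1 else - y * psi (- j) (m a) y^-1 * fac2 y.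
Local Notation Bj := local_factor.

Definition local_op g z : K :=
  \sum_(tau <- Orb) At tau z * Bj <<cr a, tau>> (Y a z) * (g (z + toC tau) - g z)
  + CE * Da z * Bj 0 (Y a z) * g z.
Local Notation Mop := local_op.

Lemma psi_Bj j y : y != 0 -> psi j (m a) y * psi (- j) (m a) y^-1 = (y^-1 - 1) * Bj j y.
Proof.
move=> y0; rewrite /Bj; have [j0|j0] := leP 0 j.
  by rewrite (@psi_le0 (- j)) ?oppr_le0 // /fac1; ring.
rewrite (@psi_le0 j) ?ltW // /fac1; field => //.
Qed.

Lemma Bj_inv j y : y != 0 -> Bj j y^-1 = - y^-1 * Bj (- j) y.
Proof.
move=> y0; rewrite /Bj oppr_ge0 invrK opprK; have [j0|j0|<-] := ltgtP 0 j.
- by move: (psi _ _ _) (fac2 y) => u1 u2; field.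
- by move: (psi _ _ _) (fac2 _) => u1 u2; ring.
- by rewrite oppr0 !psi_le0 // /fac1; field.
Qed.

Lemma Bj0 y : y != 0 -> Bj 0 y = - y^-1 * ((y - 1) * (y - qpow (2 * -1)) * (y - qpow (2 * 1))).
Proof.
move=> y0; rewrite /Bj lexx psi_le0 // !fac2E /fac1.
have e : qpow (2 * 1) = (qpow 1) ^+ 2 by rewrite mulrC qpowMn.
have e' : qpow (2 * -1) = (qpow 1)^-1 ^+ 2 by rewrite mulrC qpowMn qpowN.
have q0 := qpow_neq0 logq 1.
by rewrite e e'; field; rewrite y0 q0.
Qed.

Lemma prod_others (F : V -> K) :
  \prod_(b <- Phi | (0 < m b)%N) F b = F a * F (- a) * \prod_(b <- Phi | others b) F b.
Proof.
have aNa := root_opp_neq hroot aP.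
rewrite -big_filter (bigD1_seq a) ?filter_uniq ?fset_uniq ?mem_filter ?ma //=.
rewrite -big_filter (bigD1_seq (- a)); last 2 first.
- by rewrite !mem_filter mNa ma aNP eq_sym aNa.
- by rewrite !filter_uniq ?fset_uniq.
rewrite /= mulrA; congr (_ * _); rewrite !big_filter_cond.
apply: eq_bigl => b; rewrite /= /others.
by case: (0 < m b)%N; case: (b != a); case: (b != - a).
Qed.

Lemma psi_pair tau z : psi <<cr a, tau>> (m a) (Y a z) * psi <<cr (- a), tau>> (m (- a)) (Y (- a) z)
  = ((Y a z)^-1 - 1) * Bj <<cr a, tau>> (Y a z).
Proof. by rewrite mNa YN // crN dotpNl psi_Bj // Y_neq0. Qed.

Lemma Nop_Mop f z : Nop f z = ((Y a z)^-1 - 1) * Mop f z.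
Proof.
rewrite /Nop /Mop mulrDr mulr_sumr; congr (_ + _).
  by apply: eq_bigr => tau _; rewrite /bt prod_others psi_pair /At; ring.
rewrite /Dl prod_others -/(Da z) YN // mNa.
have := @psi_Bj 0 _ (Y_neq0 a z); rewrite oppr0 => ->; ring.
Qed.

Lemma sp_fac1 b : b \in Phi -> (0 < m b)%N -> sp Lc (fun z => fac1 (Y b z)).
Proof. by move=> bP mb; apply: spB; [exact: sp_Y|apply: sp_cst; exact: Lc0]. Qed.

Lemma sp_affineY b (c d : K) : b \in Phi -> (0 < m b)%N -> sp Lc (fun z => c * Y b z - d).
Proof. by move=> bP mb; apply: spB; [apply: spZ; exact: sp_Y|apply: sp_cst; exact: Lc0]. Qed.

Lemma sp_psi b j k : b \in Phi -> (0 < m b)%N -> sp Lc (fun z => psi j k (Y b z)).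
Proof.
move=> bP mb; rewrite /psi; apply: spLM.
  by case: (0 < j); [exact: sp_affineY|exact: sp_fac1].
by case: (j == 2); exact: sp_affineY.
Qed.

Lemma sp_prod_psi (P : pred V) (J : V -> R) : (forall b, P b -> (0 < m b)%N) ->
  sp Lc (fun z => \prod_(b <- Phi | P b) psi (J b) (m b) (Y b z)).
Proof.
move=> hP; apply: (@sp_ext _ _ _ _ _ (fun z => \prod_(b <- [seq b <- Phi | P b]) psi (J b) (m b) (Y b z))).
  by move=> z; rewrite big_filter.
apply: sp_prod; [exact: Lc0|exact: LcD|move=> b; rewrite mem_filter => /andP[Pb bP]].
by apply: sp_psi => //; exact: hP.
Qed.

Lemma sp_At tau : sp Lc (At tau).
Proof. by apply: sp_prod_psi => b /and3P[]. Qed.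

Lemma sp_Da : sp Lc Da.
Proof. by apply: sp_prod_psi => b /and3P[]. Qed.

Lemma sp_bt tau : sp Lc (bt tau).
Proof. exact: sp_prod_psi. Qed.

Lemma sp_Dl : sp Lc Dl.
Proof. exact: sp_prod_psi. Qed.

Lemma sp_Bj j : sp Lc (fun z => Bj j (Y a z)).
Proof.
have mNa' : (0 < m (- a))%N by rewrite mNa.
rewrite /Bj; case: (0 <= j).
  apply: spLM; first exact: sp_psi.
  by apply: sp_ext (sp_affineY (qpow 1) (qpow (-1)) aNP mNa') => z; rewrite YN.
apply: spLM; last exact: sp_affineY.
apply: spLM; first by apply: spN; exact: sp_Y.
by apply: sp_ext (sp_psi (- j) (m a) aNP mNa') => z; rewrite YN.
Qed.

Lemma sp_Nop x f : sp (Px x) f -> sp (Px x) (Nop f).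
Proof.
move=> fP; rewrite /Nop; apply: spD; last by apply: spLP => //; apply: spZ; exact: sp_Dl.
apply: sp_sum => tau _; apply: spLP; first exact: sp_bt.
by apply: spB => //; exact: sp_shift.
Qed.

Lemma sp_Mop x f : sp (Px x) f -> sp (Px x) (Mop f).
Proof.
move=> fP; rewrite /Mop; apply: spD.
  apply: sp_sum => tau _; apply: spLP; first by apply: spLM; [exact: sp_At|exact: sp_Bj].
  by apply: spB => //; exact: sp_shift.
apply: spLP => //; apply: spLM; last exact: sp_Bj.
by apply: spZ; exact: sp_Da.
Qed.

Lemma Da_off z : off a z -> Da z != 0.
Proof.
move=> oz; rewrite /Da prodf_seq_neq0; apply/allP => b bP; apply/implyP => /and3P[_ ba bNa].
rewrite psi_le0 // fac2E /fac1; apply: mulf_neq0; last apply: mulf_neq0.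
- by have := off_neq 0 oz bP ba bNa; rewrite mulr0 qpow0 subr_eq0.
- exact: qpow_neq0.
by rewrite subr_eq0; have := off_neq (-1) oz bP ba bNa; rewrite mulrN1z.
Qed.

Section Reflection.
Context (z0 : VC) (hz0 : Y a z0 = 1).

(** The set [Y a = 1] consists of many parallel hyperplanes; the reflection is in the one through
    [z0]. *)
Definition affine_refl z : VC := z - cpair a (z - z0) *: toC a.
Local Notation sg := affine_refl.

Lemma cpair_a : cpair a (toC a) = 2.
Proof. by rewrite cpair_toC (cr_self hG hroot) // rc_nat. Qed.

Lemma cpair_sg z : cpair a (sg z - z0) = - cpair a (z - z0).
Proof.
by rewrite /sg addrAC [LHS]cpairD cpairN cpairZ cpair_a; ring.
Qed.

Lemma sgK z : sg (sg z) = z.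
Proof. by rewrite {1}/sg cpair_sg scaleNr opprK /sg subrK. Qed.

Lemma sg_shift z tau : sg (z + toC tau) = sg z + toC (rfl a tau).
Proof.
rewrite /sg [z + _ - z0]addrAC [cpair a (_ + toC tau)]cpairD cpair_toC scalerDl.
by rewrite /refl toCB toCZ (sC tau) opprD addrACA.
Qed.

Lemma sg_pt z (i : K) : cpair a (z - z0) = i -> sg z = z - i *: toC a.
Proof. by rewrite /sg => ->. Qed.

Lemma Y_sg b z : b \in Phi -> Y b (sg z) = Y (rfl a b) z.
Proof.
move=> bP; have [k ek] := root_int hG hroot bP aP.
have E : toC (cr (rfl a b)) = toC (cr b) - k%:~R *: toC (cr a).
  have -> : cr (rfl a b) = cr b - k%:~R *: cr a by rewrite (cr_refl hG hroot) // reflE ek.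
  by move: (cr b) (cr a) => u w; rewrite toCB toCZ rc_int.
have e0 : ee (toC (cr a)) z0 = 1 := hz0.
have eb : cdot G (toC (cr b)) (toC a) = k%:~R by rewrite cdot_toC ek rc_int.
rewrite /coroot_exp E /sg /Defs.cpair; move: (toC (cr b)) (toC (cr a)) eb e0 => u c eb e0.
rewrite (eeDr G logq u z) (eeD G logq u (- (k%:~R *: c))) eeN eeNr; congr (_ * _^-1).
have e1 : ee (k%:~R *: c) z0 = 1.
  have h (j : nat) : ee (j%:R *: c) z0 = 1 by rewrite (ee_sym hG) eeMn (ee_sym hG) e0 expr1n.
  by case: (k) => j; [exact: h|rewrite NegzE mulrNz scaleNr eeN -pmulrn h invr1].
have -> : ee (k%:~R *: c) z = ee (k%:~R *: c) (z - z0) by rewrite eeDr eeNr e1 invr1 mulr1.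
rewrite /expc; congr (qpow (2 * _)).
move: eb; rewrite /cdot dotpZr dotpZl => ->; exact: mulrC.
Qed.

Lemma Ya_sg z : Y a (sg z) = (Y a z)^-1.
Proof. by rewrite Y_sg // (refl_self hG hroot) // YN. Qed.

Lemma others_refl b : b \in Phi -> others (rfl a b) = others b.
Proof.
move=> bP; rewrite /others hm //.
have h c : (rfl a b == c) = (b == rfl a c).
  by apply/eqP/eqP => [<-|->]; rewrite (reflK hG hroot).
by rewrite !h reflN (refl_self hG hroot) // opprK; congr andb; rewrite andbC.
Qed.

Lemma prod_others_sg (J : V -> R) (J' : V -> R) z : (forall b, J (rfl a b) = J' b) ->
  \prod_(b <- Phi | others b) psi (J b) (m b) (Y b (sg z)) =
  \prod_(b <- Phi | others b) psi (J' b) (m b) (Y b z).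
Proof.
move=> hJ.
transitivity (\prod_(b <- Phi | others (rfl a b))
    psi (J (rfl a b)) (m (rfl a b)) (Y (rfl a b) (sg z))).
  exact: (big_refl hG hroot _ others _ aP).
apply: eq_big_in => [b bP|b bP _]; first exact: others_refl.
by rewrite hJ (hm aP bP) (Y_sg z (root_refl hroot aP bP)) (reflK hG hroot b aP).
Qed.

Lemma At_sg tau z : At tau (sg z) = At (rfl a tau) z.
Proof.
by apply: prod_others_sg => b; rewrite (cr_refl hG hroot) // (refl_sym hG).
Qed.

Lemma Da_sg z : Da (sg z) = Da z.
Proof. exact: prod_others_sg. Qed.

(** Reindexing [tau] by [s_a tau] exchanges the coefficients at reflected points up to the unit
    [- y^-1] of [Bj_inv]. Its sign is the source of the cancellation of poles on the wall itself. *)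
Lemma Mop_sg g z : Mop g (sg z) = - (Y a z)^-1 * Mop (g \o sg) z.
Proof.
rewrite /Mop mulrDr mulr_sumr (big_Orb_refl hG hroot _ _ _ aP); congr (_ + _).
  apply: eq_bigr => tau _; rewrite At_sg (reflK hG hroot) // Ya_sg Bj_inv ?Y_neq0 //.
  rewrite -(refl_sym hG) reflE (cr_self hG hroot) //.
  have -> : - <<cr a - 2 *: cr a, tau>> = <<cr a, tau>>.
    by move: (cr a) => c; rewrite dotpBl dotpZl; ring.
  by rewrite -sg_shift /= [At tau z * _]mulrCA -!mulrA.
by rewrite Da_sg Ya_sg Bj_inv ?Y_neq0 // oppr0 /= [CE * Da z * _]mulrCA -!mulrA.
Qed.

Context (f : VC -> K).
Hypothesis qinv_a : forall (s : nat) z, (1 <= s <= m a)%N -> Y a z = 1 ->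
  f (z + (s%:R / 2) *: toC a) = f (z - (s%:R / 2) *: toC a).

Definition odd_part_at z : K := f z - f (sg z).
Local Notation odd_part := odd_part_at.

Lemma Mop_odd z : Mop odd_part z = Mop f z + Y a z * Mop f (sg z).
Proof.
rewrite Mop_sg mulrA mulrN mulfV ?Y_neq0 // mulN1r /Mop /odd_part.
rewrite [in RHS]opprD [RHS]addrACA -sumrB; congr (_ + _); last first.
  by rewrite /= -mulrBr.
apply: eq_bigr => tau _; rewrite -mulrBr; congr (_ * _) => /=.
have subACA (u1 u2 u3 u4 : K) : u1 - u2 - (u3 - u4) = u1 - u3 - (u2 - u4) by ring.
exact: subACA.
Qed.

Lemma odd_part_zero z (i : int) : cpair a (z - z0) = i%:~R -> (`|i| <= m a)%N -> odd_part z = 0.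
Proof.
move=> hi im; rewrite /odd_part (sg_pt hi).
(* The midpoint of [z] and its reflection lies on a wall; quasi-invariance there compares the two
   points. *)
pose w := z - (i%:~R / 2) *: toC a.
have wz : z = w + (i%:~R / 2) *: toC a by rewrite subrK.
have wz' : z - i%:~R *: toC a = w - (i%:~R / 2) *: toC a.
  by rewrite /w -addrA -opprD -scalerDl; congr (_ - _ *: _); field.
have hw : Y a w = 1.
  rewrite YE; have -> : cpair a w = cpair a z0; last by rewrite -YE.
  apply/eqP; rewrite -subr_eq0 -cpairN -cpairD /w addrAC cpairD cpairN cpairZ cpair_a hi.
  by apply/eqP; field.
clearbody w; rewrite wz' wz; clear wz wz' hi; apply/eqP; rewrite subr_eq0; apply/eqP.
case: i im => [[|s]|s] im; first by rewrite !mul0r !scale0r subr0 addr0.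
  by rewrite -pmulrn; apply: qinv_a.
rewrite NegzE mulrNz mulNr scaleNr opprK -pmulrn; apply/esym; apply: qinv_a => //.
Qed.

(** Up to distance [m a] from the wall the odd part vanishes. A translation passes beyond it only
    from [s = m a], where [num1] vanishes, or by a step of 2 from [s = m a - 1], where [num2]
    vanishes. *)
Lemma psi_odd z (s : nat) tau : cpair a (z - z0) = s%:R -> (s <= m a)%N -> tau \in Orb ->
  0 <= <<cr a, tau>> -> psi <<cr a, tau>> (m a) (Y a z) * odd_part (z + toC tau) = 0.
Proof.
move=> hs sm tO.
have Yz : Y a z = qpow (2 * s%:R).
  by rewrite -[z](subrK z0) YD -[X in _ * X]YE hz0 mulr1 YE hs.
have hc (j : int) : <<cr a, tau>> = j%:~R -> cpair a (z + toC tau - z0) = (s%:Z + j)%:~R.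
  by move=> ej; rewrite addrAC cpairD hs cpair_toC ej rc_int rmorphD.
have n1m : s = m a -> num1 (m a) (Y a z) = 0.
  by move=> e; rewrite /num1 Yz -e -qpowD; apply/eqP; rewrite subr_eq0; apply/eqP; congr qpow; ring.
have n2m : s.+1 = m a -> num2 (m a) (Y a z) = 0.
  move=> e; rewrite /num2 Yz -e -qpowD; apply/eqP; rewrite subr_eq0; apply/eqP; congr qpow.
  by rewrite -natr1; ring.
case: (Orb_pair hG hroot hom tO aP) => [e|e|e|e _|e _]; rewrite e => e0.
- by rewrite (odd_part_zero (hc 0 e)) ?mulr0 // addr0.
- have [sm'|sm'] := leqP s.+1 (m a).
    by rewrite (odd_part_zero (hc 1 e)) ?mulr0 //; lia.
  by rewrite psi1 n1m ?mul0r //; lia.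
- by move: e0; rewrite oppr_ge0 ler10.
- have [sm'|sm'] := leqP s.+2 (m a).
    by rewrite (odd_part_zero (hc 2 e)) ?mulr0 //; lia.
  rewrite psi2; have [h|h] : s = m a \/ s.+1 = m a by lia.
    by rewrite n1m // !mul0r.
  by rewrite n2m // mulr0 mul0r.
- by move: e0; rewrite oppr_ge0 lern0.
Qed.

Lemma Bj_odd z (s : nat) tau : cpair a (z - z0) = s%:R -> (s <= m a)%N -> tau \in Orb ->
  Bj <<cr a, tau>> (Y a z) * odd_part (z + toC tau) = 0.
Proof.
move=> hs sm tO; have [j0|j0] := leP 0 <<cr a, tau>>.
  by rewrite /Bj j0 mulrAC (psi_odd hs) // mul0r.
have hc (j : int) : <<cr a, tau>> = j%:~R -> cpair a (z + toC tau - z0) = (s%:Z + j)%:~R.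
  by move=> ej; rewrite addrAC cpairD hs cpair_toC ej rc_int rmorphD.
have [e|e] : <<cr a, tau>> = (-1)%:~R \/ <<cr a, tau>> = (-2)%:~R.
  case: (Orb_pair hG hroot hom tO aP) j0 => [->|->|->|-> _|-> _]; rewrite ?ltxx ?ltr10 ?ltrn0 //.
  - by left; rewrite mulrN1z.
  - by right; rewrite mulrNz.
- by rewrite (odd_part_zero (hc _ e)) ?mulr0 //; lia.
have [s0|s0] := posnP s; last first.
  by rewrite (odd_part_zero (hc _ e)) ?mulr0 //; lia.
(* Here [s = 0] and the translation leads to distance 2 on the other side. If [m a = 1] this is too
   far, but then [num2] vanishes at [y = 1]. *)
have [m2|m2] := leqP 2 (m a).
  by rewrite (odd_part_zero (hc _ e)) ?mulr0 //; lia.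
have m1 : m a = 1%N by lia.
rewrite e /Bj ler0z /= mulrNz opprK psi2 m1 /num2.
have -> : Y a z = 1.
  by rewrite -[z](subrK z0) YD -[X in _ * X]YE hz0 mulr1 YE hs s0 mulr0n mulr0 qpow0.
by rewrite invr1 mulr1n !subrr qpow0 mulr1 subrr !(mulr0, mul0r).
Qed.

Lemma Mop_odd_zero z (s : nat) : cpair a (z - z0) = s%:R -> (s <= m a)%N -> Mop odd_part z = 0.
Proof.
move=> hs sm; have o0 : odd_part z = 0.
  by apply: (@odd_part_zero z s%:Z) => //; rewrite hs -pmulrn.
rewrite /Mop o0 mulr0 addr0 big_seq big1 // => tau tO.
by rewrite subr0 -mulrA (Bj_odd hs) // mulr0.
Qed.

End Reflection.

End OneRoot.
End LocalOperators.

Section QuasiInvariance.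
Local Notation Y := coroot_exp.
Local Notation Dop := dual_macdonald.
Local Notation Nop := cleared_op.
Local Notation Mop := local_op.
Local Notation Bj := local_factor.
Local Notation Dl := common_denom.
Implicit Types (a b tau : V) (x z w xi : VC) (f F g : VC -> K).

Definition qinv f := forall a (s : nat) z, a \in Phi -> (1 <= s <= m a)%N ->
  qpow (2 * cpair a z) = 1 ->
  f (z + (s%:R / 2) *: toC a) = f (z - (s%:R / 2) *: toC a).

Section OneRoot.
Context (a : V) (aP : a \in Phi) (ma : (0 < m a)%N).
Context (x : VC) (f : VC -> K) (fP : sp (Px x) f) (fq : qinv f).

Let qinv_a (s : nat) z : (1 <= s <= m a)%N -> Y a z = 1 ->
  f (z + (s%:R / 2) *: toC a) = f (z - (s%:R / 2) *: toC a).
Proof. by move=> hs hz; apply: fq. Qed.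

(** The reflection in the wall through [z] fixes [z], so the value for the odd part is twice the
    value for [f]. *)
Lemma Mop_zero1 z : Y a z = 1 -> Mop a f z = 0.
Proof.
move=> z1; have sz : affine_refl a z z = z.
  by rewrite /affine_refl subrr /Defs.cpair /cdot dotp0r scale0r subr0.
have c0 : cpair a (z - z) = 0%N%:R by rewrite subrr /Defs.cpair /cdot dotp0r.
have := Mop_odd_zero aP ma z1 qinv_a c0 (leq0n _).
rewrite (Mop_odd aP z1) sz z1 mul1r -mulr2n -mulr_natl => /eqP.
by rewrite mulf_eq0 pnatr_eq0 /= => /eqP.
Qed.

Lemma half_shift z : z + (1%:R / 2) *: toC a + (1%:R / 2) *: toC a = z + toC a :> VC.
Proof. by rewrite -addrA -scalerDl mul1r -div1r -splitr scale1r. Qed.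

(** The condition for [s = 1], centred at [z + a / 2], which lies on a wall. *)
Lemma qinv_step z : Y a z = qpow (2 * -1) -> f (z + toC a) = f z.
Proof.
move=> hz; rewrite -half_shift qinv_a ?addrK // YD hz cpairZ cpair_toC (cr_self hG hroot) // rc_nat.
by rewrite -qpowD mul1r mulVf ?pnatr_eq0 // -mulrDr addNr mulr0 qpow0.
Qed.

Lemma fac2_zero : fac2 (qpow (2 * -1)) = 0.
Proof. by rewrite fac2E subrr mulr0. Qed.

(** All terms contain the vanishing value of [fac2] except that of [tau = a], whose difference is
    zero by [qinv_step]. *)
Lemma Mop_zero2 z : Y a z = qpow (2 * (-1)%:~R) -> Mop a f z = 0.
Proof.
rewrite mulrN1z => hz; rewrite /Mop hz /Bj lexx psi_le0 // fac2_zero mulr0 mul0r !(mulr0, mul0r) addr0.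
rewrite big_seq big1 // => tau tO.
case: (Orb_pair hG hroot hom tO aP) => [->|->|->|_ ->|->].
- by rewrite lexx psi_le0 // fac2_zero mulr0 !(mulr0, mul0r).
- by rewrite ler01 psi1 fac2_zero mulr0 !(mulr0, mul0r).
- by rewrite oppr_ge0 ler10 !(mulr0, mul0r).
- by rewrite qinv_step // subrr mulr0.
- by rewrite oppr_ge0 lern0 !(mulr0, mul0r).
Qed.

(** Mirror image of [Mop_zero2]: now [fac2] vanishes at [y^-1], and the remaining term is that of
    [tau = - a]. *)
Lemma Mop_zero3 z : Y a z = qpow (2 * 1%:~R) -> Mop a f z = 0.
Proof.
rewrite -[1%:~R]/1 => hz.
have hz' : (qpow (2 * 1))^-1 = qpow (2 * -1) by rewrite mulrN qpowN.
rewrite /Mop hz /Bj hz' lexx psi_le0 // fac2_zero !(mulr0, mul0r) addr0.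
rewrite big_seq big1 // => tau tO.
case: (Orb_pair hG hroot hom tO aP) => [->|->|->|-> _|_ ->].
- by rewrite lexx !(mulr0, mul0r).
- by rewrite ler01 !(mulr0, mul0r).
- by rewrite oppr_ge0 ler10 opprK psi1 fac2_zero !(mulr0, mul0r).
- by rewrite ler0n !(mulr0, mul0r).
- have := @qinv_step (z - toC a); rewrite subrK toCN => -> //; first by rewrite subrr mulr0.
  rewrite YD hz -toCN cpair_toC dotpNr (cr_self hG hroot) // rcN rc_nat -qpowD; congr qpow; ring.
Qed.

Lemma Dl_Bj z : Dl z = ((Y a z)^-1 - 1) * Bj a 0 (Y a z) * Da a z.
Proof.
rewrite /Dl (prod_others aP ma) -/(Da a z) -psi_Bj ?Y_neq0 //.
by rewrite oppr0 YN (mN hG hroot hm).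
Qed.

(** The zeros [1], [q^-2] and [q^2] of [local_factor 0] are simple and distinct because [q] is not a
    root of unity. [local_op] vanishes at each of them, so the linear factors can be divided out in
    turn. *)
Lemma local_regular : exists2 F, sp (Px x) F &
  (forall z, Mop a f z = Bj a 0 (Y a z) * F z) /\
  (forall z, generic z -> F z = Da a z * Dop f z).
Proof.
have MP : sp (Px x) (Mop a f) by exact: sp_Mop.
have [F1 F1P e1] := sp_div aP ma (a1 := 0) MP
  (fun z h => Mop_zero1 (etrans h (etrans (congr1 qpow (mulr0 2)) (qpow0 logq)))).
rewrite mulr0 qpow0 in e1.
have q21 : qpow (2 * (-1)%:~R) != 1.
  have := @qpow_int_neq1 R logq hq (-2) isT; rewrite [X in _ -> qpow X != 1](_ : _ = (-2)%:~R) //.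
  by rewrite !mulrNz; ring.
have q22 : qpow (2 * 1%:~R) != 1.
  have := @qpow_int_neq1 R logq hq 2 isT; rewrite [X in _ -> qpow X != 1](_ : _ = 2%:~R) //.
  by rewrite mulr1.
have q23 : qpow (2 * 1%:~R) != qpow (2 * (-1)%:~R).
  apply/eqP => h; have := @qpow_int_inj R logq hq 2 (-2).
  rewrite -[2%:~R]/(2%:R) mulrNz -[2%:~R]/(2%:R) => hh.
  suff // : (2 = -2)%Z by [].
  by apply: hh; move: h; rewrite mulr1 mulrNz mulrN mulr1.
have [F2 F2P e2] : exists2 F2, sp (Px x) F2 &
    forall z, F1 z = (Y a z - qpow (2 * (-1)%:~R)) * F2 z.
  apply: (sp_div aP ma F1P) => z hz.
  have := e1 z; rewrite Mop_zero2 // hz => /eqP; rewrite eq_sym mulf_eq0 subr_eq0 (negbTE q21).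
  by move=> /eqP.
have [F3 F3P e3] : exists2 F3, sp (Px x) F3 &
    forall z, F2 z = (Y a z - qpow (2 * 1%:~R)) * F3 z.
  apply: (sp_div aP ma F2P) => z hz.
  have := e1 z; rewrite Mop_zero3 // e2 hz => /eqP.
  rewrite eq_sym !mulf_eq0 !subr_eq0 (negbTE q22) (negbTE q23) /=.
  by move=> /eqP.
have FP : sp (Px x) (fun z => - (Y a z) * F3 z).
  by apply: spLP => //; apply: spN; exact: sp_Y.
have ME z : Mop a f z = Bj a 0 (Y a z) * (- (Y a z) * F3 z).
  rewrite e1 e2 e3 Bj0 ?Y_neq0 // mulrN1z -[1%:~R]/1.
  by have y0 := Y_neq0 a z; field.
exists (fun z => - (Y a z) * F3 z) => //; split => // z gz.
have := Nop_generic f gz; rewrite (Nop_Mop aP ma) ME.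
have := Dl_generic gz; rewrite Dl_Bj // -!mulrA !mulf_eq0 !negb_or => /and3P[c1 c2 _].
by move=> /(mulfI c1)/(mulfI c2).
Qed.

End OneRoot.

Section Regularity.
Context (x : VC) (f : VC -> K) (fP : sp (Px x) f) (fq : qinv f).

Definition Pf b z : K := psi 0 (m b) (Y b z) * psi 0 (m (- b)) (Y (- b) z).

Lemma Pf_Bj a z : a \in Phi -> Pf a z = ((Y a z)^-1 - 1) * Bj a 0 (Y a z).
Proof.
by move=> aP; rewrite /Pf (mN hG hroot hm) // YN -psi_Bj ?Y_neq0 // oppr0.
Qed.

Lemma Pf_factors a z : a \in Phi -> Pf a z = (Y a z)^-1 ^+ 2 *
  ((Y a z - qpow (2 * 0%:~R)) * ((Y a z - qpow (2 * 0%:~R)) *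
  ((Y a z - qpow (2 * (-1)%:~R)) * (Y a z - qpow (2 * 1%:~R))))).
Proof.
move=> aP; rewrite Pf_Bj // Bj0 ?Y_neq0 // mulrN1z -[1%:~R]/1 mulr0 qpow0.
have y0 := Y_neq0 a z; move: (Y a z) y0 => y y0.
by move: (qpow _) (qpow _) => u1 u2; field.
Qed.

Lemma Dl_Pf a z : a \in Phi -> (0 < m a)%N -> Dl z = Pf a z * Da a z.
Proof. by move=> aP ma; rewrite /Dl (prod_others aP ma). Qed.

Lemma sp_Pf b : b \in Phi -> (0 < m b)%N -> sp Lc (Pf b).
Proof.
move=> bP mb; apply: spLM; first exact: sp_psi.
by apply: sp_psi; rewrite ?(root_opp hG hroot) ?(mN hG hroot hm).
Qed.

Lemma Pf_off a b z : b \in Phi -> b != a -> b != - a -> off a z -> Pf b z != 0.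
Proof.
move=> bP ba bNa oz; rewrite Pf_factors // !mulf_neq0 ?subr_eq0 ?expf_neq0 ?invr_eq0 ?Y_neq0 //.
all: exact: off_neq oz bP ba bNa.
Qed.

Lemma Dl_positives v z : gen v -> Dl z = \prod_(b <- positives G Phi m v) Pf b z.
Proof.
move=> gv; rewrite /Dl (big_split_gen hG hroot _ _ gv) /positives ?big_filter //.
by move=> b bP; rewrite (mN hG hroot hm).
Qed.

(* The walls are treated one root at a time; [sp_gauss] lets the divisibility by
   one factor pass through the others, which are coprime to it. *)
Lemma regular_step v (l : seq V) : gen v -> uniq l -> {subset l <= positives G Phi m v} ->
  exists2 F, sp (Px x) F &
    forall z, generic z -> F z * \prod_(b <- l) Pf b z = Dl z * Dop f z.
Proof.
move=> gv; elim: l => [|a l IH] /=.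
  move=> _ _; exists (Nop f); first exact: sp_Nop.
  by move=> z gz; rewrite big_nil mulr1 Nop_generic.
move=> /andP[al ul] lP; have [|F FP FE] := IH ul.
  by move=> b bl; apply: lP; rewrite inE bl orbT.
have /positivesP[aP ma va] := lP a (mem_head _ _).
have lP' b : b \in l -> [/\ b \in Phi, (0 < m b)%N, b != a & b != - a].
  move=> bl; have /positivesP[bP mb vb] : b \in positives G Phi m v.
    by apply: lP; rewrite inE bl orbT.
  split => //; first by apply: contraNneq al => <-.
  by apply: contraTneq vb => ->; rewrite (gen_opp_gt0 gv aP) negbK.
pose A z := \prod_(b <- l) Pf b z.
have AL : sp Lc A.
  by apply: sp_prod; [exact: Lc0|exact: LcD|move=> b /lP'[bP mb _ _]; exact: sp_Pf].
have A0 z : off a z -> A z != 0.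
  move=> oz; rewrite /A prodf_seq_neq0; apply/allP => b /lP'[bP _ ba bNa] /=.
  exact: Pf_off oz.
have [Fa FaP [_ FaE]] := local_regular aP ma fP fq.
pose H z := (Y a z)^-1 ^+ 2 * Fa z.
have HP : sp (Px x) H.
  apply: spLP => //; apply: (@sp_ext _ _ _ _ _ (fun z => Y (- a) z * Y (- a) z)).
    by move=> z; rewrite YN.
  by apply: spLM; apply: sp_Y; rewrite ?(root_opp hG hroot) ?(mN hG hroot hm).
pose lin (k : int) z := Y a z - qpow (2 * k%:~R).
have lL k F0 : sp (Px x) F0 -> sp (Px x) (fun z => lin k z * F0 z).
  move=> h; apply: spLP h; apply: spB; first exact: sp_Y.
  by apply: sp_cst; exact: Lc0.
have e0 : (fun z => F z * A z) =1 (fun z => lin 0 z * (lin 0 z * (lin (-1) z * (lin 1 z * H z)))).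
  apply: (sp_eq_generic (P := Px x) (Q := Px x)).
  - by apply: sp_ext (spLP AL FP) => z; rewrite mulrC.
  - by do !apply: (lL).
  move=> z gz; rewrite FE // (Dl_Pf _ aP ma) Pf_factors // -mulrA -FaE //.
  by rewrite /lin /H; move: (Y a z) => y; ring.
have gauss := sp_gauss aP ma.
(* Four divisions: [Pf a] contains the factor [Y a - 1] twice, once for [a] and once for [- a]. *)
have [F1 [F1P h1 e1]] := gauss _ _ _ _ _ FP AL (lL _ _ (lL _ _ (lL _ _ HP))) A0 e0.
have [F2 [F2P h2 e2]] := gauss _ _ _ _ _ F1P AL (lL _ _ (lL _ _ HP)) A0 e1.
have [F3 [F3P h3 e3]] := gauss _ _ _ _ _ F2P AL (lL _ _ HP) A0 e2.
have [F4 [F4P h4 e4]] := gauss _ _ _ _ _ F3P AL HP A0 e3.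
exists (fun z => Y a z * Y a z * F4 z).
  by apply: spLP F4P; apply: spLM; exact: sp_Y.
move=> z gz; rewrite -FE // big_cons h1 h2 h3 h4 -/(A z) Pf_factors //.
have y0 := Y_neq0 a z; move: (Y a z) y0 => y y0.
by move: (qpow _) (qpow _) (qpow _) (F4 z) (A z) => u1 u2 u3 u4 u5; field.
Qed.

Lemma Dop_regular : exists2 F, sp (Px x) F & forall z, generic z -> F z = Dop f z.
Proof.
have [v gv] := exists_gen hG hroot.
have [|//|F FP FE] := @regular_step v (positives G Phi m v) gv.
  by rewrite filter_uniq ?fset_uniq.
exists F => // z gz; apply: (mulIf (Dl_generic gz)).
by rewrite {1}(Dl_positives z gv) FE // mulrC.
Qed.

End Regularity.
End QuasiInvariance.

(** * Quasi-invariance of the image under the operator *)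

Section QuasiInvariancePreserved.
Local Notation Y := coroot_exp.
Local Notation Dop := dual_macdonald.
Local Notation Mop := local_op.
Local Notation Bj := local_factor.
Local Notation odd_part := odd_part_at.
Local Notation sg := affine_refl.
Implicit Types (a b tau : V) (x z w xi : VC) (f F g : VC -> K).

Context (x : VC) (f : VC -> K) (fP : sp (Px x) f) (fq : qinv f).
Context (F : VC -> K) (FP : sp (Px x) F) (FE : forall z, generic z -> F z = Dop f z).

Section OneRoot.
Context (a : V) (aP : a \in Phi) (ma : (0 < m a)%N).

Let qinv_a (s : nat) z : (1 <= s <= m a)%N -> Y a z = 1 ->
  f (z + (s%:R / 2) *: toC a) = f (z - (s%:R / 2) *: toC a).
Proof. by move=> hs hz; apply: fq. Qed.

Lemma Mop_factor z : Mop a f z = Bj a 0 (Y a z) * (Da a z * F z).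
Proof.
have [Fa FaP [-> FaE]] := local_regular aP ma fP fq.
congr (_ * _); apply: (sp_eq_generic FaP (spLP (sp_Da a) FP)).
by move=> {}z gz; rewrite FaE // FE.
Qed.

Context (z0 : VC) (hz0 : Y a z0 = 1).

(** [Da] is invariant under the reflection and [local_factor 0] changes by the same unit as
    [local_op], so the factorisation passes to odd parts. *)
Lemma Mop_odd_factor z :
  Mop a (odd_part a z0 f) z = Bj a 0 (Y a z) * (Da a z * odd_part a z0 F z).
Proof.
rewrite (Mop_odd aP hz0) !Mop_factor.
rewrite (Da_sg aP hz0) (Ya_sg aP hz0) Bj_inv ?Y_neq0 // oppr0.
have y0 := Y_neq0 a z; rewrite /odd_part_at.
by move: (Y a z) (Bj _ _ _) (Da _ _) (F z) (F _) y0 => y u1 u2 u3 u4 y0; field.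
Qed.

Lemma sp_sg P g : sp P g -> sp setT (fun z => g (sg a z0 z)).
Proof.
have key xi z : ee xi (sg a z0 z) = qpow (2 * (cdot G xi (toC a) * cpair a z0)) *
    ee (xi - cdot G xi (toC a) *: toC (cr a)) z.
  rewrite /expc -qpowD -mulrDr; congr (qpow (2 * _)).
  rewrite /affine_refl cpairD cpairN /Defs.cpair; move: (toC (cr a)) (toC a) => c d.
  by rewrite /cdot !(dotpBl, dotpBr, dotpZl, dotpZr); ring.
move=> [s sP gs].
exists [seq (p.1 * qpow (2 * (cdot G p.2 (toC a) * cpair a z0)),
   p.2 - cdot G p.2 (toC a) *: toC (cr a)) | p <- s]; first by [].
move=> z; rewrite gs /ev big_map; apply: eq_bigr => p _.
by rewrite key mulrA.
Qed.

Lemma sp_odd P g : sp P g -> sp setT (odd_part a z0 g).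
Proof. by move=> gP; apply: spB; [apply: sp_sub gP|exact: sp_sg gP]. Qed.

Lemma odd_part_sg g z : odd_part a z0 g (sg a z0 z) = - odd_part a z0 g z.
Proof. by rewrite /odd_part_at (sgK aP) opprB. Qed.

Lemma hasd_line P g u : sp P g -> exists d, hasd (fun t => g (u + t%:C *: toC a)) d.
Proof.
move=> [s sP gs]; exists (\sum_(p <- [seq (p.1 * ee p.2 u, 2 * cdot G p.2 (toC a) * logq) | p <- s]) p.1 * p.2).
exists [seq (p.1 * ee p.2 u, 2 * cdot G p.2 (toC a) * logq) | p <- s] => // t.
rewrite gs /ev big_map; apply: eq_bigr => p _ /=.
rewrite eeDr -mulrA; congr (_ * (_ * _)).
rewrite /expc /Defs.qpow /cdot dotpZr; congr cexp; ring.
Qed.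

Lemma hasd_mul0 (S T : R -> K) d e : hasd S d -> hasd T e -> S 0 = 0 -> T 0 = 0 ->
  hasd (fun t => S t * T t) 0.
Proof. by move=> hS hT S0 T0; have := hasdM hS hT; rewrite S0 T0 mulr0 mul0r addr0. Qed.

Lemma reflect_point (u c : VC) (k : K) : u + k *: c - c - (2 * k - 1) *: c = u + (- k) *: c.
Proof.
rewrite -{2}[c]scale1r -!addrA; congr (_ + _).
by rewrite -!scaleNr -!scalerDl; congr (_ *: _); ring.
Qed.

Local Opaque odd_part_at affine_refl.

Lemma hasd_mul0r (S T : R -> K) d : hasd S d -> hasd T 0 -> T 0 = 0 ->
  hasd (fun t => S t * T t) 0.
Proof. by move=> hS hT T0; have := hasdM hS hT; rewrite T0 !mulr0 addr0. Qed.

(** For [s = 1]. Every summand is a product of two functions vanishing at [u], except that for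
    [tau = - a] it is the difference of values of the odd part that vanishes together with its
    derivative. *)
Lemma Mop_odd_derivative u : cpair a (u - z0) = 1 ->
  hasd (fun t => Mop a (odd_part a z0 f) (u + t%:C *: toC a)) 0.
Proof.
move=> hu; set o := odd_part a z0 f.
have oS : sp setT o by exact: sp_odd fP.
have o0 : o u = 0 by apply: (odd_part_zero aP hz0 qinv_a (i := 1)).
have pt0 : u + (0 : R)%:C *: toC a = u by rewrite scale0r addr0.
have Yu : (Y a u)^-1 = qpow (2 * -1).
  by rewrite -[u](subrK z0) YD -[X in _ * X]YE hz0 mulr1 YE hu mulrN qpowN.
have hus : cpair a (u - z0) = 1%N%:R by rewrite hu.
have NaP : - a \in Phi by rewrite (root_opp hG hroot).
have mNa : (0 < m (- a))%N by rewrite (mN hG hroot hm).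
have dif tau : sp setT (fun z => o (z + toC tau) - o z).
  by apply: spB; [exact: sp_shift oS|exact: oS].
have sT P g : sp P g -> sp setT g by apply: sp_sub.
have sM g h : sp setT g -> sp setT h -> sp setT (fun z => g z * h z) by exact: spM.
rewrite /local_op -[X in hasd _ X]addr0; apply: hasdD; last first.
  have [d hd] := hasd_line u (sM _ _ (spZ CE (sT _ _ (sp_Da a)))
      (sT _ _ (sp_Bj aP ma 0))).
  have [e he] := hasd_line u oS.
  apply: (hasd_mul0 hd he); rewrite pt0 // /local_factor lexx Yu fac2_zero !mulr0 //.
apply: hasd_sum => tau tO.
have [j0|j0] := leP 0 <<cr a, tau>>.
  have h1 : sp setT (fun z => fac2 (Y (- a) z)).
    by apply: sT (sp_affineY (qpow 1) (qpow (-1)) NaP mNa).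
  have [d hd] := hasd_line u h1.
  have [e he] := hasd_line u (sM _ _ (sM _ _ (sT _ _ (sp_At a tau))
    (sT _ _ (sp_psi <<cr a, tau>> (m a) aP ma))) (dif tau)).
  apply: (hasd_ext _ (hasd_mul0 hd he _ _)); rewrite ?pt0.
  - have alg (X A P D : K) : X * (A * P * D) = A * (P * X) * D by ring.
    by move=> t; rewrite /local_factor j0 YN; exact: alg.
  - by rewrite YN Yu fac2_zero.
  - rewrite o0 subr0 -mulrA (psi_odd aP ma hz0 qinv_a hus) ?mulr0 //.
have [d hd] := hasd_line u (sM _ _ (sT _ _ (sp_At a tau))
  (sT _ _ (sp_Bj aP ma <<cr a, tau>>))).
have [e he] := hasd_line u (dif tau).
case: (Orb_pair hG hroot hom tO aP) => [ej|ej|ej|ej _|ej et]; move: (j0); rewrite ej.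
- by rewrite ltxx.
- by rewrite ltr10.
- move=> _; rewrite -{1}ej; apply: (hasd_mul0 hd he); rewrite pt0.
    by rewrite ej /local_factor oppr_ge0 ler10 opprK psi1 Yu fac2_zero !(mulr0, mul0r).
  rewrite o0 subr0; apply: (odd_part_zero aP hz0 qinv_a (i := 0)) => //.
  by rewrite addrAC cpairD hu cpair_toC ej rcN subrr.
- by rewrite ltrn0.
move=> _; rewrite -{1}ej.
(* The reflection exchanges [u + t a - a] and [u - t a], and the odd part changes sign; so the
   difference is even in [t]. *)
have ev t : o (u + (- t)%:C *: toC a + toC tau) - o (u + (- t)%:C *: toC a) =
            o (u + t%:C *: toC a + toC tau) - o (u + t%:C *: toC a).
  have h t' : o (u + t'%:C *: toC a + toC tau) = - o (u + (- t')%:C *: toC a).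
    have e1 : o (sg a z0 (u + t'%:C *: toC a + toC tau)) = - o (u + t'%:C *: toC a + toC tau).
      exact: odd_part_sg.
    apply: etrans (etrans (esym (opprK _)) (congr1 -%R (esym e1))) _; congr (- o _).
    have -> : sg a z0 (u + t'%:C *: toC a + toC tau) =
        u + t'%:C *: toC a + toC tau - (2 * t'%:C - 1) *: toC a.
      apply: sg_pt; rewrite et toCN addrAC cpairD cpairN cpair_toC (cr_self hG hroot) //.
      by rewrite addrAC cpairD hu cpairZ cpair_toC (cr_self hG hroot) // rc_nat; ring.
    by rewrite et toCN rcN; exact: reflect_point.
  have alg (p1 q1 p2 q2 : K) : p1 = - q2 -> p2 = - q1 -> p1 - q1 = p2 - q2.
    by move=> -> ->; ring.
  by have h2 := h (- t); rewrite opprK in h2; exact: alg h2 (h t).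
have he' : hasd (fun t : R => o (u + t%:C *: toC a + toC tau) - o (u + t%:C *: toC a)) e := he.
have e0 : e = 0 := hasd_even ev he'.
have o1 : o (u + toC tau) = 0.
  apply: (odd_part_zero aP hz0 qinv_a (i := -1)) => //.
  by rewrite addrAC cpairD hu cpair_toC ej rcN rc_nat; ring.
rewrite e0 in he'; apply: (hasd_mul0r hd he').
by rewrite pt0 o1 o0 subrr.
Qed.

Local Transparent odd_part_at affine_refl.

(** The zero at [q^2] is simple: the other linear factors are nonzero there, and the last one has
    derivative [q^2 * 4 log q] along [a]. *)
Lemma Bj0_derivative u : cpair a (u - z0) = 1 ->
  exists2 d, d != 0 & hasd (fun t => Bj a 0 (Y a (u + t%:C *: toC a))) d.
Proof.
move=> hu.
have Yu : Y a u = qpow (2 * 1).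
  by rewrite -[u](subrK z0) YD -[X in _ * X]YE hz0 mulr1 YE hu.
have NaP : - a \in Phi by rewrite (root_opp hG hroot).
have mNa : (0 < m (- a))%N by rewrite (mN hG hroot hm).
have [c hc] : exists c, hasd (fun t : R => - (Y a (u + t%:C *: toC a))^-1 *
    ((Y a (u + t%:C *: toC a) - 1) * (Y a (u + t%:C *: toC a) - qpow (2 * -1)))) c.
  have h : sp Lc (fun z => - Y (- a) z * ((Y a z - 1) * (Y a z - qpow (2 * -1)))).
    apply: spLM; first by apply: spN; exact: sp_Y.
    by apply: spLM; apply: spB; [exact: sp_Y|apply: sp_cst; exact: Lc0|exact: sp_Y|apply: sp_cst; exact: Lc0].
  have [c hc] := hasd_line u h; exists c.
  by apply: hasd_ext hc => t; rewrite YN.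
have hd : hasd (fun t : R => Y a (u + t%:C *: toC a) - qpow (2 * 1)) (qpow (2 * 1) * (4 * logq)).
  rewrite -[X in hasd _ X]addr0; apply: hasdD; last exact: hasd_cst.
  apply: hasd_ext (hasd_exp _ _) => t; rewrite YD Yu; congr (_ * _).
  rewrite /Defs.qpow cpairZ cpair_toC (cr_self hG hroot) // rc_nat; congr cexp; ring.
have := hasdM hc hd; rewrite scale0r addr0 Yu subrr mulr0 add0r => he.
eexists; last by apply: hasd_ext he => t; rewrite Bj0 ?Y_neq0 // !mulrA.
have q21 : qpow (2 * 1) != 1.
  by have := @qpow_int_neq1 R logq hq 2 isT; rewrite mulr1.
have q22 : qpow (2 * 1) != qpow (2 * -1).
  apply/eqP => h; have := @qpow_int_inj R logq hq 2 (-2).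
  rewrite mulrNz => hh; suff // : (2 = -2)%Z by [].
  by apply: hh; move: h; rewrite mulr1 mulrN mulr1.
apply: mulf_neq0; apply: mulf_neq0.
- by rewrite oppr_eq0 invr_eq0 qpow_neq0.
- by apply: mulf_neq0; rewrite subr_eq0.
- exact: qpow_neq0.
- by apply: mulf_neq0; [rewrite pnatr_eq0|exact: logq_neq0 hq].
Qed.

(* For [s >= 2] the factor [local_factor 0] does not vanish and [Mop_odd_zero]
   suffices; for [s = 1] it has a simple zero and the derivatives along [alpha]
   are compared instead. *)
Lemma odd_image_zero (s : nat) z : (1 <= s <= m a)%N -> cpair a (z - z0) = s%:R ->
  odd_part a z0 F z = 0.
Proof.
move=> /andP[s1 sm] hz; have [w [wa hw]] := off_line aP.
have [k0 hk] := hw z.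
apply: (sp_line (w := w) (k0 := k0) (sp_odd FP)) => k /hk /(Da_off) D0.
set u := z + _ in D0 *.
have hu : cpair a (u - z0) = s%:R by rewrite /u addrAC cpairD cpairZ wa mulr0 addr0.
apply: (mulfI D0); rewrite mulr0.
have [s2|s2] := leqP 2 s.
  have := Mop_odd_zero aP ma hz0 qinv_a hu sm.
  rewrite Mop_odd_factor => /eqP; rewrite mulf_eq0 => /orP[|/eqP//].
  have Yu : Y a u = qpow (2 * s%:R).
    by rewrite -[u](subrK z0) YD -[X in _ * X]YE hz0 mulr1 YE hu.
  have ne (l : int) : l != s -> qpow (2 * s%:R) != qpow (2 * l%:~R).
    move=> ls; apply: contra ls => /eqP h; apply/eqP.
    have := @qpow_int_inj R logq hq (2 * s%:Z) (2 * l).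
    rewrite !intrM -pmulrn => /(_ h); lia.
  rewrite Bj0 ?Y_neq0 // Yu !mulf_eq0 oppr_eq0 invr_eq0 (negbTE (qpow_neq0 _ _)) !subr_eq0 /=.
  have := ne 0; rewrite mulr0 qpow0 => /(_ _)/negbTE->; last by lia.
  have := ne (-1); rewrite mulrN1z => /(_ _)/negbTE->; last by lia.
  have := ne 1; rewrite -[1%:~R]/1 => /(_ _)/negbTE->; last by lia.
  by [].
have s1' : s = 1%N by lia.
rewrite s1' in hu.
have [e e0 he] := Bj0_derivative hu.
have [d hd] := hasd_line u (spM (PQ := setT) (fun _ _ _ _ => I) (sp_Da a) (sp_odd FP)).
have h1 := hasdM he hd.
have h2 := Mop_odd_derivative hu.
have /hasd_uniq : hasd (fun t => Mop a (odd_part a z0 f) (u + t%:C *: toC a))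
    (e * (Da a (u + (0 : R)%:C *: toC a) * odd_part a z0 F (u + (0 : R)%:C *: toC a)) +
     Bj a 0 (Y a (u + (0 : R)%:C *: toC a)) * d).
  by apply: hasd_ext h1 => t; rewrite Mop_odd_factor.
move=> /(_ _ h2); rewrite scale0r addr0.
have Yu : Y a u = qpow (2 * 1).
  by rewrite -[u](subrK z0) YD -[X in _ * X]YE hz0 mulr1 YE hu.
rewrite Bj0 ?Y_neq0 // Yu subrr !mulr0 mul0r addr0 => /eqP.
by rewrite mulf_eq0 (negbTE e0) /= => /eqP.
Qed.

End OneRoot.

(* Quasi-invariance says that the odd part of [F] under the reflection at [z] vanishes at
   the points at distance [s / 2] times [alpha] from the wall. *)
Lemma Dop_qinv : qinv F.
Proof.
move=> a s z aP hs hz; have ma : (0 < m a)%N by case/andP: hs => h1 /(leq_trans h1).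
pose w := z + (s%:R / 2) *: toC a.
have cw : cpair a (w - z) = s%:R.
  by rewrite /w addrAC subrr add0r cpairZ cpair_toC (cr_self hG hroot) // rc_nat divfK ?pnatr_eq0.
have := odd_image_zero aP ma hz hs cw.
rewrite /odd_part_at (sg_pt cw) => /eqP; rewrite subr_eq0 => /eqP ->.
by congr F; rewrite /w -addrA -scalerBl; congr (_ + _); rewrite -scaleNr; congr (_ *: _); field.
Qed.

End QuasiInvariancePreserved.

(** * Top coefficients *)

Section LeadingTerms.
Local Notation Y := coroot_exp.
Local Notation Nop := cleared_op.
Local Notation bt := cleared_coef.
Local Notation Dl := common_denom.
Implicit Types (a b tau : V) (x z w xi eta : VC) (f F g h : VC -> K).

Section Direction.
Context (lam : V).

Definition rdeg xi : R := complex.Re (cdot G (toC lam) xi).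
Local Notation deg := rdeg.

Lemma degD xi eta : deg (xi + eta) = deg xi + deg eta.
Proof. by rewrite /deg /cdot dotpDr raddfD. Qed.

Lemma deg_toC (u : V) : deg (toC u) = <<lam, u>>.
Proof. by rewrite /deg cdot_toC. Qed.

Lemma deg0 : deg 0 = 0.
Proof. by rewrite /deg /cdot dotp0r. Qed.

Definition lead h (k : K) eta : Prop :=
  sp [set xi | deg xi < deg eta] (fun z => h z - k * ee eta z).

Lemma lead_ext h h' k k' eta eta' : h =1 h' -> k = k' -> eta = eta' -> lead h k eta -> lead h' k' eta'.
Proof. by move=> e <- <-; apply: sp_ext => z; rewrite e. Qed.

Lemma lead_mono k eta : lead (fun z => k * ee eta z) k eta.
Proof. by apply: sp_ext (sp0 G logq _) => z; rewrite subrr. Qed.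

Lemma lead_cst k : lead (fun=> k) k 0.
Proof. by apply: lead_ext (lead_mono k 0) => // z; rewrite ee0 mulr1. Qed.

Lemma sp_lead h k eta : lead h k eta -> sp [set xi | deg xi <= deg eta] h.
Proof.
move=> hl; apply: (@sp_ext _ _ _ _ _ (fun z => (h z - k * ee eta z) + k * ee eta z)).
  by move=> z; rewrite subrK.
apply: spD; first by apply: sp_sub hl => xi /= /ltW.
by apply: sp_mono => /=.
Qed.

Lemma leadM h h' k k' eta eta' : lead h k eta -> lead h' k' eta' ->
  lead (fun z => h z * h' z) (k * k') (eta + eta').
Proof.
move=> hl hl'; apply: (@sp_ext _ _ _ _ _ (fun z => (h z - k * ee eta z) * h' z
  + (k * ee eta z) * (h' z - k' * ee eta' z))).
  move=> z; rewrite eeD; move: (h z) (h' z) (ee eta z) (ee eta' z) => u1 u2 u3 u4; ring.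
apply: spD.
  by apply: spM hl (sp_lead hl') => xi xi' /= h1 h2; rewrite !degD ltr_leD.
have hm' : sp [set xi | deg xi <= deg eta] (fun z => k * ee eta z) by apply: sp_mono => /=.
by apply: spM hm' hl' => xi xi' /= h1 h2; rewrite !degD ler_ltD.
Qed.

Lemma lead_prod (I : eqType) (r : seq I) (H : I -> VC -> K) (k : I -> K) (eta : I -> VC) :
  (forall i, i \in r -> lead (H i) (k i) (eta i)) ->
  lead (fun z => \prod_(i <- r) H i z) (\prod_(i <- r) k i) (\sum_(i <- r) eta i).
Proof.
elim: r => [|i r IH] hr.
  by apply: lead_ext (lead_cst 1) => [z||]; rewrite big_nil.
have hi : lead (H i) (k i) (eta i) by apply: hr; rewrite mem_head.
have {}IH := IH (fun j jr => hr j (etrans (in_cons _ _ _) (introT orP (or_intror jr)))).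
by apply: lead_ext (leadM hi IH) => [z||]; rewrite big_cons.
Qed.

Lemma cf_lead P h k eta f xi : lead h k eta -> sp P f ->
  (forall xi', deg xi < deg xi' -> cf f xi' = 0) ->
  cf (fun z => h z * f z) (eta + xi) = k * cf f xi.
Proof.
move=> hl fP hf.
have fd : sp [set xi' | deg xi' <= deg xi] f.
  apply: (sp_cf hG hq fP) => xi' /= h0; rewrite leNgt; apply/negP => /hf e.
  by rewrite e eqxx in h0.
have s1 : sp setT (fun z => k * ee eta z * f z).
  by apply: (spM _ (sp_mono _ _ _ (I : setT eta)) fd).
have s2 : sp [set xi' | deg xi' < deg (eta + xi)] (fun z => (h z - k * ee eta z) * f z).
  by apply: spM hl fd => u w /= h1 h2; rewrite !degD ltr_leD.
have e : (fun z => h z * f z) = (fun z => k * ee eta z * f z + (h z - k * ee eta z) * f z).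
  by apply/funext => z; ring.
rewrite e (cfD hG hq _ s1 s2) (cf_mul_mono hG hq _ _ _ fP) (cf_out hG hq s2) ?addr0 //=.
by rewrite ltxx.
Qed.

Lemma lead_affine_pos b (c d : K) : 0 < <<lam, cr b>> ->
  lead (fun z => c * Y b z - d) c (toC (cr b)).
Proof.
move=> lb; apply: (@sp_ext _ _ _ _ _ (fun=> - d)).
  by move=> z; rewrite /coroot_exp addrAC subrr add0r.
by apply: sp_cst; rewrite /= deg0 deg_toC.
Qed.

Lemma lead_affine_neg b (c d : K) : <<lam, cr b>> < 0 -> lead (fun z => c * Y b z - d) (- d) 0.
Proof.
move=> lb; apply: (@sp_ext _ _ _ _ _ (fun z => c * Y b z)).
  by move=> z; rewrite ee0 mulr1 opprK subrK.
by apply: sp_mono; rewrite /= deg0 deg_toC.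
Qed.

Lemma lead_fac1_pos b : 0 < <<lam, cr b>> -> lead (fun z => fac1 (Y b z)) 1 (toC (cr b)).
Proof. by move=> /(lead_affine_pos 1 1); apply: lead_ext => // z; rewrite mul1r. Qed.

Lemma lead_fac1_neg b : <<lam, cr b>> < 0 -> lead (fun z => fac1 (Y b z)) (- 1) 0.
Proof. by move=> /(lead_affine_neg 1 1); apply: lead_ext => // z; rewrite mul1r. Qed.

Definition jp (j : R) : R := if 0 < j then j else 0.

Definition sgn (b : V) : R := if 0 < <<lam, cr b>> then 1 else -1.

Definition eta_ b : VC := if 0 < <<lam, cr b>> then toC (cr b) + toC (cr b) else 0.

(** The exponent [eta_ b] and the factor [q^sgn] are independent of [j]; relative to the
    denominator, only the power of [q] containing [jp j] remains. *)
Lemma lead_psi b (j : R) (k : nat) : <<lam, cr b>> != 0 -> [\/ j <= 0, j = 1 | j = 2] ->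
  lead (fun z => psi j k (Y b z))
    (qpow (sgn b)%:C * qpow (- (sgn b * k%:R * jp j))%:C) (eta_ b).
Proof.
move=> lb hj; rewrite /sgn /eta_; have [lp|ln|/eqP] := ltgtP 0 <<lam, cr b>>; last first.
- by rewrite eq_sym (negbTE lb).
- have L1 (c d : K) := lead_affine_neg c d ln.
  case: hj => [j0|->|->].
  + apply: (lead_ext _ _ _ (leadM (lead_fac1_neg ln) (L1 (qpow 1) (qpow (-1))))); rewrite ?addr0 //.
      by move=> z; rewrite psi_le0.
    rewrite /jp ltNge j0 mulr0 oppr0 qpow0 mulr1 rcN mulrNN mul1r //.
  + apply: (lead_ext _ _ _ (leadM (L1 (qpow (- k%:R)) (qpow k%:R)) (L1 (qpow 1) (qpow (-1))))); rewrite ?addr0 //.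
      by move=> z; rewrite psi1.
    rewrite /jp ltr01 mulr1 mulrNN -!qpowD rcN rcN rcM rcN rc_nat; congr qpow; ring.
  + apply: (lead_ext _ _ _ (leadM (L1 (qpow (- k%:R)) (qpow k%:R)) (L1 (qpow (1 - k%:R)) (qpow (k%:R - 1))))); rewrite ?addr0 //.
      by move=> z; rewrite psi2.
    rewrite /jp ltr0n mulrNN -!qpowD rcN rcN rcM rcM rcN !rc_nat; congr qpow; ring.
have L1 (c d : K) := lead_affine_pos c d lp.
case: hj => [j0|->|->].
+ apply: (lead_ext _ _ _ (leadM (lead_fac1_pos lp) (L1 (qpow 1) (qpow (-1))))) => //.
    by move=> z; rewrite psi_le0.
  by rewrite /jp ltNge j0 mulr0 oppr0 qpow0 mulr1 mul1r.
+ apply: (lead_ext _ _ _ (leadM (L1 (qpow (- k%:R)) (qpow k%:R)) (L1 (qpow 1) (qpow (-1))))) => //.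
    by move=> z; rewrite psi1.
  rewrite /jp ltr01 mulr1 -!qpowD mul1r rcN rc_nat; congr qpow; ring.
+ apply: (lead_ext _ _ _ (leadM (L1 (qpow (- k%:R)) (qpow k%:R)) (L1 (qpow (1 - k%:R)) (qpow (k%:R - 1))))) => //.
    by move=> z; rewrite psi2.
  rewrite /jp ltr0n -!qpowD mul1r rcN rcM !rc_nat; congr qpow; ring.
Qed.

Context (gl : gen lam).

Definition kap : K := \prod_(b <- Phi | (0 < m b)%N) qpow (sgn b)%:C.
Definition eta0 : VC := \sum_(b <- Phi | (0 < m b)%N) eta_ b.

Lemma kap_neq0 : kap != 0.
Proof. by rewrite prodf_seq_neq0; apply/allP => b _; rewrite qpow_neq0 implybT. Qed.

Lemma jp_sub j : jp j - jp (- j) = j.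
Proof. by rewrite /jp oppr_gt0; case: ltgtP => [||<-]; rewrite ?subr0 ?sub0r ?opprK. Qed.

Lemma qpow_sum (I : Type) (r : seq I) (P : pred I) (E : I -> R) :
  \prod_(i <- r | P i) qpow (E i)%:C = qpow (\sum_(i <- r | P i) E i)%:C.
Proof.
by rewrite (big_morph (fun t : R => qpow t%:C) (fun s t => etrans (congr1 qpow (rcD s t)) (qpowD _ _ _)) (qpow0 logq)).
Qed.

Lemma lead_prod_psi (J : V -> R) : (forall b, b \in Phi -> [\/ J b <= 0, J b = 1 | J b = 2]) ->
  lead (fun z => \prod_(b <- Phi | (0 < m b)%N) psi (J b) (m b) (Y b z))
    (kap * qpow (- \sum_(b <- Phi | (0 < m b)%N) sgn b * (m b)%:R * jp (J b))%:C) eta0.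
Proof.
move=> hJ; rewrite -sumrN -qpow_sum /kap -big_split /eta0.
rewrite -[X in lead _ X]big_filter -[X in lead _ _ X]big_filter.
apply: (lead_ext _ erefl erefl (lead_prod _)) => [z|b]; first by rewrite big_filter.
rewrite mem_filter => /andP[mb bP]; apply: lead_psi; last exact: hJ.
by rewrite (cr_pair_eq0 hG hroot) // gl.
Qed.

Lemma sgnN b : <<lam, cr b>> != 0 -> sgn (- b) = - sgn b.
Proof.
by rewrite /sgn crN dotpNr oppr_gt0; case: ltgtP => // _ _; rewrite opprK.
Qed.

(** For [b] and [- b] together the positive parts of the pairing combine to the pairing itself
    ([jp_sub]), and the exponents add up to [- 2 (rl lam, tau)]. *)
Lemma lead_bt tau : tau \in Orb -> lead (bt tau) (kap * qpow (- (2 * <<rl lam, tau>>))%:C) eta0.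
Proof.
move=> tO; have hJ b : b \in Phi -> [\/ <<cr b, tau>> <= 0, <<cr b, tau>> = 1 | <<cr b, tau>> = 2].
  move=> bP; case: (Orb_pair hG hroot hom tO bP) => [->|->|->|-> _|-> _].
  - by apply: Or31.
  - by apply: Or32.
  - by apply: Or31; rewrite oppr_le0 ler01.
  - by apply: Or33.
  - by apply: Or31; rewrite oppr_le0 ler0n.
apply: lead_ext (lead_prod_psi hJ) => //; congr (_ * qpow (- _)%:C).
rewrite (big_split_gen hG hroot _ _ gl) /=; last by move=> b bP; rewrite (mN hG hroot hm).
rewrite /half_sum dotp_suml mulr_sumr big_mkcond [RHS]big_mkcond; apply: eq_big_seq => b bP.
have [m0|mb] := posnP (m b); first by rewrite m0 mul0r scale0r dotp0l !mulr0 /=; case: ifP.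
rewrite /=; case: ifP => // lb; have l0 : <<lam, cr b>> != 0.
  by rewrite (cr_pair_eq0 hG hroot) // gl.
rewrite (mN hG hroot hm) // sgnN // crN dotpNl {1 2}/sgn (cr_gt0 hG hroot) // lb mul1r mulN1r.
by rewrite mulNr -mulrBr jp_sub; move: (cr b) => c; rewrite dotpZl; field.
Qed.

Lemma lead_Dl : lead Dl kap eta0.
Proof.
apply: lead_ext (@lead_prod_psi (fun=> 0) _) => // [|b _]; last by apply: Or31.
rewrite big1 ?oppr0 ?qpow0 ?mulr1 // => b _.
by rewrite /jp ltxx mulr0.
Qed.

Context (P Q : set VC) (f F : VC -> K) (fP : sp P f) (FQ : sp Q F).
Hypothesis FE : forall z, Dl z * F z = Nop f z.

Definition symbol xi : K := \sum_(tau <- Orb) qpow (- (2 * <<rl lam, tau>>))%:C * (ee xi (toC tau) - 1) + CE.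

(* In the direction of a generic [lam] the coefficients of the operator have limits,
   so it acts on the [lam]-top coefficients by a scalar. *)
Lemma top_coef_aux xi : (forall xi', deg xi < deg xi' -> cf f xi' = 0) ->
  (forall xi', deg xi < deg xi' -> cf F xi' = 0) -> cf F xi = symbol xi * cf f xi.
Proof.
move=> hf hF; apply: (mulfI kap_neq0); rewrite -(cf_lead lead_Dl FQ hF).
have -> : (fun z => Dl z * F z) = Nop f by apply/funext.
have sT g S : sp S g -> sp setT g by apply: sp_sub.
have sM g h : sp setT g -> sp setT h -> sp setT (fun z => g z * h z) by exact: spM.
have dif tau : sp setT (fun z => f (z + toC tau) - f z).
  by apply: spB; [exact: sT (sp_shift (toC tau) fP)|exact: sT fP].
have s1 tau : sp setT (fun z => bt tau z * (f (z + toC tau) - f z)).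
  by apply: sM; [exact: sT (sp_bt tau)|exact: dif].
have s2 : sp setT (fun z => Dl z * f z) by apply: sM; [exact: sT (sp_Dl)|exact: sT fP].
have e : Nop f = (fun z => \sum_(tau <- Orb) bt tau z * (f (z + toC tau) - f z) + CE * (Dl z * f z)).
  by apply/funext => z; rewrite /cleared_op mulrA.
rewrite e (cfD hG hq _ (sp_sum (fun tau _ => s1 tau)) (spZ CE s2)) (cfZ hG hq _ _ s2).
rewrite (cf_sum hG hq _ (fun tau _ => s1 tau)) (cf_lead lead_Dl fP hf) /symbol mulrDl mulrDr.
congr (_ + _); last by ring.
rewrite mulr_suml mulr_sumr; apply: eq_big_seq => tau tO.
have cfT xi' : cf (fun z => f (z + toC tau) - f z) xi' = (ee xi' (toC tau) - 1) * cf f xi'.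
  by rewrite (cfB hG hq _ (sp_shift (toC tau) fP) fP) (cf_shift hG hq _ _ fP); ring.
rewrite (cf_lead (lead_bt tO) (dif tau)) ?cfT; first by ring.
by move=> xi' /hf; rewrite cfT => ->; rewrite mulr0.
Qed.

(** At a top exponent of [F] above the support of [f], [top_coef_aux] would give the coefficient 0.
    This removes the assumption on [F]. *)
Lemma top_bound (d : R) : (forall xi, d < deg xi -> cf f xi = 0) ->
  forall xi, d < deg xi -> cf F xi = 0.
Proof.
move=> hf xi dxi; apply/eqP/negPn/negP => F0.
have [t [ut tE _]] := cf_expand hG hq FQ.
have [|xi1 x1 hmax] := @seq_argmax _ R deg t xi; first by rewrite tE.
have dx1 : d < deg xi1 by apply: lt_le_trans dxi _; apply: hmax; rewrite tE.
have := x1; rewrite tE top_coef_aux ?hf ?mulr0 ?eqxx //.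
  by move=> xi' h; apply: hf; exact: lt_trans h.
move=> xi' h; apply/eqP/negPn/negP; rewrite -tE => /hmax; rewrite leNgt h //.
Qed.

Lemma top_coef xi : (forall xi', deg xi < deg xi' -> cf f xi' = 0) ->
  cf F xi = symbol xi * cf f xi.
Proof. by move=> hf; apply: top_coef_aux => //; exact: top_bound hf. Qed.

End Direction.

Definition orbit_char x : K := \sum_(tau <- Orb) ee (toC tau) x.
Local Notation ms := orbit_char.

(** By [rl_chamber] the constant term cancels the contribution of [- f] in the differences, whatever
    the chamber of [lam]. *)
Lemma symbolE v lam xi : gen v -> gen lam ->
  CE = \sum_(tau <- Orb) qpow (- (2 * <<rl v, tau>>))%:C ->
  symbol lam xi = ms (xi - toC (rl lam)).
Proof.
move=> gv gl hCE; rewrite /symbol hCE -(rl_chamber hG hroot omega hm (fun r => qpow (- (2 * r))%:C) gl gv).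
rewrite -big_split /ms; apply: eq_bigr => tau _ /=.
rewrite mulrBr mulr1 subrK eeDr eeNr [X in _ = X / _](ee_sym hG) mulrC; congr (_ * _).
by rewrite /expc cdot_toC -qpowN; congr qpow; rewrite rcN rcM rc_nat sC.
Qed.

End LeadingTerms.

End QuasiInvariants.

Section Spectrum.
Context (R : realType) (n : nat) (G : 'M[R]_n) (hG : scalar_product G).
Context (logq : R[i]).
Hypothesis hq : forall k : nat, (0 < k)%N -> cexp logq ^+ k != 1.
Context (Phi : {fset 'rV[R]_n}) (hroot : root_system G Phi) (hred : reduced Phi).
Context (m : 'rV[R]_n -> nat).
Hypothesis hm : forall a b, a \in Phi -> b \in Phi -> m (refl G a b) = m b.
Context (omega : 'rV[R]_n) (hom : quasi_or_minuscule G Phi omega).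
Context (v : 'rV[R]_n) (gv : regular_vec G Phi v).
Context (Pos : {fset 'rV[R]_n}) (hPos : Pos = [fset a in Phi | 0 < dotp G v a]%fset).
Hypothesis hirr : irreducible_roots G Phi.
Local Notation K := R[i].
Local Notation V := 'rV[R]_n.
Local Notation VC := 'rV[R[i]]_n.
Local Notation "<< u , v >>" := (dotp G u v) (at level 0, format "<< u ,  v >>").
Local Notation cr := (coroot G).
Local Notation sC := (dotp_real_sym hG).
Local Notation gen := (regular_vec G Phi).
Local Notation ee := (expc G logq).
Local Notation sp := (sp G logq).
Local Notation cf := (cf G logq).
Local Notation qpow := (qpow logq).
Local Notation qbr := (qbr logq).
Local Notation cpair := (cpair G).
Local Notation clat := (coroot_lattice G Phi m).
Local Notation zint := (signed_half_sum G Phi m).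
Local Notation generic := (generic G Phi logq).
Local Notation rl := (half_sum G Phi m).
Local Notation rho := (rl v).
Local Notation CE := (\sum_(tau <- Orb G Phi omega) qpow (- (2 * dotp G rho tau))%:C).
Local Notation Orb := (Orb G Phi omega).
Local Notation Y := (coroot_exp G logq).
Local Notation Px := (Px G Phi m rho).
Local Notation Dop := (dual_macdonald G logq Phi m omega CE).
Local Notation Nop := (cleared_op G logq Phi m omega CE).
Local Notation Dl := (common_denom G logq Phi m).
Local Notation qinv := (qinv G logq Phi m).
Local Notation deg := (rdeg G).
Local Notation ms := (orbit_char G logq Phi omega).

(** * The spectral argument *)

Section SpectralArgument.
Implicit Types (a b tau u w lam : V) (x z xi eta : VC) (f F g h : VC -> K) (c : K).

Let hrho : zint rho. Proof. exact: zint_rl. Qed.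

(** Twice the zonotope is the zonotope of the multiplicities [2 m], so saturation applies to it as
    well; 0 is one of its integral points. *)
Definition doubled b : nat := (2 * m b)%N.
Local Notation double := doubled.

Local Notation zint2 := (signed_half_sum G Phi double).

Let hm2 a b : a \in Phi -> b \in Phi -> double (refl G a b) = double b.
Proof. by move=> aP bP; rewrite /double hm. Qed.

Lemma rl_double lam : half_sum G Phi double lam = rl lam + rl lam.
Proof.
rewrite /half_sum -big_split; apply: eq_bigr => b _ /=.
by rewrite -scalerDl /double natrM; congr (_ *: _); field.
Qed.

Lemma clat_double u : coroot_lattice G Phi double u <-> clat u.
Proof.
have e b : (0 < double b)%N = (0 < m b)%N by rewrite /double muln_gt0.
by split=> -[k ->]; exists k; apply: eq_bigl => b; rewrite e.
Qed.

Lemma zint2_0 : zint2 0.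
Proof.
exists m; split; first by move=> b bP; rewrite (mN hG hroot hm) // /double mul2n addnn.
rewrite (zint_split hG hroot _ gv) big_seq_cond big1 // => b /andP[bP _].
by rewrite (mN hG hroot hm) // subrr mul0r scale0r.
Qed.

Lemma zint2_clat u : zint2 u -> clat u.
Proof.
move=> zu; apply/clat_double; rewrite -[u]subr0.
exact: (zint_sub hG hroot zu zint2_0).
Qed.

Lemma zint2_saturated u : clat u -> (forall lam, gen lam -> <<lam, u>> <= 2 * <<lam, rl lam>>) ->
  zint2 u.
Proof.
move=> cu hu; apply: (zint_saturated hG hroot hred hm2 zint2_0).
  by rewrite subr0; apply/clat_double.
by move=> lam gl; rewrite rl_double dotpDr -mulr2n -mulr_natl hu.
Qed.

Lemma zint_saturated_rl u : clat (u - rho) ->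
  (forall lam, gen lam -> <<lam, u>> <= <<lam, rl lam>>) -> zint u.
Proof. by move=> cu hu; apply: (zint_saturated hG hroot hred hm hrho). Qed.

(** Stated by support inequalities, because these are what [top_bound] propagates; [zint2_saturated]
    turns them into integral points. *)
Definition Gx x : set VC := [set xi | exists2 u, xi = x + toC (rho + u) &
  clat u /\ forall lam, gen lam -> <<lam, u>> <= 2 * <<lam, rl lam>>].

Lemma Gx_Px x : Gx x `<=` Px x.
Proof.
move=> xi [u -> [cu _]]; exists (rho + u) => //.
by rewrite addrAC subrr add0r.
Qed.

Lemma Gx_zint2 x xi : Gx x xi -> exists2 u, zint2 u & xi = x + toC (rho + u).
Proof. by move=> [u -> [cu hu]]; exists u => //; exact: zint2_saturated. Qed.

Definition good x F : Prop := sp (Gx x) F /\ qinv F.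

Lemma good_Px x F : good x F -> sp (Px x) F.
Proof. by case=> h _; apply: sp_sub h; exact: Gx_Px. Qed.

Lemma Dop_Nop x f F : sp (Px x) f -> sp (Px x) F ->
  (forall z, generic z -> F z = Dop f z) -> forall z, Dl z * F z = Nop f z.
Proof.
move=> fP FP FE; apply: (sp_eq_generic hG hq hroot (P := Px x) (Q := Px x)).
- by apply: spLP FP; exact: sp_Dl.
- exact: sp_Nop.
- by move=> z gz; rewrite FE // Nop_generic.
Qed.

(** Each support inequality survives by [top_bound] in its own direction. The map is total, so that
    iteration carries no proofs; its value outside good functions is irrelevant. *)
Lemma exists_DD x : exists DD : (VC -> K) -> (VC -> K), forall F, good x F ->
  good x (DD F) /\ forall z, generic z -> DD F z = Dop F z.
Proof.
suff h F : exists F', good x F -> good x F' /\ forall z, generic z -> F' z = Dop F z.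
  by have [DD hD] := choice h; exists DD.
have [[FG Fq]|nF] := pselect (good x F); last by exists F.
have FP := good_Px (conj FG Fq).
have [F' F'P F'E] := Dop_regular hG hq hroot hred hm hrho hom CE FP Fq.
exists F' => _; split => //; split; last exact: (Dop_qinv hG hq hroot hred hm hrho hom FP Fq F'P F'E).
have FN := Dop_Nop FP F'P F'E.
apply: (sp_cf hG hq F'P) => xi xi0; have [mu e cmu] := cf_in hG hq F'P xi0.
exists (mu - rho); first by rewrite [X in toC X]addrC subrK.
split => // lam gl.
suff : deg lam xi <= deg lam x + <<lam, rho>> + 2 * <<lam, rl lam>>.
  by rewrite e degD deg_toC dotpBr; lra.
rewrite leNgt; apply/negP => h.
have := top_bound hG hq hroot hm hom gl FP F'P FN _ h.
move=> e0; move/negP: xi0; apply; apply/eqP; apply: e0 => xi' h'.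
apply: (cf_out hG hq FG) => -[u e' [_ hu]].
by move: h'; rewrite e' degD deg_toC dotpDr -addrA !ltrD2l ltNge hu.
Qed.

Definition DD x := projT1 (cid (exists_DD x)).

Lemma good_DD x F : good x F -> good x (DD x F).
Proof. by rewrite /DD; case: cid => D /= hD /hD[]. Qed.

Lemma DDE x F z : good x F -> generic z -> DD x F z = Dop F z.
Proof. by rewrite /DD; case: cid => D /= hD /hD[_]; apply. Qed.

Lemma good_eq x F F' : good x F -> good x F' -> (forall z, generic z -> F z = F' z) -> F = F'.
Proof.
move=> [h _] [h' _] e; apply/funext.
exact: (sp_eq_generic hG hq hroot h h').
Qed.

Lemma good0 x : good x (fun=> 0).
Proof. by split; [exact: sp0|]. Qed.

Lemma goodB x F F' : good x F -> good x F' -> good x (fun z => F z - F' z).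
Proof.
move=> [h q1] [h' q2]; split; first exact: spB.
by move=> a s z aP hs hz; rewrite q1 // q2.
Qed.

Lemma goodZ x c F : good x F -> good x (fun z => c * F z).
Proof.
move=> [h q1]; split; first exact: spZ.
by move=> a s z aP hs hz; rewrite q1.
Qed.

Lemma DopB f g z : Dop (fun z => f z - g z) z = Dop f z - Dop g z.
Proof.
have alg (c1 c2 c3 c4 : K) : c1 + c2 - (c3 + c4) = (c1 - c3) + (c2 - c4) by ring.
rewrite /dual_macdonald [RHS]alg -mulrBr -sumrB; congr (_ + _).
by apply: eq_bigr => tau _; rewrite -mulrBr; congr (_ * _); ring.
Qed.

Lemma DopZ c f z : Dop (fun z => c * f z) z = c * Dop f z.
Proof.
rewrite /dual_macdonald mulrDr mulr_sumr mulrCA; congr (_ + _).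
by apply: eq_bigr => tau _; rewrite -mulrBr mulrCA.
Qed.

Lemma DDB x F F' : good x F -> good x F' ->
  DD x (fun z => F z - F' z) = (fun z => DD x F z - DD x F' z).
Proof.
move=> h h'; apply: (@good_eq x).
- exact/good_DD/goodB.
- by apply: goodB; exact: good_DD.
- by move=> z gz; rewrite !DDE ?DopB //; exact: goodB.
Qed.

Lemma DDZ x c F : good x F -> DD x (fun z => c * F z) = (fun z => c * DD x F z).
Proof.
move=> h; apply: (@good_eq x).
- exact/good_DD/goodZ.
- exact/goodZ/good_DD.
- by move=> z gz; rewrite !DDE ?DopZ //; exact: goodZ.
Qed.

Lemma DD0 x : DD x (fun=> 0) = (fun=> 0).
Proof.
have := DDZ 0 (good0 x); rewrite (_ : (fun z => 0 * 0) = (fun=> 0)).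
  by move=> ->; apply/funext => z; rewrite mul0r.
by apply/funext => z; rewrite mul0r.
Qed.

Definition shifted_DD x c F : VC -> K := fun z => DD x F z - c * F z.
Local Notation sop := shifted_DD.

Definition sops x (cs : seq K) F := foldr (sop x) F cs.

Lemma good_sop x c F : good x F -> good x (sop x c F).
Proof. by move=> h; apply: goodB; [exact: good_DD|exact: goodZ]. Qed.

Lemma good_sops x cs F : good x F -> good x (sops x cs F).
Proof. by move=> h; elim: cs => [//|c cs IH] /=; exact: good_sop. Qed.

Lemma sop0 x c : sop x c (fun=> 0) = (fun=> 0).
Proof. by apply/funext => z; rewrite /sop DD0 mulr0 subrr. Qed.

Lemma sops0 x cs : sops x cs (fun=> 0) = (fun=> 0).
Proof. by elim: cs => [//|c cs IH] /=; rewrite IH sop0. Qed.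

Lemma sopC x c c' F : good x F -> sop x c (sop x c' F) = sop x c' (sop x c F).
Proof.
move=> h; have hD := good_DD h; apply/funext => z.
rewrite {1 3}/sop (DDB hD (goodZ _ h)) (DDB hD (goodZ _ h)) !DDZ // /sop.
by move: (DD x (DD x F) z) (DD x F z) (F z) => u1 u2 u3; ring.
Qed.

Lemma sops_cat x cs cs' F : sops x (cs ++ cs') F = sops x cs (sops x cs' F).
Proof. exact: foldr_cat. Qed.

Lemma sops_perm x cs cs' F : good x F -> perm_eq cs cs' -> sops x cs F = sops x cs' F.
Proof.
move=> h; elim: cs cs' => [|c cs IH] cs' p.
  by have /perm_size := p; case: cs' {p}.
have cin : c \in cs' by rewrite -(perm_mem p) mem_head.
have [s1 [s2 e]] : exists s1 s2, cs' = s1 ++ c :: s2.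
  by case/splitPr: (cin) => s1 s2; exists s1, s2.
rewrite e in p *; have p' : perm_eq cs (s1 ++ s2).
  by move: p; rewrite perm_sym -[c :: s2]cat1s perm_catCA perm_cons perm_sym.
rewrite /= (IH _ p') !sops_cat /=.
elim: s1 {IH e p p' cin} => [//|c1 s1 IH] /=.
by rewrite -IH sopC //; do 2!apply: good_sops.
Qed.

Lemma DD_top x F lam xi : good x F -> gen lam ->
  (forall xi', deg lam xi < deg lam xi' -> cf F xi' = 0) ->
  cf (DD x F) xi = ms (xi - toC (rl lam)) * cf F xi.
Proof.
move=> h gl hF; have FP := good_Px h; have DP := good_Px (good_DD h).
rewrite (top_coef hG hq hroot hm hom gl FP DP (Dop_Nop FP DP _) hF) => [|z]; last exact: DDE.
by rewrite (symbolE hG hroot hm _ gv gl).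
Qed.

Lemma sop_top x F c lam xi : good x F -> gen lam ->
  (forall xi', deg lam xi < deg lam xi' -> cf F xi' = 0) ->
  cf (sop x c F) xi = (ms (xi - toC (rl lam)) - c) * cf F xi.
Proof.
move=> h gl hF; have FP := good_Px h; have DP := good_Px (good_DD h).
by rewrite (cfB hG hq _ DP (spZ c FP)) (cfZ hG hq _ _ FP) (DD_top h gl hF) mulrBl.
Qed.

Lemma sops_lead x F cs lam eta k : good x F -> gen lam -> lead G logq lam F k eta ->
  (forall xi', deg lam eta < deg lam xi' -> cf (sops x cs F) xi' = 0) /\
  cf (sops x cs F) eta = \prod_(c <- cs) (ms (eta - toC (rl lam)) - c) * k.
Proof.
move=> h gl hl; elim: cs => [|c cs [IH1 IH2]].
  have sl := sp_lead hl; split => [xi' hx|] /=.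
    by apply: (cf_out hG hq sl) => /=; rewrite leNgt hx.
  rewrite big_nil mul1r; have e : F = (fun z => (F z - k * ee eta z) + k * ee eta z).
    by apply/funext => z; rewrite subrK.
  rewrite e (cfD hG hq _ hl (sp_mono _ _ _ (I : setT eta))) (cf_out hG hq hl) /= ?ltxx //.
  by rewrite (cf_mono hG hq) eqxx mulr1 add0r.
split=> [xi' hx|] /=; rewrite (sop_top _ (good_sops cs h) gl).
- by rewrite IH1 ?mulr0.
- by move=> xi'' hx'; apply: IH1; exact: lt_trans hx hx'.
- by rewrite IH2 big_cons mulrA.
- exact: IH1.
Qed.

Lemma exists_top x F lam : good x F -> F <> (fun=> 0) -> exists2 xi, cf F xi != 0 &
  forall xi', deg lam xi < deg lam xi' -> cf F xi' = 0.
Proof.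
move=> [h _] F0; have [t [ut tE FE]] := cf_expand hG hq h.
case: t ut tE FE => [|xi0 t] ut tE FE; first by case: F0; apply/funext => z; rewrite FE big_nil.
have [xi xit hmax] := @seq_argmax _ R (deg lam) (xi0 :: t) xi0 (mem_head _ _).
exists xi; first by rewrite -tE.
move=> xi' hx; apply/eqP/negPn/negP; rewrite -tE => /hmax.
by rewrite leNgt hx.
Qed.

(* The operator is triangular for the order of the exponents given by [v]. *)
Lemma kill_zint2 : exists us : seq V, [/\ uniq us, forall u, u \in us -> zint2 u &
  forall x F, good x F -> sops x [seq ms (x + toC u) | u <- us] F = (fun=> 0)].
Proof.
have [r0 hr0] := zint_bounded_seq G Phi double.
pose us0 := undup [seq u <- r0 | `[< zint2 u >]].
have us0P u : (u \in us0) <-> zint2 u.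
  rewrite mem_undup mem_filter; split; first by case/andP => /asboolP.
  by move=> zu; rewrite hr0 // andbT; apply/asboolP.
pose r : rel V := fun u w => <<v, u>> <= <<v, w>>.
have rT : total r by move=> u w; exact: le_total.
pose us := sort r us0.
have usP u : (u \in us) <-> zint2 u by rewrite mem_sort.
exists us; split; first by rewrite sort_uniq undup_uniq.
  by move=> u /usP.
move=> x F h; pose X u := x + toC (rho + u).
have srt : pairwise r us.
  by rewrite -sorted_pairwise ?sort_sorted // => u2 u1 u3; exact: le_trans.
have degX u w : (deg v (X u) < deg v (X w)) = (<<v, u>> < <<v, w>>).
  by rewrite /X !degD !deg_toC !dotpDr !ltrD2l.
have supp F' xi : good x F' -> cf F' xi != 0 -> exists2 u, u \in us & xi = X u.
  by case=> hF _ /(cf_in hG hq hF)/Gx_zint2[u zu ->]; exists u => //; apply/usP.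
suff key p s : us = p ++ s -> forall u, cf (sops x [seq ms (x + toC u) | u <- s] F) (X u) != 0 -> u \in p.
  have gz := good_sops [seq ms (x + toC u) | u <- us] h.
  apply/funext; apply: (cf_eq0 hG hq (good_Px gz)) => xi; apply/eqP/negPn/negP => xi0.
  have [u uus e] := supp _ _ gz xi0; move: xi0; rewrite e => /(key [::] us erefl).
  by rewrite in_nil.
elim: s p => [|u0 s IH] p e u.
  rewrite /= => /(supp _ _ h)[u' uus /addrI/toC_inj/addrI ->].
  by rewrite e cats0 in uus.
have gg := good_sops [seq ms (x + toC u) | u <- s] h.
have {IH} := IH (rcons p u0); rewrite cat_rcons => /(_ e) IH.
rewrite /= => u1; apply/negPn/negP => up; move: u1 => /[dup] /(supp _ _ (good_sop _ gg)) [u' uus].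
move=> /addrI/toC_inj/addrI eu; move: uus; rewrite -{u'}eu e mem_cat (negbTE up) /= => us'.
set g := sops x _ F in IH gg *.
have top xi' : deg v (X u) < deg v xi' -> cf g xi' = 0.
  move=> hx; apply/eqP/negPn/negP => /[dup] /(supp _ _ gg)[w _ ew]; rewrite ew => /IH.
  rewrite ew degX ltNge in hx; rewrite mem_rcons inE => /orP[/eqP ew0|wp].
    move: hx; rewrite ew0; move: us'; rewrite inE => /orP[/eqP->|us']; first by rewrite lexx.
    by move: srt; rewrite e pairwise_cat /= => /and3P[_ _ /andP[/allP/(_ _ us')]]; rewrite /r => ->.
  move: srt; rewrite e pairwise_cat => /and3P[/allrelP/(_ _ _ wp us')].
  by rewrite /r (negbTE hx).
rewrite (sop_top _ gg gv top) mulf_eq0 negb_or.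
have [->|uu0] := eqVneq u u0.
  by rewrite /X toCD addrA addrAC addrK [X in X == 0]subrr eqxx.
move=> /andP[_ /IH]; rewrite mem_rcons inE (negbTE uu0) (negbTE up) //.
Qed.

(* Finitely many shifts, so [simple_spectrum] excludes a thin set of [x]. *)
Definition spectral_offset u : Prop := exists u' w, [/\ zint2 u', zint w & u = rho + u' - w].

Definition simple_spectrum x : Prop := forall u u', spectral_offset u -> spectral_offset u' ->
  ms (x + toC u) = ms (x + toC u') -> u = u'.

Lemma zint2_offset u : zint2 u -> spectral_offset u.
Proof. by move=> zu; exists u, rho; split => //; rewrite addrAC subrr add0r. Qed.

Lemma offset_clat u : spectral_offset u -> clat u.
Proof.
move=> [u' [w [/zint2_clat cu zw ->]]]; rewrite addrAC; apply: clatD => //.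
exact: (zint_sub hG hroot).
Qed.

(** At the [lam]-top exponent the eigenvalue reads [m_omega (x + rho + u - rl lam)]; as the spectrum
    is simple, the shift must be [u1]. *)
Lemma eigen_top x F u1 lam : simple_spectrum x -> zint2 u1 -> good x F ->
  DD x F = (fun z => ms (x + toC u1) * F z) -> F <> (fun=> 0) -> gen lam ->
  exists u, [/\ clat u, forall lam', gen lam' -> <<lam', u>> <= 2 * <<lam', rl lam'>>,
    u1 = rho + u - rl lam & forall xi', deg lam (x + toC (rho + u)) < deg lam xi' -> cf F xi' = 0].
Proof.
move=> sx z1 h E F0 gl; have [xi xi0 top] := exists_top lam h F0.
have [FG _] := h; have [u exi [cu hu]] := cf_in hG hq FG xi0.
exists u; split => //; last by rewrite -exi.
apply: sx; first exact: zint2_offset.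
  by exists u, (rl lam); split => //; [exact: zint2_saturated|exact: zint_rl].
have := DD_top h gl top; rewrite E (cfZ hG hq _ _ FG) => /(mulIf xi0) ->.
by rewrite exi toCB addrA.
Qed.

(* For an eigenfunction the eigenvalue determines the top exponent in every
   direction [lam] at once, and the support bound at all of them is saturation. *)
Lemma eigen_zint x F u1 : simple_spectrum x -> zint2 u1 -> good x F ->
  DD x F = (fun z => ms (x + toC u1) * F z) -> F <> (fun=> 0) -> zint (u1 - rho).
Proof.
move=> sx z1 h E F0; apply: zint_saturated_rl => [|lam gl].
  rewrite -addrA; apply: clatD; first exact: zint2_clat.
  by apply: (zint_sub hG hroot) => //; exact: zint_opp.
have [u [cu hu eu _]] := eigen_top sx z1 h E F0 gl.
by have := hu _ gl; rewrite eu !dotpBr dotpDr; lra.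
Qed.

(** The product over [us] kills [F]. A factor with [u] outside [S] is injective on good functions,
    as [eigen_zint] excludes its eigenfunctions; such factors are removed one at a time. *)
Lemma simple_spectrum_kill x F (S : seq V) : simple_spectrum x -> good x F -> uniq S ->
  (forall u, zint (u - rho) -> u \in S) ->
  sops x [seq ms (x + toC u) | u <- S] F = (fun=> 0).
Proof.
move=> sx h uS hS; have [us [uus usz kill]] := kill_zint2.
pose f u := ms (x + toC u).
pose A := [seq u <- us | u \in S]; pose B := [seq u <- us | u \notin S].
have kAB : sops x (map f B) (sops x (map f A) F) = (fun=> 0).
  rewrite -sops_cat -map_cat -(kill _ _ h); apply: sops_perm => //; apply: perm_map.
  by rewrite perm_catC perm_filterC.
have kA : sops x (map f A) F = (fun=> 0).
  have hB u : u \in B -> zint2 u /\ ~ zint (u - rho).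
    by rewrite mem_filter => /andP[uS' /usz zu]; split => // /hS uS''; rewrite uS'' in uS'.
  elim: B hB kAB => [//|b B IH] hB /= kB.
  apply: IH; first by move=> u uB; apply: hB; rewrite inE uB orbT.
  apply: contrapT => g0; have [zb nb] := hB _ (mem_head _ _).
  have gB : good x (sops x (map f B) (sops x (map f A) F)) by do 2!apply: good_sops.
  apply: nb; apply: (eigen_zint sx zb gB _ g0); apply/funext => z.
  by move/(congr1 (@^~ z)): kB => /eqP; rewrite /sop subr_eq0 => /eqP.
(* Elements of [S] outside [us] only add operators applied to 0. *)
have p : perm_eq S ([seq u <- S | u \notin us] ++ A).
  rewrite perm_sym; apply: perm_trans (permEl (perm_filterC (mem us) S)).
  rewrite perm_catC perm_cat2r; apply: uniq_perm.
  - exact: filter_uniq.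
  - exact: filter_uniq.
  - by move=> u; rewrite !mem_filter andbC.
by rewrite (sops_perm h (perm_map f p)) map_cat sops_cat kA sops0.
Qed.

(** With shift 0 the top exponent in direction [lam] has the degree of [x + rl lam]; these bounds in
    all directions give the zonotope by saturation. *)
Lemma simple_spectrum_support x F : simple_spectrum x -> good x F ->
  DD x F = (fun z => ms x * F z) -> sp [set xi | exists2 w, zint w & xi = x + toC w] F.
Proof.
move=> sx h E; have [F0|F0] := pselect (F = (fun=> 0)); first by rewrite F0; exact: sp0.
have [FG _] := h; apply: (sp_cf hG hq FG) => xi xi0.
have [u exi [cu hu]] := cf_in hG hq FG xi0.
exists (rho + u) => //; apply: zint_saturated_rl; first by rewrite addrAC subrr add0r.
move=> lam gl; have E' : DD x F = (fun z => ms (x + toC 0) * F z) by rewrite toC0 addr0.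
have [u' [cu' hu' /esym/eqP]] := eigen_top sx zint2_0 h E' F0 gl.
rewrite subr_eq0 => /eqP eu' top; rewrite leNgt; apply/negP => lt.
by move/negP: xi0; apply; apply/eqP; apply: top; rewrite exi !degD !deg_toC eu' ltrD2l.
Qed.

End SpectralArgument.

(** * The function [q^(2 (x, z)) Q(z)]: support, quasi-invariance, lowest term *)

Section InitialFunction.
Implicit Types (a b tau u w lam : V) (x z xi eta : VC) (f F g h : VC -> K) (c : K) (j : nat).

Definition init x z : K := qpow (2 * cdot G x z) * Qfun G Pos m logq z.

Definition fac a j z : K := qbr (cpair a z + j%:R) * qbr (cpair a z - j%:R).

Definition Qprod z : K := \prod_(a <- Pos) \prod_(1 <= j < (m a).+1) fac a j z.

Lemma facE a j z : fac a j z = (Y a z + Y (- a) z) - (qpow (2 * j%:R) + qpow (- (2 * j%:R))).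
Proof.
rewrite /fac /Defs.qbr !mulrBl !mulrBr -!qpowD YN !YE -qpowN.
rewrite (_ : cpair a z + j%:R + (cpair a z - j%:R) = 2 * cpair a z); last by ring.
rewrite (_ : cpair a z + j%:R + - (cpair a z - j%:R) = 2 * j%:R); last by ring.
rewrite (_ : - (cpair a z + j%:R) + (cpair a z - j%:R) = - (2 * j%:R)); last by ring.
rewrite (_ : - (cpair a z + j%:R) + - (cpair a z - j%:R) = - (2 * cpair a z)); last by ring.
ring.
Qed.

Lemma facN a j z : fac (- a) j z = fac a j z.
Proof. by rewrite (facE a) (facE (- a)) (opprK a); move: (Y a z) (Y (- a) z) => y1 y2; rewrite (addrC y1). Qed.

Lemma initE x z : init x z = ee x z * (ee (toC rho) z * Qprod z).
Proof. by rewrite /init /Qfun (rhov_rl m hPos). Qed.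

Lemma init_zero x z : Qprod z = 0 -> init x z = 0.
Proof. by rewrite initE => ->; move: (ee _ z) => y1; move: (ee _ z) => y2; rewrite [X in _ * X]mulr0 mulr0. Qed.

Definition bd (d : V -> R) : set VC := [set xi | exists2 u, xi = toC u &
  clat u /\ forall lam, gen lam -> <<lam, u>> <= d lam].

Lemma bdM d e f g : sp (bd d) f -> sp (bd e) g -> sp (bd (fun lam => d lam + e lam)) (fun z => f z * g z).
Proof.
apply: spM => _ _ [u -> [cu hu]] [w -> [cw hw]]; exists (u + w); first by rewrite toCD.
by split=> [|lam gl]; [exact: clatD|rewrite dotpDr lerD ?hu ?hw].
Qed.

Lemma bd_prod (I : eqType) (r : seq I) (d : I -> V -> R) (H : I -> VC -> K) :
  (forall i, i \in r -> sp (bd (d i)) (H i)) ->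
  sp (bd (fun lam => \sum_(i <- r) d i lam)) (fun z => \prod_(i <- r) H i z).
Proof.
elim: r => [|i r IH] h.
  apply: (@sp_ext _ _ _ _ _ (fun=> 1)); first by move=> z; rewrite big_nil.
  apply: sp_cst; exists 0; rewrite ?toC0 //; split=> [|lam _]; first exact: clat0.
  by rewrite dotp0r big_nil.
have {}IH := IH (fun k kr => h k (etrans (in_cons _ _ _) (introT orP (or_intror kr)))).
apply: sp_ext (sp_sub _ (bdM (h i (mem_head _ _)) IH)) => [z|_ [u -> [cu hu]]].
  by rewrite big_cons.
by exists u => //; split=> // lam gl; rewrite big_cons hu.
Qed.

Lemma sp_fac a j : a \in Phi -> (0 < m a)%N -> sp (bd (fun lam => `|<<lam, cr a>>|)) (fac a j).
Proof.
move=> aP ma; apply: (sp_ext (fun z => esym (facE a j z))).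
have ha : bd (fun lam => `|<<lam, cr a>>|) (toC (cr a)).
  by exists (cr a) => //; split=> [|lam _]; [exact: clat_coroot|exact: ler_norm].
have hNa : bd (fun lam => `|<<lam, cr a>>|) (toC (cr (- a))).
  rewrite crN; exists (- cr a) => //; split=> [|lam _]; first exact/clatN/clat_coroot.
  by rewrite dotpNr lerNl lerNnormlW.
apply: spB; first by apply: spD; exact: sp_ee.
apply: sp_cst; exists 0; rewrite ?toC0 //.
by split=> [|lam _]; [exact: clat0|rewrite dotp0r].
Qed.

Lemma sum_half lam (F : V -> R) : gen lam -> (forall b, b \in Phi -> F (- b) = F b) ->
  \sum_(b <- Phi) F b = 2 * \sum_(b <- Phi | 0 < <<lam, b>>) F b.
Proof.
move=> gl hF; rewrite (big_split_gen hG hroot _ _ gl) //= mulr_sumr.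
rewrite big_seq_cond [RHS]big_seq_cond; apply: eq_bigr => b /andP[bP _].
by rewrite hF // mulr_natl mulr2n.
Qed.

(** The summand is even in [a], so half the sum over all roots can be taken over the chamber of [v]
    or over that of [lam]. *)
Lemma sum_Pos_norm lam : gen lam ->
  \sum_(a <- Pos) (m a)%:R * `|<<lam, cr a>>| = 2 * <<lam, rl lam>>.
Proof.
move=> gl; rewrite (big_Pos hPos); pose F b : R := (m b)%:R * `|<<lam, cr b>>|.
have FN b : b \in Phi -> F (- b) = F b.
  by move=> bP; rewrite /F (mN hG hroot hm) // crN dotpNr normrN.
apply: (@mulfI _ 2); first by rewrite pnatr_eq0.
rewrite -(sum_half gv FN) (sum_half gl FN); congr (_ * _).
rewrite /half_sum dotp_sumr mulr_sumr; rewrite big_seq_cond [RHS]big_seq_cond.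
apply: eq_bigr => b /andP[bP lb]; rewrite /F gtr0_norm ?(cr_gt0 hG hroot) //.
by move: (cr b) => cb; rewrite dotpZr; field.
Qed.

Lemma sp_Qprod : sp (bd (fun lam => 2 * <<lam, rl lam>>)) Qprod.
Proof.
suff h : sp (bd (fun lam => \sum_(a <- Pos) \sum_(1 <= j < (m a).+1) `|<<lam, cr a>>|)) Qprod.
  apply: sp_sub h => _ [u -> [cu hu]]; exists u => //; split=> // lam gl.
  apply: le_trans (hu _ gl) _; rewrite -sum_Pos_norm //; apply: ler_sum => a _.
  by rewrite big_const_nat subSS subn0 iter_addr addr0 mulr_natl.
apply: bd_prod => a; rewrite (mem_Pos hPos) => /andP[aP _].
apply: bd_prod => j; rewrite mem_index_iota => /andP[j0 jm]; apply: sp_fac => //.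
exact: leq_trans j0 jm.
Qed.

Lemma sp_init x : sp (Gx x) (init x).
Proof.
apply: (@sp_ext _ _ _ _ _ (fun z => 1 * ee (x + toC rho) z * Qprod z)).
  by move=> z; rewrite initE eeD mul1r mulrA.
apply: spM (sp_mono _ _ _ (erefl : [set x + toC rho] (x + toC rho))) sp_Qprod.
by move=> _ _ -> [u -> hu]; exists u; rewrite ?toCD ?addrA.
Qed.

Lemma fac_zero a j z : qbr (cpair a z - j%:R) = 0 \/ qbr (cpair a z + j%:R) = 0 -> fac a j z = 0.
Proof. by rewrite /fac => -[] ->; rewrite ?mulr0 ?mul0r. Qed.

Lemma Qprod_zero a j z : a \in Phi -> (1 <= j <= m a)%N ->
  (fac a j z = 0) -> Qprod z = 0.
Proof.
move=> aP jm a0; suff [b bP b0] : exists2 b, b \in Pos & m b = m a /\ fac b j z = 0.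
  case: b0 => mb b0; rewrite /Qprod; apply/eqP; rewrite prodf_seq_eq0; apply/hasP; exists b => //=.
  rewrite prodf_seq_eq0; apply/hasP; exists j; first by rewrite mem_index_iota mb.
  by rewrite b0 eqxx.
have [va|va] := boolP (0 < <<v, a>>); first by exists a; rewrite ?(mem_Pos hPos) ?aP.
exists (- a); first by rewrite (mem_Pos hPos) (root_opp hG hroot) aP (gen_opp_gt0 gv aP) va.
split; first exact: (mN hG hroot hm).
by rewrite facN.
Qed.

(** Both sides vanish: at distance [s / 2] times [a] on either side of the wall, the factor of [Q]
    for [j = s] is zero. *)
Lemma qinv_init x : qinv (init x).
Proof.
move=> a s z aP hs hz.
have h (e : K) : fac a s (z + e *: toC a) = 0 -> init x (z + e *: toC a) = 0.
  by move=> e0; apply/init_zero/(Qprod_zero aP hs e0).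
have cp (e : K) : cpair a (z + e *: toC a) = cpair a z + e * 2.
  by rewrite cpairD cpairZ cpair_toC (cr_self hG hroot) // rc_nat.
have q0 : qbr (cpair a z) = 0 by apply/eqP; rewrite qbr_eq0 hz.
rewrite -scaleNr h; last first.
  by apply: fac_zero; left; rewrite cp divfK ?pnatr_eq0 // addrK.
rewrite h //; apply: fac_zero; right.
by rewrite cp mulNr divfK ?pnatr_eq0 // subrK.
Qed.

Lemma good_init x : good x (init x).
Proof. by split; [exact: sp_init|exact: qinv_init]. Qed.

Lemma lead_fac a j : a \in Pos -> lead G logq (- v) (fac a j) 1 (toC (- cr a)).
Proof.
rewrite (mem_Pos hPos) => /andP[aP va]; have ca : 0 < <<v, cr a>> by rewrite (cr_gt0 hG hroot).
apply: (@sp_ext _ _ _ _ _ (fun z => Y a z - (qpow (2 * j%:R) + qpow (- (2 * j%:R))))).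
  move=> z; rewrite mul1r facE -crN -[ee _ z]/(Y (- a) z).
  by move: (Y a z) (Y (- a) z) => u1 u2; ring.
apply: spB; first by apply: sp_ee; rewrite /= !deg_toC !dotpNl dotpNr opprK; lra.
by apply: sp_cst; rewrite /= /rdeg /cdot dotp0r -/(cdot _ _ _) cdot_toC dotpNl dotpNr opprK /=.
Qed.

(** Each factor of [Q] has lowest exponent [- a^vee] with coefficient 1, so [rho] goes down to
    [rho - 2 rho]. *)
Lemma lead_init x : lead G logq (- v) (init x) 1 (x - toC rho).
Proof.
have lQ : lead G logq (- v) Qprod 1 (toC (- (rho + rho))).
  have h a : a \in Pos -> lead G logq (- v) (fun z => \prod_(1 <= j < (m a).+1) fac a j z)
      (\prod_(1 <= j < (m a).+1) 1) (\sum_(1 <= j < (m a).+1) toC (- cr a)).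
    by move=> aP; apply: lead_prod => j _; exact: lead_fac.
  apply: lead_ext (lead_prod h) => //.
    by rewrite big1 // => a _; rewrite big1.
  have -> : rho + rho = \sum_(a <- Pos) (m a)%:R *: cr a.
    rewrite /half_sum (big_Pos hPos) -big_split; apply: eq_bigr => b _ /=.
    by rewrite -scalerDl; congr (_ *: _); field.
  rewrite toCN (big_morph _ (@toCD R n) (toC0 R n)) -sumrN; apply: eq_bigr => a _.
  rewrite big_const_nat subSS subn0 iter_addr addr0 toCN mulNrn; congr (- _).
  by rewrite toCZ rc_nat scaler_nat.
have L := leadM (lead_mono G logq (- v) 1 (x + toC rho)) lQ.
apply: lead_ext L => [z||]; rewrite ?mul1r //.
  by rewrite initE eeD mulrA.
by rewrite toCN toCD opprD addrACA addrA addrK.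
Qed.

End InitialFunction.

(** * Dependence on [x] and passage to arbitrary [x] *)

Section Continuation.
Implicit Types (a b tau u w lam : V) (x z xi eta : VC) (f F g h : VC -> K) (c : K) (k j : nat) (us : seq V).

Lemma generic_Orb z tau : tau \in Orb -> generic z -> generic (z + toC tau).
Proof.
move=> tO gz a l aP; have [i ei] : exists i : int, <<cr a, tau>> = i%:~R.
  by apply/intrP; rewrite sC; exact: (Orb_weight hG hroot hom tO).
by rewrite cpairD cpair_toC ei rc_int -addrA -rmorphD; exact: gz.
Qed.

Lemma Dop_eq f g : (forall z, generic z -> f z = g z) ->
  forall z, generic z -> Dop f z = Dop g z.
Proof.
move=> e z gz; rewrite /dual_macdonald (e _ gz); congr (_ + _); apply: eq_big_seq => tau tO.
by rewrite (e _ (generic_Orb tO gz)).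
Qed.

(** The literal iteration of the statement, with no choice of regular extensions; [raw_sops]
    compares it with [sops] at generic points. *)
Definition raw us x h : VC -> K :=
  foldr (fun u g z => Dop g z - ms (x + toC u) * g z) h us.

Lemma raw_sops us x F z : good x F -> generic z ->
  raw us x F z = sops x [seq ms (x + toC u) | u <- us] F z.
Proof.
move=> hF; elim: us z => [//|u us IH] z gz /=.
rewrite -/(raw us x F) IH // /shifted_DD DDE //; last exact: good_sops.
by rewrite (Dop_eq IH gz).
Qed.

(** Here [z] is fixed and [x] varies. Each operator adds to the exponents elements of the orbit of
    [omega], through the translation of [q^(2 (x, z))] and through [m_omega (x + u)]; hence [T] is
    independent of [z]. *)
Lemma raw_exponents us : exists T : seq VC, forall z,
  sp [set xi | xi \in T] (fun x => raw us x (init x) z * ee (- x) z).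
Proof.
elim: us => [|u us [T hT]].
  exists [:: 0] => z; set k := ee (toC rho) z * Qprod z.
  have alg (e1 e2 : K) : e1 != 0 -> e2 = e1 * e2 * e1^-1.
    by move=> e0; rewrite mulrAC mulfV // mul1r.
  have h : sp [set xi | xi \in [:: 0]] (fun=> k) by apply: sp_cst => /=; rewrite inE.
  apply: sp_ext h => x.
  have ei : raw [::] x (init x) z = ee x z * k by exact: initE.
  rewrite ei eeN; exact: (alg _ k (ee_neq0 _ _ _ _)).
pose T' := [seq xi + toC tau | xi <- T, tau <- Orb].
exists (T ++ T') => z.
have mT xi : xi \in T -> [set xi | xi \in T ++ T'] xi by move=> h /=; rewrite mem_cat h.
have mT' xi tau : xi \in T -> tau \in Orb -> [set xi | xi \in T ++ T'] (xi + toC tau).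
  by move=> h1 h2 /=; rewrite mem_cat (allpairs_f (fun xi tau => xi + toC tau)) ?orbT.
pose H z x := raw us x (init x) z * ee (- x) z.
have sH z' : sp [set xi | xi \in T ++ T'] (H z') by apply: sp_sub (hT z').
have sHO z' tau : tau \in Orb -> sp [set xi | xi \in T ++ T'] (fun x => H z' x * ee (toC tau) x).
  move=> tO; apply: spM (hT z') (sp_ee G logq (erefl : [set toC tau] (toC tau))).
  by move=> xi _ hx ->; exact: mT'.
apply: (@sp_ext _ _ _ _ _ (fun x =>
  (\sum_(tau <- Orb) a_coef G Phi m logq tau z * (H (z + toC tau) x * ee (toC tau) x - H z x)
   + CE * H z x) - \sum_(tau <- Orb) ee (toC tau) (toC u) * (H z x * ee (toC tau) x))).
  move=> x /=; apply/esym; rewrite -/(raw us x _) /dual_macdonald /H; set g := raw us x _; set e := ee (- x) z.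
  rewrite mulrBl mulrDl mulr_suml -[CE * g z * e]mulrA; congr (_ + _ - _).
    have alg (k g1 g2 e0 e1 e2 : K) : e0 = e1 * e2 ->
      k * (g1 - g2) * e0 = k * (g1 * e1 * e2 - g2 * e0) by move=> ->; ring.
    apply: eq_bigr => tau _; apply: alg; rewrite (eeDr G logq (- x)) (eeN G logq x (toC tau)).
    by rewrite (ee_sym hG logq x (toC tau)) divfK // ee_neq0.
  rewrite /orbit_char !mulr_suml; apply: eq_bigr => tau _; rewrite eeDr.
  by move: (g z) e (ee (toC tau) x) (ee (toC tau) (toC u)) => u1 u2 u3 u4; ring.
apply: spB; last by apply: sp_sum => tau tO; apply: spZ; exact: sHO.
apply: spD; last exact: spZ.
by apply: sp_sum => tau tO; apply: spZ; apply: spB => //; exact: sHO.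
Qed.

(** Integrality makes sums along this direction Laurent polynomials in [q^(2 k)]; separation of the
    orbit keeps their terms from cancelling. *)
Lemma exists_separating : exists y, (forall tau, tau \in Orb -> <<y, tau>> \is a Num.int) /\
  forall tau tau', tau \in Orb -> tau' \in Orb -> <<y, tau>> = <<y, tau'>> -> tau = tau'.
Proof.
pose D : set V := [set y | forall tau, tau \in Orb -> <<y, tau>> \is a Num.int].
pose T := [seq t <- [seq tau - tau' | tau <- Orb, tau' <- Orb] | t != 0].
have [|u w N Du Dw tau tO|t|y Dy hy] := @avoid_hyperplanes R n G D T.
- by move=> tau _; rewrite dotp0l rpred0.
- by rewrite dotpDl dotpZl rpredD ?Dw // rpredM ?Du // natr_int.
- rewrite mem_filter => /andP[t0 _]; apply: contrapT => H; move/eqP: t0; apply.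
  apply: (root_span hG hroot) => a aP; rewrite sC; apply/eqP.
  rewrite -[X in dotp G X t](crK hG hroot aP) cr_pairl mulf_eq0; apply/orP; right.
  apply/negPn/negP => h; apply: H; exists (cr a) => // tau tO.
  by rewrite sC; exact: (Orb_weight hG hroot hom tO).
exists y; split=> // tau tau' tO tO' e; apply/eqP; rewrite -subr_eq0; apply/negPn/negP => t0.
have /hy : tau - tau' \in T.
  by rewrite mem_filter t0 (allpairs_f (fun tau tau' : V => tau - tau')).
by rewrite dotpBr e subrr eqxx.
Qed.

Definition separating := projT1 (cid exists_separating).

Lemma sep_int tau : tau \in Orb -> exists i : int, <<separating, tau>> = i%:~R.
Proof. by rewrite /separating; case: cid => y [hy _] /= /hy/intrP. Qed.

Lemma sep_inj tau tau' : tau \in Orb -> tau' \in Orb -> <<separating, tau>> = <<separating, tau'>> -> tau = tau'.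
Proof. by rewrite /separating; case: cid => y [_ hy] /=; exact: hy. Qed.

(** The powers of [q^2] are distinct, so each root of [p] is met at most once. *)
Lemma poly_nonzero_powers (p : {poly K}) : p != 0 ->
  exists k0, forall k, (k0 <= k)%N -> p.[qpow 2 ^+ k] != 0.
Proof.
move=> p0; have [r pE] := closed_field_poly_normal p.
have [t _|k0 hk] := @eventually_seq _ r (fun (t : K) k => qpow 2 ^+ k != t).
  have [[k1 e]|H] := pselect (exists k1, qpow 2 ^+ k1 = t).
    exists k1.+1 => k k1k; apply/negP => /eqP; rewrite -e -!qpowMn => /eqP.
    have q2 (l : nat) : qpow (2 * l%:R) = qpow ((2 * l)%N%:Z%:~R) by rewrite -pmulrn natrM.
    by rewrite !q2 => /eqP/(qpow_int_inj hq) []; lia.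
  by exists 0%N => k _; apply/eqP => e; apply: H; exists k.
exists k0 => k /hk h; rewrite pE hornerZ mulf_neq0 ?lead_coef_eq0 // horner_prod.
by rewrite prodf_seq_neq0; apply/allP => t /h /=; rewrite hornerXsubC subr_eq0.
Qed.

Lemma exp_sum_nonzero (c : V -> K) tau0 : tau0 \in Orb -> c tau0 != 0 ->
  exists k0, forall k, (k0 <= k)%N -> \sum_(tau <- Orb) c tau * ee (toC tau) (toC separating) ^+ k != 0.
Proof.
move=> tO c0.
(* [M] makes the integral exponents nonnegative: the sum times [q^(2 M k)] is a polynomial evaluated
   at [q^(2 k)]. *)
have [|M hM] := @eventually_seq _ Orb (fun tau N => 0 <= <<separating, tau>> + N%:R).
  move=> tau _; have [N0 h] := archi_nat (- <<separating, tau>>); exists N0 => N /h hN.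
  by rewrite -lerBlDl sub0r ltW.
have {}hM := hM _ (leqnn M).
have hj tau : exists j : nat, tau \in Orb -> <<separating, tau>> + M%:R = j%:R.
  have [tO'|_] := boolP (tau \in Orb); last by exists 0%N.
  have [i ei] := sep_int tO'; have := hM _ tO'; rewrite ei -[M%:R]/(M%:Z%:~R) -rmorphD ler0z.
  by case: (i + M%:Z) => // j _; exists j.
have [j hjE] := choice hj.
pose p : {poly K} := \sum_(tau <- Orb) c tau *: 'X^(j tau).
have pk k : p.[qpow 2 ^+ k] = qpow 2 ^+ (M * k) * \sum_(tau <- Orb) c tau * ee (toC tau) (toC separating) ^+ k.
  rewrite horner_sum mulr_sumr; apply: eq_big_seq => tau tO'.
  rewrite hornerZ hornerXn mulrCA; congr (_ * _).
  rewrite -exprM mulnC exprM [X in _ = X * _]exprM -exprMn; congr (_ ^+ _).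
  rewrite -!qpowMn /expc cdot_toC -qpowD; congr qpow.
  by rewrite sC -mulrDr -!rc_nat -rcD addrC hjE.
have p0 : p != 0.
  apply/eqP => /(congr1 (fun q : {poly K} => q`_(j tau0))); rewrite coef0 coef_sum => /eqP.
  rewrite (bigD1_seq tau0) ?Orb_uniq //= coefZ coefXn eqxx mulr1 big_seq_cond big1 ?addr0 ?(negbTE c0) //.
  move=> tau /andP[tO' /eqP ne]; rewrite coefZ coefXn; case: eqP => [ej|]; last by rewrite mulr0.
  case: ne; apply: sep_inj => //; apply: (@addIr _ M%:R).
  by rewrite !hjE // ej.
have [k0 hk] := poly_nonzero_powers p0; exists k0 => k /hk.
by rewrite pk mulf_eq0 negb_or => /andP[].
Qed.

Lemma ms_line x k u : ms (x + k%:R *: toC separating + toC u) =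
  \sum_(tau <- Orb) ee (toC tau) (x + toC u) * ee (toC tau) (toC separating) ^+ k.
Proof.
by apply: eq_bigr => tau _; rewrite !eeDr eeMn mulrAC.
Qed.

Lemma offset_bounded : exists r : seq V, forall u, spectral_offset u -> u \in r.
Proof.
have [r1 h1] := zint_bounded_seq G Phi m.
have [r2 h2] := zint_bounded_seq G Phi (doubled).
exists [seq rho + u - w | u <- r2, w <- r1] => _ [u [w [/h2 hu /h1 hw ->]]].
exact: (allpairs_f (fun u w : V => rho + u - w)).
Qed.

(** For each of finitely many pairs of distinct offsets, the difference of the values of [m_omega]
    is an exponential sum in [k]. By [Orb_span] some [tau] pairs with the difference of the offsets
    to a nonzero integer, and as [q] is not a root of unity the coefficient at [tau] is nonzero. *)
Lemma simple_spectrum_line x : exists k0, forall k, (k0 <= k)%N ->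
  simple_spectrum (x + k%:R *: toC separating).
Proof.
have [r hr] := offset_bounded.
have [p _|k0 hk] := @eventually_seq _ [seq (u, u') | u <- r, u' <- r]
   (fun p k => spectral_offset p.1 -> spectral_offset p.2 -> ms (x + k%:R *: toC separating + toC p.1) = ms (x + k%:R *: toC separating + toC p.2) -> p.1 = p.2); last first.
  exists k0 => k /hk h u u' hu hu'; apply: (h (u, u')) => //.
  by apply: (allpairs_f pair); exact: hr.
have [[h1 h2]|H] := pselect (spectral_offset p.1 /\ spectral_offset p.2); last by exists 0%N => k _ h1 h2; case: H.
have [e|ne] := eqVneq p.1 p.2; first by exists 0%N.
pose c tau := ee (toC tau) (x + toC p.1) - ee (toC tau) (x + toC p.2).
suff [tau tO c0] : exists2 tau, tau \in Orb & c tau != 0.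
  have [k0 hk] := exp_sum_nonzero tO c0; exists k0 => k /hk /eqP h _ _ e; case: h.
  move/eqP: e; rewrite !ms_line -subr_eq0 -sumrB => /eqP e; rewrite -[RHS]e.
  by apply: eq_bigr => t _; rewrite mulrBl.
apply: contrapT => H; move/eqP: ne; apply; apply/eqP; rewrite -subr_eq0; apply/eqP.
apply: (Orb_span hG hroot hom hirr) => tau tO; apply/eqP/negPn/negP => t0; apply: H.
exists tau => //; rewrite /c !eeDr -mulrBr mulf_neq0 ?ee_neq0 // subr_eq0.
have [i ei] : exists i : int, <<tau, p.1 - p.2>> = i%:~R.
  apply: (clat_weight (m := m) (Orb_weight hG hroot hom tO)).
  by apply: clatB; exact: (offset_clat).
have i0 : 2 * i != 0 by rewrite mulf_neq0 //; apply: contraNneq t0 => i0; rewrite ei i0.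
have := qpow_int_neq1 hq i0; apply: contra => /eqP e.
rewrite rmorphM /= -(rc_int R i) -ei -cdot_toC toCB /cdot dotpBr -!/(cdot _ _ _) mulrBr qpowB.
by move: e; rewrite /expc => ->; rewrite divff // qpow_neq0.
Qed.

(* After removing [ee x], everything is an exponential sum in [x] whose spectrum
   [T] does not depend on [z]; the value at [x] is then a combination, with weights
   independent of [z], of values far along the line through [x]. *)
Lemma continuation us x : exists N (w : nat -> K) (X : nat -> VC),
  (forall j, simple_spectrum (X j)) /\
  forall z, raw us x (init x) z * ee (- x) z =
    \sum_(j < N) w j * (raw us (X j) (init (X j)) z * ee (- X j) z).
Proof.
have [T hT] := raw_exponents us; have [k0 hk] := simple_spectrum_line x.
have [|p hp] := @shift_weights K [seq ee xi (toC separating) | xi <- T] k0.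
  by apply/allP => _ /mapP[xi _ ->]; exact: ee_neq0.
exists (size p), (fun j => p`_j), (fun j => x + (k0 + j)%:R *: toC separating); split.
  by move=> j; apply: hk; rewrite leq_addr.
move=> z; have [s sT hs] := hT z.
have hb (i : K * VC) : i \in s -> p.[ee i.2 (toC separating)] * ee i.2 (toC separating) ^+ k0 = 1.
  by move=> /sT iT; exact: (hp _ (map_f (fun xi => ee xi (toC separating)) iT)).
apply: etrans (hs x) _; apply: etrans (exp_sum_shift (fun i => i.1 * ee i.2 x) hb) _.
apply: eq_bigr => j _; congr (_ * _); apply/esym; apply: etrans (hs _) _.
by apply: eq_bigr => i _; rewrite eeDr eeMn mulrA.
Qed.

Section Eigenfunction.
Context (S : seq V) (uS : uniq (0 :: S)) (hS : forall u, zint (u - rho) -> u \in 0 :: S).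

Definition eigenf x : VC -> K := sops x [seq ms (x + toC u) | u <- S] (init x).

Let gi x : good x (init x). Proof. exact: good_init. Qed.

Lemma good_eigenf x : good x (eigenf x).
Proof. exact/good_sops. Qed.

(** With the shift 0 adjoined, the product kills [init x] when the spectrum is simple;
    [continuation] carries this vanishing to every [x]. *)
Lemma eigenfE x : DD x (eigenf x) = (fun z => ms x * eigenf x z).
Proof.
have ss x' : simple_spectrum x' -> forall z, generic z -> raw (0 :: S) x' (init x') z = 0.
  by move=> hx' z gz; rewrite raw_sops // simple_spectrum_kill.
apply: (good_eq (good_DD (good_eigenf x)) (goodZ (ms x) (good_eigenf x))).
move=> z gz; apply/eqP; rewrite -subr_eq0; apply/eqP.
have [N [w [X [hX e]]]] := continuation (0 :: S) x.
have alg (a b : K) : a * (0 * b) = 0 by rewrite mul0r mulr0.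
have e0 : raw (0 :: S) x (init x) z * ee (- x) z = 0.
  by rewrite e; apply: big1 => j _; rewrite (ss _ (hX j) z gz).
have alg2 (a b : K) : b != 0 -> a * b = 0 -> a = 0.
  by move=> b0 /eqP; rewrite mulf_eq0 (negbTE b0) orbF => /eqP.
have h0 := alg2 _ _ (ee_neq0 _ _ _ _) e0.
have := raw_sops (0 :: S) (gi x) gz; rewrite h0 /= /shifted_DD toC0 addr0.
by move=> /esym.
Qed.

(** Once the factor [ee x] is removed, [continuation] makes [eigenf x] a combination of functions
    with exponents among the same integral points of the zonotope. *)
Lemma eigenf_support x : sp [set xi | exists2 w, zint w & xi = x + toC w] (eigenf x).
Proof.
pose P x : set VC := [set xi | exists2 w, zint w & xi = x + toC w].
have ss x' : simple_spectrum x' -> sp (P x') (eigenf x').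
  by move=> hx'; apply: (simple_spectrum_support hx' (good_eigenf x') (eigenfE x')).
have [N [w [X [hX e]]]] := continuation S x.
pose E z := \sum_(j < N) w j * (eigenf (X j) z * ee (- X j) z).
have sE : sp (P 0) E.
  apply: sp_sum => j _; apply: spZ.
  apply: spM (ss _ (hX j)) (sp_ee G logq (erefl : [set - X j] (- X j))).
  by move=> _ _ [u zu ->] ->; exists u => //; rewrite add0r addrAC subrr add0r.
have sF : sp (P x) (fun z => ee x z * E z).
  apply: spM (sp_ee G logq (erefl : [set x] x)) sE.
  by move=> _ _ -> [u zu ->]; exists u => //; rewrite add0r.
have [gs _] := good_eigenf x.
apply: (sp_ext _ sF); apply: (sp_eq_generic hG hq hroot sF gs) => z gz.
have -> : E z = raw S x (init x) z * ee (- x) z.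
  by rewrite e; apply: eq_bigr => j _; rewrite raw_sops.
by rewrite raw_sops // eeN mulrCA mulfV ?mulr1 // ee_neq0.
Qed.

(** In the direction [- v] the vector [rl] is [- rho], so the operator acts on the lowest exponent
    [x - rho] by [ms x]. *)
Lemma eigenf_lowest x : cf (eigenf x) (x - toC rho) = \prod_(u <- S) (ms x - ms (x + toC u)).
Proof.
have gN : gen (- v) by exact: genN.
have rN : rl (- v) = - rho.
  rewrite /half_sum (big_oppPhi hG hroot) -sumrN big_seq_cond [RHS]big_seq_cond.
  apply: eq_big => [b|b /andP[bP _]]; first by rewrite dotpNl dotpNr opprK.
  by rewrite (mN hG hroot hm) // crN scalerN.
have [_ ->] := sops_lead [seq ms (x + toC u) | u <- S] (gi x) gN (lead_init x).
by rewrite mulr1 big_map rN toCN opprK subrK.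
Qed.

End Eigenfunction.
End Continuation.

End Spectrum.

(** * Translation into the notions of the statement *)

Lemma cf_expand_seq (R : realType) (n : nat) (G : 'M[R]_n) (hG : scalar_product G) (logq : R[i])
  (hq : forall k : nat, (0 < k)%N -> cexp logq ^+ k != 1) (P : set 'rV[R[i]]_n) (f : 'rV[R[i]]_n -> R[i])
  (r : seq 'rV[R[i]]_n) : sp G logq P f -> uniq r -> (forall xi, P xi -> xi \in r) ->
  forall z, f z = \sum_(xi <- r) cf G logq f xi * expc G logq xi z.
Proof.
move=> fP ur hr z; have [t [ut tE ->]] := cf_expand hG hq fP.
rewrite (perm_big [seq xi <- r | cf G logq f xi != 0]) /=; last first.
  apply: uniq_perm => // [|xi]; first exact: filter_uniq.
  rewrite mem_filter tE; case: (boolP (_ == 0)) => //= xi0.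
  by rewrite hr //; exact: (cf_in hG hq fP xi0).
rewrite big_filter big_mkcond; apply: eq_bigr => xi _.
by case: eqP => //= ->; rewrite mul0r.
Qed.

Theorem theorem3p7 (R : realType) (n : nat) (G : 'M[R]_n)
  (hG : scalar_product G)
  (Phi Pos : {fset 'rV[R]_n})
  (hroot : root_system G Phi) (hred : reduced Phi)
  (hirr : irreducible_roots G Phi) (hpos : positive_roots G Phi Pos)
  (q logq : R[i]) (hq0 : q != 0) (hlog : cexp logq = q)
  (hq : forall k : nat, (0 < k)%N -> q ^+ k != 1)
  (m : 'rV[R]_n -> nat) (hm : weyl_invariant G Phi m)
  (omega : 'rV[R]_n) (homega : quasi_or_minuscule G Phi omega) :
  exists c : 'rV[R]_n -> 'rV[R[i]]_n -> R[i],
    let psi := BA_form G Phi Pos m logq c in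
    let mw := orbit_sum G Phi logq omega in
    let lowest := fun x : 'rV[R[i]]_n =>
      \big[*%R/1]_(nu \in shifts G Pos m) (mw x - mw (x + toC nu)) in
    [/\ (* (i) *)
        forall x z, generic G Phi logq z ->
          psi_op G Phi Pos m logq omega x z = psi x z,
        (* (ii) *)
        (forall x, c (- rhov G Pos m) x = lowest x) /\
          (exists x, lowest x != 0),
        (* (iii) *)
        Baker_Akhiezer G Phi Pos m logq psi &
        (* (iv) *)
        forall x z, generic G Phi logq z ->
          macdonald G Phi Pos m logq omega (psi x) z = mw x * psi x z].
Proof.
have hq' k : (0 < k)%N -> cexp logq ^+ k != 1 by rewrite hlog; exact: hq.
have hm' a b : a \in Phi -> b \in Phi -> m (refl G a b) = m b.
  by move=> aP bP; apply: (hm (refl G a \o id)) => //; apply: weyl_refl => //; exact: weyl_id.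
have [v [gv hPos]] := hpos.
pose rho := half_sum G Phi m v.
have rhoE : rhov G Pos m = rho by exact: rhov_rl hPos.
have shE := shiftsE hG hroot hm' gv hPos.
have [r hr] := zint_bounded_seq G Phi m.
have fin : finite_set (shifts G Pos m).
  apply: (@sub_finite_set _ _ [set` [seq w + rho | w <- r]]); last exact: finite_seq.
  by move=> nu /shE[_ /hr h] /=; apply/mapP; exists (nu - rho); rewrite ?subrK.
pose S : seq 'rV[R]_n := fset_set (shifts G Pos m).
have memS nu : (nu \in S) <-> shifts G Pos m nu.
  by rewrite /S in_fset_set //; split; [move/set_mem|move/mem_set].
have uS : uniq (0 :: S).
  by rewrite /= fset_uniq andbT; apply/negP => /memS/shE[]; rewrite eqxx.
have hS u : signed_half_sum G Phi m (u - rho) -> u \in 0 :: S.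
  by move=> zu; rewrite inE; case: eqP => //= /eqP u0; apply/memS/shE.
pose F := eigenf hG hq' hroot hred hm' homega gv Pos S.
have gF x : good G logq Phi m v x (F x) := good_eigenf hG hq' hroot hred hm' homega gv hPos S x.
have sF x : sp G logq [set xi | exists2 w, signed_half_sum G Phi m w & xi = x + toC w] (F x).
  exact: eigenf_support.
have finO := finite_orbit hroot omega.
have mwE x : orbit_sum G Phi logq omega x = orbit_char G logq Phi omega x.
  exact: fsbig_finite.
have macE f z : macdonald G Phi Pos m logq omega f z = dual_macdonald G logq Phi m omega
    (\sum_(tau <- Orb G Phi omega) qpow logq (- (2 * dotp G rho tau))%:C) f z.
  rewrite /macdonald /dual_macdonald !fsbig_finite //; congr (_ + _ * _).
  by apply: eq_bigr => tau _; rewrite rhoE rcN rcM rc_nat.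
have opE x nu : shifted_op G Phi Pos m logq omega x nu = (fun f z => dual_macdonald G logq Phi m omega
    (\sum_(tau <- Orb G Phi omega) qpow logq (- (2 * dotp G rho tau))%:C) f z
    - orbit_char G logq Phi omega (x + toC nu) * f z).
  by apply/funext => f; apply/funext => z; rewrite /shifted_op macE mwE.
have opsE x (s : seq 'rV[R]_n) g :
    (\big[(fun F1 F2 => F1 \o F2)/id]_(nu <- s) shifted_op G Phi Pos m logq omega x nu) g =
    raw G logq Phi m omega v s x g.
  by elim: s => [|u s IH]; rewrite ?big_nil ?big_cons //= IH opE.
have psiE x z : generic G Phi logq z -> psi_op G Phi Pos m logq omega x z = F x z.
  move=> gz; apply: etrans (congr1 (@^~ z) (opsE x _ _)) _.
  exact: (raw_sops hG hq' hroot hred hm' homega gv S (good_init hG logq hroot hm' gv hPos x) gz).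
exists (fun nu x => cf G logq (F x) (x + toC nu)) => psi mw lowest.
have psiF x z : psi x z = F x z.
  pose zs := undup [seq w <- r | `[< signed_half_sum G Phi m w >]].
  have zsP w : signed_half_sum G Phi m w <-> w \in zs.
    rewrite mem_undup mem_filter; split; last by case/andP => /asboolP.
    by move=> zw; rewrite hr // andbT; apply/asboolP.
  have tinj : injective (fun w : 'rV[R]_n => x + toC w) by move=> u w /addrI/toC_inj.
  rewrite (@cf_expand_seq R n G hG logq hq' _ _ [seq x + toC w | w <- zs] (sF x)); last first.
  - by move=> _ [w /zsP zw ->]; exact: map_f.
  - by rewrite map_inj_uniq ?undup_uniq.
  (* The index set of [BA_form] contains the integral points; at any further point the coefficient
     is 0. *)
  rewrite big_map /psi /BA_form -(fsbig_widen [set` zs]).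
  - rewrite -fsbig_seq ?undup_uniq // mulr_sumr; apply: eq_bigr => w _.
    by rewrite eeD mulrCA.
  - move=> w /= /zsP zw; split; first exact: (zint_polytope hG hroot gv hPos zw).
    exact: (zint_coweight hG hroot hred hm' zw).
  - move=> w /= [_ nw]; rewrite (cf_out hG hq' (sF x)) ?mul0r // => -[w' zw' /addrI/toC_inj e].
    by apply: nw; apply/zsP; rewrite e.
have lowE x : cf G logq (F x) (x + toC (- rhov G Pos m)) = lowest x.
  rewrite rhoE toCN eigenf_lowest // /lowest fsbig_finite //.
  by apply: eq_bigr => u _; rewrite /mw !mwE.
(* Both 0 and [nu] are spectral offsets, so at a point of simple spectrum [m_omega x] differs from
   every [m_omega (x + nu)]. *)
have low0 : exists x, lowest x != 0.
  have [k0 hk] := simple_spectrum_line hG hq' hroot hm' homega gv hirr 0.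
  exists (0 + k0%:R *: toC (separating hG hroot homega)); rewrite -lowE rhoE toCN eigenf_lowest //.
  rewrite prodf_seq_neq0; apply/allP => u /memS/shE[u0 zu] /=.
  rewrite subr_eq0; apply/eqP => e; move/eqP: u0; apply; apply/esym.
  apply: (hk _ (leqnn _)).
  - exact: (zint2_offset hG hroot hm' gv (zint2_0 hG hroot hm' gv)).
  (* Central symmetry of the zonotope makes [rho - u] integral, and [u = rho + 0 - (rho - u)]. *)
  - exists 0, (- (u - rho)); split.
    + exact: (zint2_0 hG hroot hm' gv).
    + exact: (zint_opp hG hroot zu).
    + by rewrite addr0 opprK [RHS]addrC subrK.
  - by rewrite toC0 addr0.
split; last 1 first.
- move=> x z gz; rewrite /mw mwE macE psiF.
  have -> : psi x = F x by apply/funext => t.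
  by rewrite -(DDE hG hq' hroot hred hm' homega gv (gF x) gz) eigenfE.
- by move=> x z gz; rewrite psiF psiE.
- by split; [exact: lowE|exact: low0].
- split.
  + have [x x0] := low0; exists x; apply: contrapT => H.
    move/eqP: x0; apply; rewrite -lowE.
    rewrite -[RHS](cf0 hG hq' (x + toC (- rhov G Pos m))); congr (cf _ _ _ _).
    apply/funext => z; rewrite -psiF; apply/eqP/negPn/negP => h.
    by apply: H; exists z.
  + by eexists.
  + by move=> a s x z aP hs hz; rewrite !psiF; have [_ h] := gF x; exact: h.
Qed.
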